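(* For a finitely generated abelian group $A$ and every $n\ge 0$ there is a natural filtration of $H^n(A,\mathbb F_2)$ by subfunctors (of the functor $A\mapsto H^n(A,\mathbb F_2)$ on finitely generated abelian groups) $$H^n(A,\mathbb F_2)=\Phi^0\supseteq\Phi^1\supseteq\dots\supseteq\Phi^{\lfloor n/2\rfloor+1}=0$$ such that there are natural isomorphisms $$\Phi^i/\Phi^{i+1}\cong \Lambda^{n-2i}((A/2)^\vee)\otimes \mathrm{Sym}^i(({}_2A)^\vee)\qquad (0\le i\le\lfloor n/2\rfloor).$$
   Context: $H^n(A,\mathbb F_2)$ is the $n$-th cohomology of the group $A$. $A/2=A/2A$, ${}_2A=\{a\in A\mid 2a=0\}$, $(-)^\vee$ is the $\mathbb F_2$-linear dual; $\Lambda^k$ and $\mathrm{Sym}^k$ are the $k$-th exterior and symmetric powers over $\mathbb F_2$, and $\otimes$ is over $\mathbb F_2$. *)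

(* Defs.v *)
From HB Require Import structures.
From mathcomp Require Import all_boot all_order all_algebra perm ring_quotient finmap.
From mathcomp Require Import boolp functions.
From mathcomp.multinomials Require Import monalg.

Set Implicit Arguments.
Unset Strict Implicit.
Unset Printing Implicit Defensive.

Import GRing.Theory.

Local Open Scope ring_scope.
Local Open Scope quotient_scope.

Section Submodules.
Variables (R : pzRingType) (V : lmodType R).

Definition submodule (M : submodClosed V) : Type := {x : V | x \in M}.

HB.instance Definition _ (M : submodClosed V) :=
  SubChoice.copy (submodule M) {x : V | x \in M}.
HB.instance Definition _ (M : submodClosed V) :=
  [SubChoice_isSubLmodule of submodule M by <:].

Definition span (S : V -> Prop) : {pred V} := fun x =>
  `[< forall M : submodClosed V, (forall y, S y -> y \in M) -> x \in M >].

Lemma mem_span S x : S x -> x \in span S.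
Proof. by move=> Sx; apply/asboolP => M SM; apply: SM. Qed.

Lemma span_min S (M : submodClosed V) :
  (forall y, S y -> y \in M) -> {subset span S <= M}.
Proof. by move=> SM x /asboolP; apply. Qed.

Fact span_submod_closed S : submod_closed (span S).
Proof.
split=> [|a x y /asboolP hx /asboolP hy]; apply/asboolP=> M SM.
  exact: rpred0.
by rewrite rpredD ?rpredZ ?hx ?hy.
Qed.

HB.instance Definition _ S :=
  GRing.isSubmodClosed.Build R V (span S) (span_submod_closed S).

Definition within (M N : submodClosed V) : {pred submodule M} :=
  fun x => val x \in N.

Fact within_submod_closed M N : submod_closed (@within M N).
Proof.
split=> [|a x y hx hy]; rewrite unfold_in; first by rewrite raddf0 rpred0.
by rewrite linearP rpredD ?rpredZ.
Qed.

HB.instance Definition _ M N :=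
  GRing.isSubmodClosed.Build R (submodule M) (@within M N)
    (within_submod_closed M N).

End Submodules.

Arguments within {R V} M N _.

Section QuotientModule.
Variables (R : pzRingType) (V : lmodType R) (M : submodClosed V).

(* The structure submodClosed does not carry closure under opposites. *)
Definition underlying_zmod : {pred V} := fun x => x \in M.

Fact underlying_zmod_closed : zmod_closed underlying_zmod.
Proof. exact: GRing.submod_closedB (submodClosedP M). Qed.

HB.instance Definition _ :=
  GRing.isZmodClosed.Build V underlying_zmod underlying_zmod_closed.

Definition quotient : Type := Quotient.quot underlying_zmod.

HB.instance Definition _ := GRing.Zmodule.on quotient.
HB.instance Definition _ := EqQuotient.on quotient.

Definition quotient_pi (x : V) : quotient := \pi_quotient x.

Lemma quotient_eq x y : (quotient_pi x == quotient_pi y) = (x - y \in M).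
Proof. exact/esym/(Quotient.idealrBE underlying_zmod). Qed.

Lemma quotient_reprK (x : quotient) : quotient_pi (repr x) = x.
Proof. exact: reprK. Qed.

Fact quotient_pi_is_additive : zmod_morphism quotient_pi.
Proof. exact: (pi_is_zmod_morphism (Quotient.quot underlying_zmod)). Qed.

HB.instance Definition _ :=
  GRing.isZmodMorphism.Build V quotient quotient_pi quotient_pi_is_additive.

Definition quotient_scale (a : R) (x : quotient) : quotient :=
  quotient_pi (a *: repr x).

Lemma quotient_scaleE a x : quotient_scale a (quotient_pi x) = quotient_pi (a *: x).
Proof.
apply/eqP; rewrite quotient_eq -scalerBr rpredZ // -quotient_eq.
by rewrite quotient_reprK.
Qed.

Fact quotient_scaleA a b x :
  quotient_scale a (quotient_scale b x) = quotient_scale (a * b) x.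
Proof. by rewrite -[x]quotient_reprK !quotient_scaleE scalerA. Qed.

Fact quotient_scale1 : left_id 1 quotient_scale.
Proof. by move=> x; rewrite -[x]quotient_reprK quotient_scaleE scale1r. Qed.

Fact quotient_scaleDr : right_distributive quotient_scale +%R.
Proof.
move=> a x y; rewrite -[x]quotient_reprK -[y]quotient_reprK.
by rewrite -raddfD !quotient_scaleE scalerDr raddfD.
Qed.

Fact quotient_scaleDl x : {morph quotient_scale^~ x : a b / a + b}.
Proof.
by move=> a b; rewrite -[x]quotient_reprK !quotient_scaleE scalerDl raddfD.
Qed.

HB.instance Definition _ := GRing.Zmodule_isLmodule.Build R quotient
  quotient_scaleA quotient_scale1 quotient_scaleDr quotient_scaleDl.

Fact quotient_pi_is_scalable : scalable quotient_pi.
Proof. by move=> a x; rewrite -quotient_scaleE. Qed.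

HB.instance Definition _ :=
  GRing.isScalable.Build R V quotient *:%R quotient_pi quotient_pi_is_scalable.

End QuotientModule.

Section InducedMaps.
Variables (R : pzRingType) (V W : lmodType R) (f : {linear V -> W}).

Definition submodule_map (M : submodClosed V) (N : submodClosed W)
    (fMN : {in M, forall x, f x \in N}) (x : submodule M) : submodule N :=
  Sub (f (val x)) (fMN _ (valP x)).

Fact submodule_map_is_linear M N fMN : linear (@submodule_map M N fMN).
Proof. by move=> a x y; apply: val_inj; rewrite /= !linearP. Qed.

HB.instance Definition _ M N fMN :=
  GRing.isLinear.Build R (submodule M) (submodule N) *:%R
    (@submodule_map M N fMN) (submodule_map_is_linear fMN).

Definition quotient_map (M : submodClosed V) (N : submodClosed W)
    (fMN : {in M, forall x, f x \in N}) (x : quotient M) : quotient N :=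
  quotient_pi N (f (repr x)).

Lemma quotient_mapE M N fMN x :
  @quotient_map M N fMN (quotient_pi M x) = quotient_pi N (f x).
Proof.
apply/eqP; rewrite quotient_eq -raddfB fMN // -quotient_eq.
by rewrite quotient_reprK.
Qed.

Fact quotient_map_is_linear M N fMN : linear (@quotient_map M N fMN).
Proof.
move=> a x y; rewrite -[x]quotient_reprK -[y]quotient_reprK.
by rewrite -linearP !quotient_mapE !linearP.
Qed.

HB.instance Definition _ M N fMN :=
  GRing.isLinear.Build R (quotient M) (quotient N) *:%R
    (@quotient_map M N fMN) (quotient_map_is_linear fMN).

Lemma span_map (S : V -> Prop) (T : W -> Prop) :
  (forall x, S x -> f x \in span T) -> {in span S, forall x, f x \in span T}.
Proof.
move=> fST; pose P : {pred V} := fun x => f x \in span T.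
have P_submod : submod_closed P.
  split=> [|a x y Px Py]; rewrite unfold_in; first by rewrite raddf0 rpred0.
  by rewrite linearP rpredD ?rpredZ.
pose PM := GRing.isSubmodClosed.Build R V P P_submod.
pose Q : submodClosed V := HB.pack P PM.
by move=> x /(@span_min _ _ _ Q); apply.
Qed.

End InducedMaps.

(* The subquotient M / (M :&: N) of V; N need not be contained in M. *)
Definition subquotient (R : pzRingType) (V : lmodType R) (M N : submodClosed V) :
  lmodType R := quotient (within M N).

Section SubquotientMap.
Variables (R : pzRingType) (V W : lmodType R) (f : {linear V -> W}).
Variables (M N : submodClosed V) (M' N' : submodClosed W).
Hypothesis fM : {in M, forall x, f x \in M'}.
Hypothesis fN : {in N, forall x, f x \in N'}.

Fact submodule_map_within :
  {in within M N, forall x, submodule_map fM x \in within M' N'}.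
Proof. by move=> x; rewrite !unfold_in; apply: fN. Qed.

Definition subquotient_map : {linear subquotient M N -> subquotient M' N'} :=
  quotient_map submodule_map_within.

End SubquotientMap.

Section Dual.
Variable R : comPzRingType.

Definition linear_form (V : lmodType R) : {pred (V -> R^o)} :=
  fun phi => `[< linear phi >].

Fact linear_form_submod_closed V : submod_closed (@linear_form V).
Proof.
split=> [|a phi psi /asboolP Lphi /asboolP Lpsi]; apply/asboolP => b x y /=.
  by rewrite scaler0 addr0.
change (a *: phi (b *: x + y) + psi (b *: x + y) =
  b *: (a *: phi x + psi x) + (a *: phi y + psi y)).
rewrite Lphi Lpsi !scalerDr !scalerA (mulrC a b) -!addrA; congr (_ + _).
by rewrite !addrA; congr (_ + _); rewrite addrC.
Qed.

HB.instance Definition _ (V : lmodType R) :=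
  GRing.isSubmodClosed.Build R (V -> R^o) (@linear_form V)
    (linear_form_submod_closed V).

Definition dual (V : lmodType R) : lmodType R := submodule (@linear_form V).

Definition precomp (V W : lmodType R) (f : {linear V -> W}) (phi : W -> R^o) :
  V -> R^o := phi \o f.

Fact precomp_is_linear (V W : lmodType R) (f : {linear V -> W}) :
  linear (@precomp V W f).
Proof. by []. Qed.

HB.instance Definition _ (V W : lmodType R) (f : {linear V -> W}) :=
  GRing.isLinear.Build R (W -> R^o) (V -> R^o) *:%R (@precomp V W f)
    (precomp_is_linear f).

Fact precomp_linear_form (V W : lmodType R) (f : {linear V -> W}) :
  {in @linear_form W, forall phi, precomp f phi \in @linear_form V}.
Proof.
move=> phi /asboolP Lphi; apply/asboolP => a x y.
by rewrite /precomp /= linearP Lphi.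
Qed.

Definition dual_map (V W : lmodType R) (f : {linear V -> W}) :
  {linear dual W -> dual V} := submodule_map (@precomp_linear_form V W f).

End Dual.

(* {malg R[X]} is used only as the free R-module on X, with basis << x >>. *)
Section FreeModule.
Variables (R : nzRingType) (X Y : choiceType) (h : X -> Y).

Definition free_map (g : {malg R[X]}) : {malg R[Y]} :=
  \sum_(x <- msupp g) << g@_x *g h x >>.

Lemma free_mapEw (g : {malg R[X]}) (D : {fset X}) : (msupp g `<=` D)%fset ->
  free_map g = \sum_(x <- D) << g@_x *g h x >>.
Proof.
move=> gD; apply: big_fset_incl => // x _ /mcoeff_outdom ->.
exact: monalgU0.
Qed.

Fact free_map_is_linear : linear free_map.
Proof.
move=> a g1 g2; pose D := (msupp g1 `|` msupp g2)%fset.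
have D1 : (msupp g1 `<=` D)%fset by apply: fsubsetUl.
have D2 : (msupp g2 `<=` D)%fset by apply: fsubsetUr.
have D3 : (msupp (a *: g1 + g2) `<=` D)%fset.
  apply: fsubset_trans (msuppD_le _ _) _; rewrite fsubUset D2 andbT.
  exact: fsubset_trans (msuppZ_le _ _) D1.
rewrite (free_mapEw D1) (free_mapEw D2) (free_mapEw D3) scaler_sumr.
rewrite -big_split; apply: eq_bigr => x _ /=.
rewrite mcoeffD mcoeffZ monalgUD; congr (_ + _).
by apply/malgP => y; rewrite mcoeffZ !mcoeffU mulrnAr.
Qed.

HB.instance Definition _ :=
  GRing.isLinear.Build R {malg R[X]} {malg R[Y]} *:%R free_map
    free_map_is_linear.

Lemma free_mapU x : free_map << x >> = << h x >>.
Proof. by rewrite (free_mapEw msuppU_le) big_seq_fset1 mcoeffUU. Qed.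

End FreeModule.

Section TensorProduct.
Variable R : comNzRingType.

Variant bilinear_rel (V W : lmodType R) : {malg R[(V * W)%type]} -> Prop :=
| BilinearL a v v' w :
    bilinear_rel (<< (a *: v + v', w) >> - a *: << (v, w) >> - << (v', w) >>)
| BilinearR a v w w' :
    bilinear_rel (<< (v, a *: w + w') >> - a *: << (v, w) >> - << (v, w') >>).

Definition tensor (V W : lmodType R) : lmodType R :=
  quotient (span (@bilinear_rel V W)).

Section Map.
Variables (V V' W W' : lmodType R).
Variables (f : {linear V -> V'}) (g : {linear W -> W'}).

Definition tensor_gen_map (u : V * W) : V' * W' := (f u.1, g u.2).

Fact tensor_rel_map : {in span (@bilinear_rel V W), forall x,
  free_map tensor_gen_map x \in span (@bilinear_rel V' W')}.
Proof.
apply: span_map => _ [a v v' w|a v w w'].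
  rewrite !raddfB /= linearZ /= !free_mapU /tensor_gen_map /= linearP.
  exact/mem_span/BilinearL.
rewrite !raddfB /= linearZ /= !free_mapU /tensor_gen_map /= linearP.
exact/mem_span/BilinearR.
Qed.

Definition tensor_map : {linear tensor V W -> tensor V' W'} :=
  quotient_map tensor_rel_map.

End Map.
End TensorProduct.

Section ExteriorSymmetricPowers.
Variables (R : comNzRingType) (k : nat).

Definition with_entry (T : Type) (v : {ffun 'I_k -> T}) (i : 'I_k) (x : T) :
  {ffun 'I_k -> T} := [ffun j => if j == i then x else v j].

Definition multilinear_rel (V : lmodType R) (i : 'I_k) (a : R)
    (v : {ffun 'I_k -> V}) (x y : V) : {malg R[{ffun 'I_k -> V}]} :=
  << with_entry v i (a *: x + y) >> - a *: << with_entry v i x >>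
    - << with_entry v i y >>.

Variant exterior_rel (V : lmodType R) : {malg R[{ffun 'I_k -> V}]} -> Prop :=
| ExteriorMultilinear i a v x y : exterior_rel (multilinear_rel i a v x y)
| ExteriorAlternating (v : {ffun 'I_k -> V}) i j of i != j & v i = v j :
    exterior_rel << v >>.

Variant symmetric_rel (V : lmodType R) : {malg R[{ffun 'I_k -> V}]} -> Prop :=
| SymmetricMultilinear i a v x y : symmetric_rel (multilinear_rel i a v x y)
| SymmetricPerm (v : {ffun 'I_k -> V}) (s : 'S_k) :
    symmetric_rel (<< v >> - << [ffun j => v (s j)] >>).

Definition exterior (V : lmodType R) : lmodType R :=
  quotient (span (@exterior_rel V)).

Definition symmetric (V : lmodType R) : lmodType R :=
  quotient (span (@symmetric_rel V)).

Section Map.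
Variables (V W : lmodType R) (f : {linear V -> W}).

Definition power_gen_map (v : {ffun 'I_k -> V}) : {ffun 'I_k -> W} :=
  [ffun j => f (v j)].

Lemma power_gen_map_with_entry v i x :
  power_gen_map (with_entry v i x) = with_entry (power_gen_map v) i (f x).
Proof. by apply/ffunP => j; rewrite !ffunE; case: ifP. Qed.

Lemma free_map_multilinear_rel i a v x y :
  free_map power_gen_map (multilinear_rel i a v x y) =
  multilinear_rel i a (power_gen_map v) (f x) (f y).
Proof.
by rewrite !raddfB /= linearZ /= !free_mapU !power_gen_map_with_entry linearP.
Qed.

Fact exterior_rel_map : {in span (@exterior_rel V), forall x,
  free_map power_gen_map x \in span (@exterior_rel W)}.
Proof.
apply: span_map => _ [i a v x y|v i j ij vij]; apply: mem_span.
  by rewrite /= free_map_multilinear_rel; left.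
by rewrite /= free_mapU; right with i j; rewrite // !ffunE vij.
Qed.

Definition exterior_map : {linear exterior V -> exterior W} :=
  quotient_map exterior_rel_map.

Fact symmetric_rel_map : {in span (@symmetric_rel V), forall x,
  free_map power_gen_map x \in span (@symmetric_rel W)}.
Proof.
apply: span_map => _ [i a v x y|v s]; apply: mem_span.
  by rewrite /= free_map_multilinear_rel; left.
rewrite raddfB /= !free_mapU.
have -> : power_gen_map [ffun j => v (s j)] = [ffun j => power_gen_map v (s j)].
  by apply/ffunP => j; rewrite !ffunE.
by right.
Qed.

Definition symmetric_map : {linear symmetric V -> symmetric W} :=
  quotient_map symmetric_rel_map.

End Map.
End ExteriorSymmetricPowers.

Section GroupCohomology.
Variable R : comNzRingType.

(* Inhomogeneous cochains of the additive group A with coefficients in the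
   trivial module R. *)
Definition cochain (A : zmodType) (n : nat) : lmodType R :=
  ({ffun 'I_n -> A} -> R^o).

(* The i-th face of (a_0, ..., a_n) is (a_1, ..., a_n) for i = 0,
   (a_0, ..., a_(i-1) + a_i, ..., a_n) for 0 < i < n.+1, and
   (a_0, ..., a_(n-1)) for i = n.+1. *)
Definition bar_face (A : zmodType) (n : nat) (i : 'I_n.+2)
    (a : {ffun 'I_n.+1 -> A}) : {ffun 'I_n -> A} :=
  [ffun j : 'I_n =>
    if (j.+1 < i)%N then a (widen_ord (leqnSn n) j)
    else if j.+1 == i then a (widen_ord (leqnSn n) j) + a (lift ord0 j)
    else a (lift ord0 j)].

Definition coboundary (A : zmodType) (n : nat) (c : cochain A n) :
    cochain A n.+1 :=
  fun a => \sum_(i < n.+2) (-1) ^+ i * c (bar_face i a).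

Fact coboundary_is_linear (A : zmodType) n : linear (@coboundary A n).
Proof.
move=> b c1 c2; apply: funext => a.
change (\sum_(i < n.+2)
          (-1) ^+ i * (b * c1 (bar_face i a) + c2 (bar_face i a)) =
  b * (\sum_(i < n.+2) (-1) ^+ i * c1 (bar_face i a)) +
  \sum_(i < n.+2) (-1) ^+ i * c2 (bar_face i a)).
rewrite mulr_sumr -big_split; apply: eq_bigr => i _ /=.
by rewrite mulrDr !mulrA [_ * b]mulrC.
Qed.

HB.instance Definition _ (A : zmodType) (n : nat) :=
  GRing.isLinear.Build R (cochain A n) (cochain A n.+1) *:%R
    (@coboundary A n) (@coboundary_is_linear A n).

Definition cocycles (A : zmodType) (n : nat) : {pred cochain A n} :=
  fun c => coboundary c == 0.

Definition coboundaries (A : zmodType) (n : nat) : {pred cochain A n} :=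
  match n with
  | 0 => fun c => c == 0
  | m.+1 => fun c => `[< exists b : cochain A m, c = coboundary b >]
  end.

Fact cocycles_submod_closed A n : submod_closed (@cocycles A n).
Proof.
split=> [|b x y /eqP hx /eqP hy]; rewrite unfold_in; first by rewrite raddf0.
by rewrite linearP /= hx hy scaler0 addr0.
Qed.

Fact coboundaries_submod_closed A n : submod_closed (@coboundaries A n).
Proof.
case: n => [|n]; split=> [|b x y].
- exact: eqxx.
- by move=> /eqP -> /eqP ->; rewrite unfold_in scaler0 addr0.
- by apply/asboolP; exists 0; rewrite raddf0.
- move=> /asboolP[u ->] /asboolP[v ->]; apply/asboolP; exists (b *: u + v).
  by rewrite linearP.
Qed.

HB.instance Definition _ (A : zmodType) (n : nat) :=
  GRing.isSubmodClosed.Build R (cochain A n) (@cocycles A n)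
    (@cocycles_submod_closed A n).
HB.instance Definition _ (A : zmodType) (n : nat) :=
  GRing.isSubmodClosed.Build R (cochain A n) (@coboundaries A n)
    (@coboundaries_submod_closed A n).

Definition cohomology (n : nat) (A : zmodType) : lmodType R :=
  subquotient (@cocycles A n) (@coboundaries A n).

Section Map.
Variables (A B : zmodType) (f : {additive A -> B}) (n : nat).

Definition cochain_map (m : nat) (c : cochain B m) : cochain A m :=
  fun a => c [ffun j => f (a j)].

Fact cochain_map_is_linear m : linear (@cochain_map m).
Proof. by []. Qed.

HB.instance Definition _ m :=
  GRing.isLinear.Build R (cochain B m) (cochain A m) *:%R (@cochain_map m)
    (@cochain_map_is_linear m).

Lemma coboundary_cochain_map m (c : cochain B m) :
  coboundary (cochain_map c) = cochain_map (coboundary c).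
Proof.
apply: funext => a; apply: eq_bigr => i _; congr (_ * c _).
apply/ffunP => j; rewrite !ffunE.
by case: ifP => // _; case: ifP => // _; rewrite raddfD.
Qed.

Fact cochain_map_cocycles :
  {in @cocycles B n, forall c, cochain_map c \in @cocycles A n}.
Proof.
by move=> c /eqP dc0; rewrite unfold_in coboundary_cochain_map dc0 raddf0.
Qed.

Fact cochain_map_coboundaries :
  {in @coboundaries B n, forall c, cochain_map c \in @coboundaries A n}.
Proof.
case: n => [|m] c; first by move=> /eqP ->; rewrite raddf0 unfold_in.
move=> /asboolP[b ->]; apply/asboolP; exists (cochain_map b).
by rewrite coboundary_cochain_map.
Qed.

Definition cohomology_map : {linear cohomology n B -> cohomology n A} :=
  subquotient_map cochain_map_cocycles cochain_map_coboundaries.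

End Map.
End GroupCohomology.

Section ElementaryAbelian2.
Variable A : zmodType.
Hypothesis A2 : forall x : A, x *+ 2 = 0.

Definition F2_scale (a : 'F_2) (x : A) : A := x *+ a.

Lemma mulrn_mod2 (x : A) n : x *+ (n %% 2) = x *+ n.
Proof.
by rewrite [in RHS](divn_eq n 2) mulrnDr mulnC mulrnA A2 mul0rn add0r.
Qed.

Fact F2_scaleA a b x : F2_scale a (F2_scale b x) = F2_scale (a * b) x.
Proof. by rewrite /F2_scale -mulrnA mulnC [RHS]mulrn_mod2. Qed.

Fact F2_scale1 : left_id 1 F2_scale.
Proof. by []. Qed.

Fact F2_scaleDr : right_distributive F2_scale +%R.
Proof. by move=> a x y; rewrite /F2_scale mulrnDl. Qed.

Fact F2_scaleDl x : {morph F2_scale^~ x : a b / a + b}.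
Proof. by move=> a b; rewrite /F2_scale -mulrnDr [LHS]mulrn_mod2. Qed.

End ElementaryAbelian2.

Section Mod2.
Variable A : zmodType.

Definition doubles : {pred A} := fun x => `[< exists y, x = y *+ 2 >].

Fact doubles_zmod_closed : zmod_closed doubles.
Proof.
split=> [|_ _ /asboolP[x ->] /asboolP[y ->]]; apply/asboolP.
  by exists 0; rewrite mul0rn.
by exists (x - y); rewrite mulrnBl.
Qed.

HB.instance Definition _ :=
  GRing.isZmodClosed.Build A doubles doubles_zmod_closed.

Definition mod2 : Type := Quotient.quot doubles.

HB.instance Definition _ := GRing.Zmodule.on mod2.
HB.instance Definition _ := EqQuotient.on mod2.

Definition mod2_pi (x : A) : mod2 := \pi_mod2 x.

Lemma mod2_eq x y : (mod2_pi x == mod2_pi y) = (x - y \in doubles).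
Proof. exact/esym/(Quotient.idealrBE doubles). Qed.

Lemma mod2_reprK (x : mod2) : mod2_pi (repr x) = x.
Proof. exact: reprK. Qed.

Fact mod2_pi_is_additive : zmod_morphism mod2_pi.
Proof. exact: (pi_is_zmod_morphism (Quotient.quot doubles)). Qed.

HB.instance Definition _ :=
  GRing.isZmodMorphism.Build A mod2 mod2_pi mod2_pi_is_additive.

Fact mod2_mulr2n (x : mod2) : x *+ 2 = 0.
Proof.
rewrite -[x]mod2_reprK -raddfMn -(raddf0 mod2_pi).
by apply/eqP; rewrite mod2_eq subr0; apply/asboolP; exists (repr x).
Qed.

HB.instance Definition _ := GRing.Zmodule_isLmodule.Build 'F_2 mod2
  (F2_scaleA mod2_mulr2n) (@F2_scale1 mod2) (@F2_scaleDr mod2)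
  (F2_scaleDl mod2_mulr2n).

End Mod2.

Section Torsion2.
Variable A : zmodType.

Definition killed_by2 : {pred A} := fun x => x *+ 2 == 0.

Fact killed_by2_zmod_closed : zmod_closed killed_by2.
Proof.
split=> [|x y /eqP x2 /eqP y2]; rewrite unfold_in; first by rewrite mul0rn.
by rewrite mulrnBl x2 y2 subr0.
Qed.

HB.instance Definition _ :=
  GRing.isZmodClosed.Build A killed_by2 killed_by2_zmod_closed.

Definition torsion2 : Type := {x : A | x \in killed_by2}.

HB.instance Definition _ := SubChoice.copy torsion2 {x : A | x \in killed_by2}.
HB.instance Definition _ := [SubChoice_isSubZmodule of torsion2 by <:].

Fact torsion2_mulr2n (x : torsion2) : x *+ 2 = 0.
Proof. by apply: val_inj; rewrite raddfMn; apply/eqP/(valP x). Qed.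

HB.instance Definition _ := GRing.Zmodule_isLmodule.Build 'F_2 torsion2
  (F2_scaleA torsion2_mulr2n) (@F2_scale1 torsion2) (@F2_scaleDr torsion2)
  (F2_scaleDl torsion2_mulr2n).

End Torsion2.

Section Mod2Torsion2Maps.
Variables (A B : zmodType) (f : {additive A -> B}).

Definition mod2_map (x : mod2 A) : mod2 B := mod2_pi (f (repr x)).

Lemma mod2_mapE x : mod2_map (mod2_pi x) = mod2_pi (f x).
Proof.
apply/eqP; rewrite mod2_eq -raddfB.
have: repr (mod2_pi x) - x \in @doubles A by rewrite -mod2_eq mod2_reprK.
by move=> /asboolP[y ->]; apply/asboolP; exists (f y); rewrite raddfMn.
Qed.

Fact mod2_map_is_linear : linear mod2_map.
Proof.
move=> a x y; rewrite -[x]mod2_reprK -[y]mod2_reprK.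
rewrite /GRing.scale /= /F2_scale -raddfMn -raddfD !mod2_mapE.
by rewrite raddfD raddfMn raddfD raddfMn.
Qed.

HB.instance Definition _ :=
  GRing.isLinear.Build 'F_2 (mod2 A) (mod2 B) *:%R mod2_map mod2_map_is_linear.

Fact torsion2_map_subproof (x : torsion2 A) : f (val x) \in @killed_by2 B.
Proof. by rewrite unfold_in -raddfMn (eqP (valP x)) raddf0. Qed.

Definition torsion2_map (x : torsion2 A) : torsion2 B :=
  Sub (f (val x)) (torsion2_map_subproof x).

Fact torsion2_map_is_linear : linear torsion2_map.
Proof.
move=> a x y; apply: val_inj.
change (f (val (x *+ a + y)) = val (torsion2_map x *+ a + torsion2_map y)).
by rewrite !raddfD !raddfMn.
Qed.

HB.instance Definition _ :=
  GRing.isLinear.Build 'F_2 (torsion2 A) (torsion2 B) *:%R torsion2_map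
    torsion2_map_is_linear.

End Mod2Torsion2Maps.

Definition finitely_generated (A : zmodType) : Prop :=
  exists s : seq A, forall x : A,
    exists c : 'I_(size s) -> int, x = \sum_(i < size s) s`_i *~ c i.

Record fgAbelian := FgAbelian {
  fg_sort :> zmodType;
  fg_finitely_generated : finitely_generated fg_sort
}.

(* A subfunctor of the contravariant functor A |-> H^n(A, F_2) on the category
   of finitely generated abelian groups. *)
Record subfunctor (n : nat) := Subfunctor {
  subfunctor_at :> forall A : fgAbelian, submodClosed (cohomology 'F_2 n A);
  subfunctor_map : forall (A B : fgAbelian) (f : {additive A -> B}),
    {in subfunctor_at B, forall x,
      cohomology_map 'F_2 f n x \in subfunctor_at A}
}.

Definition graded_piece (n : nat) (Phi Psi : subfunctor n) (A : fgAbelian) :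
  lmodType 'F_2 := subquotient (Phi A) (Psi A).

Definition graded_piece_map (n : nat) (Phi Psi : subfunctor n)
    (A B : fgAbelian) (f : {additive A -> B}) :
  {linear graded_piece Phi Psi B -> graded_piece Phi Psi A} :=
  subquotient_map (@subfunctor_map n Phi A B f) (@subfunctor_map n Psi A B f).

(* Lambda^j((A/2)^dual) (x) Sym^i((_2 A)^dual), contravariant in A. *)
Definition ext_sym (j i : nat) (A : fgAbelian) : lmodType 'F_2 :=
  tensor (exterior j (dual (mod2 A))) (symmetric i (dual (torsion2 A))).

Definition ext_sym_map (j i : nat) (A B : fgAbelian) (f : {additive A -> B}) :
  {linear ext_sym j i B -> ext_sym j i A} :=
  tensor_map (exterior_map j (dual_map (mod2_map f)))
    (symmetric_map i (dual_map (torsion2_map f))).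

(* Main.v *)
(* Write F2 for the field with two elements. Cochains of all degrees form one
   differential graded ring [cochains A]. Two kinds of cocycles matter: additive
   maps chi : A -> F2, that is forms on A/2, in degree 1, and symmetric
   2-cocycles, which up to coboundary are the extension classes of A by F2 and
   are determined by the form a |-> e(a,a) + e(0,0) they induce on the 2-torsion
   of A. The i-th step of the filtration is the span of the classes of the
   products e_1 ... e_i z with symmetric 2-cocycles e_k and z any cocycle, which
   is visibly natural in A. Since chi^2 is a symmetric 2-cocycle, products of
   characters are alternating modulo the next step, so that
     (chi_1 ^ ... ^ chi_j) (x) (psi_1 ... psi_i) |-> e_psi1 ... e_psii chi_1 ... chi_j
   is a well defined natural map onto the i-th graded piece.
   That it is bijective follows from a monomial basis of the cohomology: for a
   sum of cyclic groups, the products of the even classes (one for each even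
   finite cyclic factor) and of distinct characters (one for each infinite or
   even factor) form a basis. This is proved by adding one cyclic factor X at a
   time. By Shapiro's lemma cochains with coefficients in the functions on X
   compute the cohomology of the complement of X, and the translation by a
   generator t of X, through the exact sequence 0 -> constants -> functions ->
   functions -> constants -> 0 with t - 1 in the middle (without the last term
   when X is infinite), expresses every cocycle as u + chi v + e z with cocycles
   u, v from the complement and a cocycle z of smaller degree, uniquely up to
   coboundaries. *)

From HB Require Import structures.
From mathcomp Require Import all_boot all_order all_algebra perm finmap.
From mathcomp Require Import boolp functions.
From mathcomp.multinomials Require Import monalg.
Require Import Defs.

Set Implicit Arguments.
Unset Strict Implicit.
Unset Printing Implicit Defensive.

Import Order.TTheory GRing.Theory Num.Theory.

Local Open Scope ring_scope.

(** The obstacle is naturality: an even class is attached to a form on the 2-torsion only modulo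
    coboundaries, and maps do not respect a splitting into cyclic groups. Hence the filtration and
    the comparison map use symmetric cocycles alone, and a splitting enters only through facts whose
    statements do not mention it: a form on the 2-torsion is realised by a symmetric cocycle, a
    symmetric cocycle with zero form is a coboundary, the comparison map is bijective. The even
    class of a cyclic group of even order N is the carry of addition modulo N. On Z/2 the carry is
    chi^2, while on Z/4 the square chi^2 is a coboundary; monomials with distinct characters treat
    both cases alike, and exterior powers can appear only in the graded pieces. A basis also records
    points dual to the characters and to the even classes. They read off the coefficients of a
    2-cocycle: those of chi_i chi_j from its antisymmetrisation, then those of e_k from its
    diagonal. *)

(** * Sums in groups of exponent 2 *)

Section Char2.
Variable V : nmodType.
Hypothesis addVV : forall x : V, x + x = 0.

Inductive sum_expr := SumVar of nat | SumZero | SumAdd of sum_expr & sum_expr.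

Fixpoint sum_eval (env : seq V) (e : sum_expr) : V :=
  match e with
  | SumVar i => env`_i
  | SumZero => 0
  | SumAdd e1 e2 => sum_eval env e1 + sum_eval env e2
  end.

Fixpoint sum_vars (e : sum_expr) : seq nat :=
  match e with
  | SumVar i => [:: i]
  | SumZero => [::]
  | SumAdd e1 e2 => sum_vars e1 ++ sum_vars e2
  end.

(** Keeps one copy of each element of odd multiplicity. Besides serving the tactic [char2], it makes
    lists of monomials duplicate-free, as linear independence requires. *)
Definition odd_part (T : eqType) (s : seq T) : seq T :=
  foldr (fun x t => if x \in t then rem x t else x :: t) [::] s.

Lemma sum_odd_part (T : eqType) (s : seq T) (F : T -> V) :
  \sum_(x <- odd_part s) F x = \sum_(x <- s) F x.
Proof.
elim: s => [|x s IHs]; first by rewrite !big_nil.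
rewrite big_cons -IHs /=; case: ifP => xs; last by rewrite big_cons.
by rewrite [in RHS](big_rem x) //= addrA addVV add0r.
Qed.

Lemma odd_part_uniq (T : eqType) (s : seq T) : uniq (odd_part s).
Proof.
elim: s => //= x s IHs; case: ifP => xs; first exact: rem_uniq.
by rewrite /= xs.
Qed.

Lemma odd_part_sub (T : eqType) (s : seq T) : {subset odd_part s <= s}.
Proof.
elim: s => //= x s IHs y; case: ifP => xs.
  by move=> /mem_rem /IHs ys; rewrite in_cons ys orbT.
by rewrite !in_cons => /orP[-> //|/IHs ->]; rewrite orbT.
Qed.

Lemma addVV_eq (x y : V) : x + y = 0 -> x = y.
Proof. by move=> xy; rewrite -[LHS]addr0 -(addVV y) addrA xy add0r. Qed.

Lemma sum_eval_eq env e1 e2 :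
  odd_part (sum_vars e1 ++ sum_vars e2) = [::] -> sum_eval env e1 = sum_eval env e2.
Proof.
have evalE e : sum_eval env e = \sum_(i <- sum_vars e) env`_i.
  elim: e => [i||e1' IH1 e2' IH2] /=; first by rewrite big_seq1.
    by rewrite big_nil.
  by rewrite big_cat -IH1 -IH2.
move=> e12; apply: addVV_eq.
by rewrite !evalE -big_cat -sum_odd_part e12 big_nil.
Qed.

End Char2.

Ltac head_of e := lazymatch e with ?f _ => head_of f | _ => e end.
(** Conversion is tried only on terms with the same head, which keeps the search for atoms cheap. *)
Ltac same_atom x y :=
  match tt with
  | _ => constr_eq x y
  | _ => let f := head_of x in let g := head_of y in constr_eq f g; unify x y
  end.
Ltac sum_insert x s :=
  match s with
  | nil => constr:(x :: s)
  | ?y :: ?t => match tt with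
    | _ => let _ := match tt with _ => same_atom x y end in constr:(s)
    | _ => let t' := sum_insert x t in constr:(y :: t')
    end
  end.
Ltac sum_atoms e s :=
  match e with
  | (?a + ?b)%R => let s' := sum_atoms a s in sum_atoms b s'
  | 0%R => constr:(s)
  | _ => sum_insert e s
  end.
Ltac sum_index x s :=
  match s with
  | ?y :: ?t => match tt with
    | _ => let _ := match tt with _ => same_atom x y end in constr:(0%N)
    | _ => let i := sum_index x t in constr:(S i)
    end
  end.
Ltac sum_quote e s :=
  match e with
  | (?a + ?b)%R => let a' := sum_quote a s in let b' := sum_quote b s in
                   constr:(SumAdd a' b')
  | 0%R => constr:(SumZero)
  | _ => let i := sum_index e s in constr:(SumVar i)
  end.
(* Decides equality of sums in a group of exponent 2. *)
Ltac char2 h :=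
  lazymatch goal with
  | |- @eq ?T ?a ?b =>
    let s := sum_atoms a (@nil T) in let s := sum_atoms b s in
    let a' := sum_quote a s in let b' := sum_quote b s in
    exact: (@sum_eval_eq _ h s a' b' erefl)
  end.

Notation F2 := 'F_2.

Lemma F2_addxx (x : F2) : x + x = 0.
Proof. by apply/val_inj; rewrite /= addnn -mul2n modnMr. Qed.

Lemma F2_cases (x : F2) : x = 0 \/ x = 1.
Proof. by case: x => [[|[|//]] i]; [left|right]; apply: val_inj. Qed.

(** * Cochains as a differential graded ring *)

(* The value at [:: a_1; ...; a_n] is the degree n component. *)
Definition cochains (A : Type) := seq A -> F2.

Section Cochains.
Variable A : zmodType.
Implicit Types (f g h : cochains A) (a b : A) (l : seq A).

HB.instance Definition _ := GRing.Zmodule.copy (cochains A) (seq A -> F2).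

(** Fixing the first argument is the recursion step of most cochain computations: product, inner
    faces and coboundary of [f] at [a :: l] reduce to those of [f @@ a] at [l]. *)
Definition after f a : cochains A := fun l => f (a :: l).
Local Notation "f @@ a" := (after f a) (at level 30).

(** The sum of [f l1 * g l2] over all cuts of [l] into [l1 ++ l2]. No degree occurs, so
    inhomogeneous cochains multiply as well. *)
Fixpoint cup f g l : F2 :=
  if l is a :: l' then f [::] * g l + cup (f @@ a) g l' else f [::] * g [::].

Definition cup_unit : cochains A := fun l => (l == [::])%:R.

Lemma cochainsP f g : (forall l, f l = g l) -> f = g.
Proof. by move=> fg; apply: funext. Qed.

Lemma addcE f g l : (f + g) l = f l + g l. Proof. by []. Qed.

Lemma zerocE l : (0 : cochains A) l = 0. Proof. by []. Qed.

Lemma cup0c g l : cup 0 g l = 0.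
Proof.
elim: l => [|a l IHl] /=; first by rewrite [_ [::]]/(0) mul0r.
rewrite [(_ : cochains A) [::]]/(0) mul0r add0r.
by have -> : (0 : cochains A) @@ a = 0 by [].
Qed.

Fact cup_mulDl : left_distributive (cup : cochains A -> _ -> cochains A) +%R.
Proof.
move=> f g h; apply: cochainsP => l; elim: l f g => [|a l IHl] f g /=.
  by rewrite !addcE /= mulrDl.
have -> : (f + g) @@ a = f @@ a + g @@ a by [].
by rewrite IHl !addcE /= mulrDl; char2 F2_addxx.
Qed.

Fact cup_mulDr : right_distributive (cup : cochains A -> _ -> cochains A) +%R.
Proof.
move=> f g h; apply: cochainsP => l; elim: l f => [|a l IHl] f /=.
  by rewrite !addcE /= mulrDr.
by rewrite IHl !addcE /= mulrDr; char2 F2_addxx.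
Qed.

Fact cup_mulA : associative (cup : cochains A -> _ -> cochains A).
Proof.
have cupZ (c : F2) f g l : cup (fun l => c * f l) g l = c * cup f g l.
  elim: l f => [|a l IHl] f /=; first by rewrite mulrA.
  by rewrite (IHl (f @@ a)) mulrDr mulrA.
move=> f g h; apply: cochainsP => l; elim: l f => [|a l IHl] f /=; first exact: mulrA.
rewrite IHl.
have -> : (cup f g : cochains A) @@ a = (fun l => f [::] * g (a :: l)) + (cup (f @@ a) g : cochains A) by [].
have := cup_mulDl (fun l => f [::] * g (a :: l)) (cup (f @@ a) g : cochains A) h.
move=> /(congr1 (fun z => z l)) ->; rewrite addcE (cupZ (f [::]) (g @@ a)) mulrDr.
by rewrite !mulrA addrA.
Qed.

Fact cup_mul1 : left_id cup_unit cup.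
Proof.
move=> f; apply: cochainsP => -[|a l] /=; first by rewrite mul1r.
have -> : cup_unit @@ a = 0 by [].
by rewrite cup0c mul1r addr0.
Qed.

Fact cup_mulr1 : right_id cup_unit cup.
Proof.
move=> f; apply: cochainsP => l; elim: l f => [|a l IHl] f /=; first by rewrite mulr1.
by rewrite IHl mulr0 add0r.
Qed.

HB.instance Definition _ := GRing.Zmodule_isPzRing.Build (cochains A)
  cup_mulA cup_mul1 cup_mulr1 cup_mulDl cup_mulDr.

Lemma addcc f : f + f = 0.
Proof. by apply: cochainsP => l; apply: F2_addxx. Qed.

Lemma mulc_nil f g : (f * g) [::] = f [::] * g [::]. Proof. by []. Qed.

Lemma mulc_cons f g a l :
  (f * g) (a :: l) = f [::] * g (a :: l) + ((f @@ a) * g) l.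
Proof. by []. Qed.

Definition after_scale (c : F2) g a : cochains A := fun l => c * g (a :: l).

Lemma after_mul f g a : (f * g) @@ a = after_scale (f [::]) g a + (f @@ a) * g.
Proof. by []. Qed.

Fixpoint merge f l : F2 :=
  if l is a :: l1 then
    if l1 is b :: l2 then f ((a + b : A) :: l2) + merge (f @@ a) l1 else 0
  else 0.

Lemma merge_cons2 f a b l :
  merge f [:: a, b & l] = f ((a + b : A) :: l) + merge (f @@ a) (b :: l).
Proof. by []. Qed.

Lemma merge_nil f : merge f [::] = 0. Proof. by []. Qed.
Lemma merge1 f a : merge f [:: a] = 0. Proof. by []. Qed.

Definition eps : cochains A := fun l => (size l == 1)%:R.

(* [merge] collects the inner faces; multiplication by the constant 1-cochain
   [eps] on either side gives the two outer faces. *)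
Definition dif f : cochains A := (merge f : cochains A) + eps * f + f * eps.

Lemma afterD f g a : (f + g) @@ a = f @@ a + g @@ a. Proof. by []. Qed.

Arguments merge : simpl never.

Lemma mergeD f g : merge (f + g) = (merge f : cochains A) + merge g.
Proof.
apply: cochainsP => l; elim: l f g => [|a [|b l] IHl] f g; rewrite addcE.
- by rewrite !merge_nil addr0.
- by rewrite !merge1 addr0.
by rewrite !merge_cons2 afterD IHl !addcE; char2 F2_addxx.
Qed.

Lemma merge0 : merge 0 = 0 :> cochains A.
Proof. by apply: (@addrI _ (merge 0)); rewrite -mergeD !addr0. Qed.

Lemma mergeZ (c : F2) f l : merge (fun l => c * f l) l = c * merge f l.
Proof.
elim: l f => [|a [|b l] IHl] f.
- by rewrite !merge_nil mulr0.
- by rewrite !merge1 mulr0.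
by rewrite !merge_cons2 (IHl (f @@ a)) mulrDr.
Qed.

(** The inner face that joins the fixed argument [a] to the next one; it is what [merge (f @@ a)]
    misses. *)
Definition fuse f a : cochains A :=
  fun l => if l is b :: l' then f ((a + b : A) :: l') else 0.

Lemma after_merge f a : (merge f : cochains A) @@ a = fuse f a + merge (f @@ a).
Proof. by apply: cochainsP => -[|b l]; rewrite addcE ?merge_nil ?addr0. Qed.

(** A merged pair lies on one side of the cut, so [merge] is a derivation. *)
Lemma merge_mul f g :
  merge (f * g) = (merge f : cochains A) * g + f * (merge g : cochains A).
Proof.
apply: cochainsP => l; elim: l f => [|a [|b l] IHl] f; rewrite addcE.
- by rewrite !mulc_nil !merge_nil mul0r mulr0 addr0.
- by rewrite !mulc_cons !mulc_nil /after !merge1 merge_nil !mul0r !mulr0 !addr0.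
rewrite merge_cons2 after_mul mergeD addcE IHl addcE (mergeZ (f [::]) (g @@ a)).
rewrite !mulc_cons !merge_nil !mul0r merge_cons2 mulrDr.
have -> : ((merge f : cochains A) @@ a) @@ b = f @@ (a + b) + (merge (f @@ a) : cochains A) @@ b.
  by apply: cochainsP.
by rewrite mulrDl addcE; char2 F2_addxx.
Qed.

(** Merges at two separate places can be done in two orders, and three adjacent entries can be
    joined in two ways, so every term occurs twice. *)
Lemma merge_merge f : merge (merge f) = 0 :> cochains A.
Proof.
apply: cochainsP => l; elim: l f => [|a [|b l] IHl] f //.
rewrite merge_cons2 after_merge ?mergeD ?addcE ?IHl //.
rewrite addr0; case: l {IHl} => [|c l]; first by rewrite !merge1 addr0.
rewrite !merge_cons2 -[a + b + c]addrA.
exact: F2_addxx.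
Qed.

(** A Maurer-Cartan equation: by it, [merge] plus the commutator with [eps] squares to zero. *)
Lemma merge_eps : merge eps = eps * eps.
Proof.
apply: cochainsP => -[|a [|b l]].
- by rewrite mulc_nil mul0r.
- by rewrite mulc_cons mulc_nil mulr0 mul0r addr0.
rewrite merge_cons2 !mulc_cons mul0r add0r.
have eab : eps @@ a @@ b = 0 by [].
have -> : merge (eps @@ a) (b :: l) = 0.
  case: l => // c l; rewrite merge_cons2 eab merge0 addr0 //.
rewrite eab.
by rewrite mul0r zerocE !addr0 mul1r.
Qed.

Lemma difD f g : dif (f + g) = dif f + dif g.
Proof. by rewrite /dif mergeD mulrDl mulrDr; char2 addcc. Qed.

Lemma dif0 : dif 0 = 0.
Proof. by apply: (addrI (dif 0)); rewrite -difD !addr0. Qed.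

Lemma difM f g : dif (f * g) = dif f * g + f * dif g.
Proof. by rewrite /dif merge_mul !mulrDl !mulrDr !mulrA; char2 addcc. Qed.

Lemma dif_dif f : dif (dif f) = 0.
Proof.
rewrite {1}/dif /dif !mergeD !merge_mul merge_eps merge_merge !mulrDl !mulrDr !mulrA.
by char2 addcc.
Qed.

End Cochains.
Arguments merge : simpl never.
Arguments eps {A}.
Notation "f @@ a" := (after f a) (at level 30).

(** * Coefficients in the functions on a quotient *)

(* A family [y : X -> cochains A] is a cochain with coefficients in the
   functions on [X], on which [A] acts by translation through [q]; [difX] is
   its coboundary. *)
Section Coefficients.
Variables (A X : zmodType) (q : {additive A -> X}).
Implicit Types (y : X -> cochains A) (x : X).

(** The face that drops the first argument, which here acts on [X] by translation; it takes the
    place of [eps * f]. *)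
Definition push y x : cochains A :=
  fun l => if l is a :: l' then y (x + q a) l' else 0.

Definition difX y x : cochains A := (merge (y x) : cochains A) + y x * eps + push y x.

Lemma pushD y1 y2 x : push (fun x => y1 x + y2 x) x = push y1 x + push y2 x.
Proof. by apply: cochainsP => -[|a l]; rewrite addcE //= addr0. Qed.

Lemma push_mul y z x : push (fun x => y x * z) x = push y x * z.
Proof.
apply: cochainsP => -[|a l]; first by rewrite mulc_nil mul0r.
by rewrite mulc_cons mul0r add0r.
Qed.

Lemma push_merge y x :
  push (fun x => merge (y x)) x + merge (push y x) = push (push y) x.
Proof.
apply: cochainsP => -[|a [|b l]]; rewrite addcE ?merge_nil ?merge1 ?addr0 //.
rewrite merge_cons2 /= raddfD (addrA x).
have -> : push y x @@ a = y (x + q a) by [].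
by char2 F2_addxx.
Qed.

Lemma difXD y1 y2 x : difX (fun x => y1 x + y2 x) x = difX y1 x + difX y2 x.
Proof. by rewrite /difX pushD mergeD mulrDl; char2 (@addcc A). Qed.

Lemma difX_mul y z x : difX (fun x => y x * z) x = difX y x * z + y x * dif z.
Proof.
by rewrite /difX push_mul merge_mul /dif !mulrDl !mulrDr !mulrA; char2 (@addcc A).
Qed.

Lemma difX_difX y x : difX (difX y) x = 0.
Proof.
rewrite {1}/difX /difX !pushD push_mul -push_merge !mergeD !merge_mul merge_merge.
rewrite merge_eps !mulrDl !mulrA; char2 (@addcc A).
Qed.

Lemma difX_const z x : difX (fun=> z) x = dif z.
Proof.
rewrite /difX /dif.
have -> : push (fun=> z) x = eps * z.
  apply: cochainsP => -[|a l]; first by rewrite mulc_nil mul0r.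
  rewrite mulc_cons mul0r add0r.
  have -> : eps @@ a = 1 by apply: cochainsP => -[].
  by rewrite mul1r.
by char2 (@addcc A).
Qed.

Lemma difX_translate y t x : difX (fun x => y (x + t)) x = difX y (x + t).
Proof.
by rewrite /difX; congr (_ + _); apply: cochainsP => -[|a l] //=; rewrite addrAC.
Qed.

End Coefficients.

(** * Shapiro's lemma by an explicit homotopy *)

Section Shapiro.
Variables (A X : zmodType) (q : {additive A -> X}).
Variables (p : {additive A -> A}) (s : {additive X -> A}).
Hypothesis qp : forall a, q (p a) = 0.
Hypothesis qs : forall x, q (s x) = x.
Hypothesis psq : forall a, p a + s (q a) = a.
Implicit Types (f g : cochains A) (y : X -> cochains A).

(* The homotopy between a family and its restriction to the kernel of [q],
   which is the image of the projector [p]. *)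
Fixpoint prism f (x : X) (l : seq A) : F2 :=
  if l is a :: l' then f [:: s x, a & l'] + prism (f @@ p a) (x + q a) l'
  else f [:: s x].

Lemma prismD f g x l : prism (f + g) x l = prism f x l + prism g x l.
Proof.
elim: l f g x => [|a l IHl] f g x /=; rewrite ?addcE //.
by rewrite afterD IHl; char2 F2_addxx.
Qed.

Lemma prism_nil_only f x l : (forall a l, f (a :: l) = 0) -> prism f x l = 0.
Proof.
elim: l f x => [|a l IHl] f x f0 /=; first exact: f0.
by rewrite f0 add0r; apply: IHl => b l'; apply: f0.
Qed.

Lemma after_difX y x a : difX q y x @@ a =
  fuse (y x) a + merge (y x @@ a) + after_scale (y x [::]) eps a +
  (y x @@ a) * eps + y (x + q a).
Proof.
rewrite /difX !afterD after_merge after_mul.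
have -> : push q y x @@ a = y (x + q a) by [].
by char2 (@addcc A).
Qed.

Lemma prism_homotopy y x l :
  difX q (prism (y 0)) x l + prism (difX q y 0) x l = y x l + y 0 (map p l).
Proof.
elim: l x y => [|a l IHl] x y.
  rewrite /difX /= !addcE !mulc_nil mulc_cons mulc_nil merge_nil merge1 /=.
  by rewrite !mulr0 mulr1 !addr0 !add0r qs addrC.
(* The tail of the prism on [a :: l] is the prism of [z 0] at [X0] on [l], so the induction
   hypothesis is applied to [z]. *)
set X0 := x + q a; pose z x := y x @@ p a.
have afterE (f : cochains A) l' b : f (b :: l') = (f @@ b) l' by [].
rewrite [difX _ _ _ (a :: l)]afterE after_difX.
have -> : (prism (y 0) x : cochains A) @@ a = ((y 0 @@ s x) @@ a) + prism (z 0) X0.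
  by [].
rewrite [prism _ x (a :: l)]/= -/X0.
have -> : difX q y 0 @@ p a =
    difX q z 0 + (fuse (y 0) (p a) + after_scale (y 0 [::]) eps (p a) + y 0 + push q z 0).
  by rewrite after_difX qp addr0 /difX -/(z 0); char2 (@addcc A).
have prismD5 f1 f2 f3 f4 f5 : prism (f1 + (f2 + f3 + f4 + f5)) X0 l = prism f1 X0 l +
    (prism f2 X0 l + prism f3 X0 l + prism f4 X0 l + prism f5 X0 l).
  by rewrite !prismD.
rewrite prismD5 [prism (after_scale _ _ _) _ _]prism_nil_only; last first.
  by move=> b l'; rewrite /after_scale /eps /= mulr0.
rewrite [difX q y 0 _]afterE [(_ @@ s x) (a :: l)]afterE after_difX !afterD after_merge after_mul.
rewrite mulrDl mergeD !addcE.
have IH : prism (difX q z 0) X0 l = difX q (prism (z 0)) X0 l + y X0 (p a :: l) + y 0 (p a :: map p l).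
  by rewrite -[y X0 _]/(z X0 l) -[y 0 _]/(z 0 (map p l)) -addrA -IHl; char2 F2_addxx.
(* The two ways around one cell of the prism: [s x] followed by [a], or [p a] followed by [s X0]. *)
have sxa : s x + a = p a + s X0 by rewrite raddfD addrCA psq.
rewrite IH /difX !addcE [0 + q _]add0r qs.
case: l {IHl IH prismD5} => [|b l].
  rewrite /= !merge_nil /after_scale /after /= sxa qs [0 + X0]add0r.
  rewrite ?mulc_nil ?mulr0 -[z X0 _]/(y X0 [:: p a]).
  by char2 F2_addxx.
rewrite /= /after_scale /after /= sxa qs !add0r.
rewrite (raddfD p a b) (raddfD q a b) (addrA x) -/X0 qp -[z X0 _]/(y X0 [:: p a, b & l]) /eps /= !mulr0.
rewrite -[prism [eta _] _ _]/(prism (z 0) (X0 + q b) l).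
by char2 F2_addxx.
Qed.

Lemma shapiro y : (forall x, difX q y x = 0) -> (forall l, y 0 (map p l) = 0) ->
  forall x, y x = difX q (prism (y 0)) x.
Proof.
move=> dy y0 x; apply: cochainsP => l.
have := prism_homotopy y x l; rewrite y0 addr0 => <-.
rewrite dy; have -> : prism 0 x l = 0.
  by elim: l x => //= a l IHl x; rewrite IHl addr0.
by rewrite addr0.
Qed.

End Shapiro.

(** * Pullbacks and low degrees *)

Section Pullback.
Variables (A B : zmodType) (h : {additive A -> B}).
Implicit Types f g : cochains B.

Definition pull f : cochains A := fun l => f (map h l).

Lemma pullD f g : pull (f + g) = pull f + pull g. Proof. by []. Qed.

Lemma pull0 : pull 0 = 0. Proof. by []. Qed.

Lemma pull1 : pull 1 = 1.
Proof. by apply: cochainsP => -[]. Qed.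

Lemma pullM f g : pull (f * g) = pull f * pull g.
Proof.
apply: cochainsP => l; rewrite /pull; elim: l f => [|a l IHl] f //=.
by rewrite !mulc_cons; congr (_ + _); rewrite (IHl (f @@ h a)).
Qed.

Lemma pull_eps : pull eps = eps.
Proof. by apply: cochainsP => l; rewrite /pull /eps size_map. Qed.

Lemma pull_merge f : pull (merge f) = merge (pull f).
Proof.
apply: cochainsP => l; rewrite /pull; elim: l f => [|a [|b l] IHl] f //.
rewrite [map _ _]/= !merge_cons2; congr (_ + _); first by rewrite /= raddfD.
exact: (IHl (f @@ h a)).
Qed.

Lemma pull_dif f : pull (dif f) = dif (pull f).
Proof. by rewrite /dif !pullD !pullM pull_eps pull_merge. Qed.

Lemma pull_sum I (r : seq I) (F : I -> cochains B) :
  pull (\sum_(i <- r) F i) = \sum_(i <- r) pull (F i).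
Proof. exact: (big_morph pull pullD pull0). Qed.

Lemma pull_prod I (r : seq I) (F : I -> cochains B) :
  pull (\prod_(i <- r) F i) = \prod_(i <- r) pull (F i).
Proof. exact: (big_morph pull pullM pull1). Qed.

End Pullback.

Lemma pull_comp (A B C : zmodType) (h : {additive A -> B}) (k : {additive B -> C}) f
    (hk : {additive A -> C}) : hk =1 k \o h -> pull h (pull k f) = pull hk f.
Proof.
by move=> hkE; apply: cochainsP => l; rewrite /pull -map_comp (eq_map hkE).
Qed.

Lemma pull_id (A : zmodType) (h : {additive A -> A}) f : h =1 id -> pull h f = f.
Proof. by move=> hE; apply: cochainsP => l; rewrite /pull (eq_map hE) map_id. Qed.

Section LowDegree.
Variable A : zmodType.
Implicit Types (f g : cochains A) (chi : A -> F2) (e : A -> A -> F2).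

Definition homogeneous (n : nat) f := forall l, size l != n -> f l = 0.

Lemma homogeneousD n f g :
  homogeneous n f -> homogeneous n g -> homogeneous n (f + g).
Proof. by move=> hf hg l ln; rewrite addcE hf ?hg ?addr0. Qed.

Lemma homogeneous_sum n (I : eqType) (r : seq I) (F : I -> cochains A) :
  {in r, forall i, homogeneous n (F i)} -> homogeneous n (\sum_(i <- r) F i).
Proof.
move=> hF; rewrite big_seq; apply: big_ind => //; exact: homogeneousD.
Qed.

Lemma homogeneousM m n f g :
  homogeneous m f -> homogeneous n g -> homogeneous (m + n)%N (f * g).
Proof.
move=> hf hg l; elim: l m f hf => [|a l IHl] m f hf.
  rewrite mulc_nil; case: m hf => [|m] hf n0; last by rewrite hf ?mul0r.
  by rewrite [g _]hg ?mulr0.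
rewrite mulc_cons => ln.
have -> : f [::] * g (a :: l) = 0.
  by case: m hf ln => [|m] hf ln; [rewrite hg ?mulr0|rewrite hf ?mul0r].
rewrite add0r; case: m hf ln => [|m] hf ln.
  have -> : f @@ a = 0 by apply: cochainsP => l'; apply: hf.
  by rewrite mul0r.
by apply: (IHl m) => // l' l'm; apply: hf.
Qed.

Lemma homogeneous_eps : homogeneous 1 (@eps A).
Proof. by move=> l; rewrite /eps; case: (size l == 1). Qed.

Lemma homogeneous1 : homogeneous 0 (1 : cochains A).
Proof. by move=> [|a l] // _; change (cup_unit (a :: l) = 0). Qed.

Lemma homogeneous_merge n f : homogeneous n f -> homogeneous n.+1 (merge f).
Proof.
move=> hf l; elim: l n f hf => [|a [|b l] IHl] n f hf ln //.
rewrite merge_cons2 hf // add0r; case: n hf ln => [|n] hf ln.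
  have -> : f @@ a = 0 by apply: cochainsP => l'; apply: hf.
  by rewrite merge0.
by apply: (IHl n) => // l' l'n; apply: hf.
Qed.

Lemma homogeneous_dif n f : homogeneous n f -> homogeneous n.+1 (dif f).
Proof.
move=> hf; apply: homogeneousD.
  apply: homogeneousD; first exact: homogeneous_merge.
  by rewrite -add1n; apply: homogeneousM => //; apply: homogeneous_eps.
by rewrite -addn1; apply: homogeneousM => //; apply: homogeneous_eps.
Qed.

Lemma homogeneous_eq n f g : homogeneous n f -> homogeneous n g ->
  (forall l, size l = n -> f l = g l) -> f = g.
Proof.
move=> hf hg fg; apply: cochainsP => l.
by case: (eqVneq (size l) n) => [/fg //|ln]; rewrite hf ?hg.
Qed.

Definition part n f : cochains A := fun l => if size l == n then f l else 0.

Lemma homogeneous_part n f : homogeneous n (part n f).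
Proof. by move=> l /negPf ln; rewrite /part ln. Qed.

Lemma part_homogeneous n f : homogeneous n f -> part n f = f.
Proof.
move=> hf; apply: (@homogeneous_eq n) => // [|l ln]; first exact: homogeneous_part.
by rewrite /part ln eqxx.
Qed.

Lemma partD n f g : part n (f + g) = part n f + part n g.
Proof. by apply: cochainsP => l; rewrite addcE /part addcE; case: ifP; rewrite ?addr0. Qed.

Lemma after_part n f a : part n.+1 f @@ a = part n (f @@ a).
Proof. by []. Qed.

Lemma partM m n f g : homogeneous m f -> part (m + n)%N (f * g) = f * part n g.
Proof.
move=> hf; apply: (@homogeneous_eq (m + n)%N).
- exact: homogeneous_part.
- by apply: homogeneousM => //; apply: homogeneous_part.
move=> l lmn; rewrite /part lmn eqxx; elim: l m f hf lmn => [|a l IHl] m f hf lmn.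
  by rewrite !mulc_nil; move/esym/eqP: lmn; rewrite addn_eq0 => /andP[_ /eqP ->].
rewrite !mulc_cons; case: m hf lmn => [|m] hf lmn.
  have -> : f @@ a = 0 by apply: cochainsP => l'; apply: hf.
  by rewrite -/(part n g) !mul0r !addr0 /part lmn eqxx.
rewrite hf // !mul0r !add0r; apply: (IHl m); first by move=> l' l'm; apply: hf.
by case: lmn.
Qed.

Lemma mulc_short n f g l : homogeneous n g -> (size l < n)%N -> (f * g) l = 0.
Proof.
move=> hg; elim: l f => [|a l IHl] f ln.
  by rewrite mulc_nil [g _]hg ?mulr0 // neq_ltn ln.
by rewrite mulc_cons [g _]hg ?mulr0 ?add0r ?IHl ?(ltnW ln) // neq_ltn ln.
Qed.

Lemma mulc_eq0 m n f g l : (forall l', size l' = m -> f l' = 0) ->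
  homogeneous n g -> size l = (m + n)%N -> (f * g) l = 0.
Proof.
move=> f0 hg; elim: l m f f0 => [|a l IHl] m f f0 lmn.
  by rewrite mulc_nil f0 ?mul0r //; case: m lmn {f0}.
rewrite mulc_cons; case: m f0 lmn => [|m] f0 lmn.
  by rewrite f0 // mul0r add0r (mulc_short _ hg) // -[n]add0n -lmn.
rewrite [g _]hg ?mulr0 ?add0r.
  by apply: (IHl m) => [l' l'm|]; [apply: f0; rewrite /= l'm|case: lmn].
by rewrite lmn addSn neq_ltn ltnS leq_addl orbT.
Qed.

Lemma partMr m n f g : homogeneous n g -> part (m + n)%N (f * g) = part m f * g.
Proof.
move=> hg; apply: (@homogeneous_eq (m + n)%N) => [||l lmn].
- exact: homogeneous_part.
- by apply: homogeneousM => //; apply: homogeneous_part.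
rewrite /part lmn eqxx -/(part m f); apply: (addVV_eq F2_addxx).
rewrite -addcE -mulrDl (mulc_eq0 _ hg lmn) // => l' l'm.
by rewrite addcE /part l'm eqxx F2_addxx.
Qed.

Lemma part_merge n f : part n.+1 (merge f) = merge (part n f).
Proof.
apply: (@homogeneous_eq n.+1).
- exact: homogeneous_part.
- by apply/homogeneous_merge/homogeneous_part.
move=> l; elim: l n f => [|a [|b l] IHl] n f ln //.
  by rewrite /part ln eqxx.
have -> : part n.+1 (merge f) [:: a, b & l] = merge f [:: a, b & l].
  by rewrite /part ln eqxx.
case: ln => ln; rewrite !merge_cons2; congr (_ + _).
  by rewrite /part /= ln eqxx.
by case: n ln => // n ln; rewrite after_part -IHl // /part /= ln eqxx.
Qed.

Lemma part_dif n f : part n.+1 (dif f) = dif (part n f).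
Proof.
rewrite /dif !partD part_merge -{1}add1n (partM _ _ homogeneous_eps).
by rewrite -{1}addn1 (partMr _ _ homogeneous_eps).
Qed.

Lemma part_dif0 f : part 0 (dif f) = 0.
Proof.
apply: cochainsP => -[|a l] //; rewrite /part /= /dif !addcE !mulc_nil merge_nil.
by rewrite mul0r mulr0 !addr0.
Qed.

End LowDegree.

Section LowDegreeCochains.
Variable A : zmodType.
Implicit Types (f g z : cochains A) (chi : A -> F2) (e : A -> A -> F2).

Lemma eps_mul f a l : (eps * f) (a :: l) = f l.
Proof.
rewrite mulc_cons mul0r add0r.
by have -> : eps @@ a = 1 :> cochains A; [apply: cochainsP => -[]|rewrite mul1r].
Qed.

Lemma difE f l : dif f l = merge f l + (eps * f) l + (f * eps) l.
Proof. by []. Qed.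

Lemma dif_nil f : dif f [::] = 0.
Proof. by rewrite difE !mulc_nil merge_nil mul0r mulr0 !addr0. Qed.

Lemma dif1 f a : dif f [:: a] = 0.
Proof.
by rewrite difE merge1 eps_mul mulc_cons mulc_nil mulr0 mulr1 addr0 add0r F2_addxx.
Qed.

Lemma dif_cons2 f a b l :
  dif f [:: a, b & l] =
  f (b :: l) + f ((a + b : A) :: l) + f (a :: l) + dif (f @@ a) (b :: l).
Proof.
rewrite !difE merge_cons2 !eps_mul mulc_cons [eps (a :: _)]/(0 : F2) mulr0.
by rewrite -[f (a :: l)]/((f @@ a) l); char2 F2_addxx.
Qed.

Definition of0 (c : F2) : cochains A := fun l => if l is [::] then c else 0.
Definition of1 chi : cochains A := fun l => if l is [:: a] then chi a else 0.
Definition of2 e : cochains A := fun l => if l is [:: a; b] then e a b else 0.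
Definition of3 (k : A -> A -> A -> F2) : cochains A :=
  fun l => if l is [:: a; b; c] then k a b c else 0.

Lemma homogeneous_of1 chi : homogeneous 1 (of1 chi).
Proof. by case=> [|a []]. Qed.
Lemma homogeneous_of2 e : homogeneous 2 (of2 e).
Proof. by case=> [|a [|b []]]. Qed.
Lemma homogeneous_of3 k : homogeneous 3 (of3 k).
Proof. by case=> [|a [|b [|c []]]]. Qed.

Lemma of0M c f l : (of0 c * f) l = c * f l.
Proof.
case: l => [|a l] //; rewrite mulc_cons.
have -> : of0 c @@ a = 0 by [].
by rewrite mul0r addr0.
Qed.

Lemma of0_0 : of0 0 = 0.
Proof. by apply: cochainsP => -[]. Qed.
Lemma of0_1 : of0 1 = 1.
Proof. by apply: cochainsP => -[]. Qed.
Lemma of0D c d : of0 (c + d) = of0 c + of0 d.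
Proof. by apply: cochainsP => -[|a l]; rewrite addcE //= addr0. Qed.

Lemma of1M chi f a l : (of1 chi * f) (a :: l) = chi a * f l.
Proof.
rewrite mulc_cons mul0r add0r.
by have -> : of1 chi @@ a = of0 (chi a); [apply: cochainsP => -[]|rewrite of0M].
Qed.

Lemma of2M e f a b l : (of2 e * f) [:: a, b & l] = e a b * f l.
Proof.
rewrite mulc_cons mul0r add0r.
by have -> : of2 e @@ a = of1 (e a); [apply: cochainsP => -[|? []]|rewrite of1M].
Qed.

Lemma dif_of1 chi : dif (of1 chi) = of2 (fun a b => chi a + chi b + chi (a + b)).
Proof.
apply: (@homogeneous_eq _ 2).
- exact/homogeneous_dif/homogeneous_of1.
- exact: homogeneous_of2.
by case=> [|a [|b []]] // _; rewrite dif_cons2 dif1 /=; char2 F2_addxx.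
Qed.

Lemma dif_of2 e : dif (of2 e) =
  of3 (fun a b c => e b c + e (a + b) c + e a (b + c) + e a b).
Proof.
apply: (@homogeneous_eq _ 3).
- exact/homogeneous_dif/homogeneous_of2.
- exact: homogeneous_of3.
case=> [|a [|b [|c []]]] // _; rewrite !dif_cons2 dif1 /= /after /=.
by char2 F2_addxx.
Qed.

Definition exact_cochain f := exists g, f = dif g.
Definition cohomologous f g := exact_cochain (f + g).

Lemma cohomologous_refl f : cohomologous f f.
Proof. by exists 0; rewrite dif0 addcc. Qed.

Lemma exact_cochainD f g : exact_cochain f -> exact_cochain g -> exact_cochain (f + g).
Proof. by move=> [u ->] [v ->]; exists (u + v); rewrite difD. Qed.

Lemma exact_cochain0 : exact_cochain 0.
Proof. by exists 0; rewrite dif0. Qed.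

Lemma exact_mul f z : exact_cochain f -> dif z = 0 -> exact_cochain (f * z).
Proof. by move=> [u ->] z0; exists (u * z); rewrite difM z0 mulr0 addr0. Qed.

Lemma mul_exact f z : exact_cochain f -> dif z = 0 -> exact_cochain (z * f).
Proof. by move=> [u ->] z0; exists (z * u); rewrite difM z0 mul0r add0r. Qed.

Lemma exact_cocycle f : exact_cochain f -> dif f = 0.
Proof. by move=> [u ->]; apply: dif_dif. Qed.

Lemma cohomologous_trans g f h :
  cohomologous f g -> cohomologous g h -> cohomologous f h.
Proof.
move=> fg gh; rewrite /cohomologous.
have -> : f + h = (f + g) + (g + h) by char2 (@addcc A).
exact: exact_cochainD.
Qed.

Lemma cohomologousD f f' g g' :
  cohomologous f f' -> cohomologous g g' -> cohomologous (f + g) (f' + g').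
Proof.
move=> fg gh; rewrite /cohomologous.
have -> : f + g + (f' + g') = (f + f') + (g + g') by char2 (@addcc A).
exact: exact_cochainD.
Qed.

Lemma cohomologousM f f' g g' : dif f = 0 -> dif g' = 0 ->
  cohomologous f f' -> cohomologous g g' -> cohomologous (f * g) (f' * g').
Proof.
move=> f0 g0 fg gh; rewrite /cohomologous.
have -> : f * g + f' * g' = f * (g + g') + (f + f') * g'.
  by rewrite mulrDl mulrDr; char2 (@addcc A).
by apply: exact_cochainD; [apply: mul_exact|apply: exact_mul].
Qed.

Lemma cohomologous_cocycle f g : cohomologous f g -> dif f = 0 -> dif g = 0.
Proof.
by move=> /exact_cocycle; rewrite difD => fg f0; rewrite f0 add0r in fg.
Qed.

Lemma exact_cohomologous f g : cohomologous f g -> exact_cochain g -> exact_cochain f.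
Proof.
move=> fg g0; have -> : f = (f + g) + g by char2 (@addcc A).
exact: exact_cochainD.
Qed.

Lemma dif_1 : dif 1 = 0 :> cochains A.
Proof.
apply: (@homogeneous_eq _ 1) => //; first exact/homogeneous_dif/homogeneous1.
by case=> [|a []] // _; rewrite dif1.
Qed.

Lemma dif_sum I (r : seq I) (F : I -> cochains A) :
  dif (\sum_(i <- r) F i) = \sum_(i <- r) dif (F i).
Proof. exact: (big_morph _ (@difD A) (@dif0 A)). Qed.

Lemma dif_sum0 (I : eqType) (r : seq I) (F : I -> cochains A) :
  {in r, forall i, dif (F i) = 0} -> dif (\sum_(i <- r) F i) = 0.
Proof. by move=> F0; rewrite dif_sum big_seq big1. Qed.

Lemma dif_prod (I : eqType) (r : seq I) (F : I -> cochains A) :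
  {in r, forall i, dif (F i) = 0} -> dif (\prod_(i <- r) F i) = 0.
Proof.
move=> F0; rewrite big_seq; apply: (big_ind (fun f => dif f = 0)) => //.
  exact: dif_1.
by move=> f g f0 g0; rewrite difM f0 g0 mul0r mulr0 addr0.
Qed.

Lemma cocycleM f g : dif f = 0 -> dif g = 0 -> dif (f * g) = 0.
Proof. by move=> f0 g0; rewrite difM f0 g0 mul0r mulr0 addr0. Qed.

Definition additive_form chi := forall a b, chi (a + b) = chi a + chi b.

Lemma dif_additive chi : additive_form chi -> dif (of1 chi) = 0.
Proof.
move=> chiD; rewrite dif_of1; apply: cochainsP => -[|a [|b []]] //=.
by rewrite chiD F2_addxx.
Qed.

Definition symmetric_cocycle (e : cochains A) :=
  [/\ homogeneous 2 e, dif e = 0 & forall a b, e [:: a; b] = e [:: b; a]].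

(** Weight [f l] by [chi] of the sum of [l]. Inner faces keep the sum, hence commute with the
    weighting; the two outer faces lose the first or the last entry, and the defects are
    [of1 chi * f] and [f * of1 chi]. *)
Lemma of1_commute chi z : additive_form chi -> dif z = 0 ->
  cohomologous (of1 chi * z) (z * of1 chi).
Proof.
move=> chiD z0.
have chi0 : chi 0 = 0 by apply: (@addrI _ (chi 0)); rewrite -chiD !addr0.
(* The cup-1 product of [f] with [chi]. *)
pose w f : cochains A := fun l => f l * chi (\sum_(a <- l) a).
have w_after f a : w f @@ a = of0 (chi a) * (f @@ a) + w (f @@ a).
  apply: cochainsP => l; rewrite addcE of0M /w /after big_cons chiD mulrDr mulrC.
  by [].
have dw f : dif (w f) = w (dif f) + of1 chi * f + f * of1 chi.
  apply: cochainsP => l; elim: l f => [|a [|b l] IHl] f.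
  - by rewrite !addcE !mulc_nil /w !dif_nil !(mul0r, mulr0) !addr0.
  - rewrite !addcE dif1 /w dif1 of1M mulc_cons mulc_nil /= mulr0 !addr0 mul0r add0r.
    by rewrite mulrC F2_addxx.
  rewrite dif_cons2 w_after difD addcE IHl !addcE difM.
  have -> : dif (of0 (chi a)) = 0.
    apply: (@homogeneous_eq _ 1) => //; last by case=> [|c []] // _; rewrite dif1.
    by apply: homogeneous_dif => -[].
  rewrite mul0r add0r of0M [w (dif f) _]/w dif_cons2 !of1M (mulc_cons f).
  move: (dif (f @@ a)) => D; rewrite [of1 chi (a :: _)]/(0 : F2) /w !big_cons !chiD.
  rewrite mulr0 -[f (a :: l)]/((f @@ a) l) !mulrDr !mulrDl.
  rewrite -[(f @@ a) l]/(f (a :: l)).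
  rewrite [chi a * D _]mulrC [chi b * _]mulrC [chi a * _]mulrC.
  char2 F2_addxx.
exists (w z); rewrite dw z0.
by have -> : w 0 = 0; [apply: cochainsP => l; apply: mul0r|rewrite add0r].
Qed.

Lemma symmetric_cocycle_commute (e e' : cochains A) :
  symmetric_cocycle e -> symmetric_cocycle e' -> cohomologous (e * e') (e' * e).
Proof.
have of2E f : homogeneous 2 f -> f = of2 (fun a b => f [:: a; b]).
  move=> hf; apply: (@homogeneous_eq _ 2) => //; first exact: homogeneous_of2.
  by case=> [|a [|b []]].
move=> [/of2E -> + _] [/of2E -> + _].
set g := fun a b => e [:: a; b]; set g' := fun a b => e' [:: a; b].
have dE h : dif (of2 h) = 0 -> forall a b c, h b c = h (a + b) c + h a (b + c) + h a b.
  move=> h0 a b c; apply: (addVV_eq F2_addxx); rewrite !addrA.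
  by have := congr1 (fun f => f [:: a; b; c]) h0; rewrite dif_of2.
move=> /dE Eg /dE Eg'.
(* The cup-1 product of [g] with [g']. *)
exists (of3 (fun a b c => g (a + b) c * g' a b + g a (b + c) * g' b c)).
apply: (@homogeneous_eq _ 4).
- by apply: homogeneousD; apply: (@homogeneousM _ 2 2); apply: homogeneous_of2.
- exact/homogeneous_dif/homogeneous_of3.
case=> [|a [|b [|c [|d []]]]] // _; rewrite addcE !of2M /=.
rewrite !dif_cons2 dif1 /= /after /= !addr0.
(* The cocycle identity is solved for a different term in [g'] than in [g]; with these two
   orientations the rewritten products cancel in pairs. *)
have Eg'' x y t : g' (x + y) t = g' y t + g' x (y + t) + g' x y.
  by rewrite (Eg' x y t); char2 F2_addxx.
rewrite (Eg'' a b c) (Eg'' b c d) (Eg a b (c + d)) (Eg a (b + c) d).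
rewrite (Eg (a + b) c d) !mulrDl !mulrDr (addrA a b c) (addrA b c d).
rewrite ![g' a b * _]mulrC; char2 F2_addxx.
Qed.

End LowDegreeCochains.

(** * Splitting off a cyclic factor *)

Section CyclicFactor.
Variables (A X : zmodType) (q : {additive A -> X}).
Variables (p : {additive A -> A}) (s : {additive X -> A}).
Hypothesis qp : forall a, q (p a) = 0.
Hypothesis qs : forall x, q (s x) = x.
Hypothesis psq : forall a, p a + s (q a) = a.
Implicit Types (f g z u v : cochains A) (y : X -> cochains A) (x : X).

Let pp a : p (p a) = p a.
Proof. by rewrite -[RHS]psq qp raddf0 addr0. Qed.

Lemma pull_pull f : pull p (pull p f) = pull p f.
Proof. by apply: pull_comp => a; rewrite /= pp. Qed.

Lemma pull_difX y : pull p (difX q y 0) = dif (pull p (y 0)).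
Proof.
rewrite /difX !pullD pullM pull_merge pull_eps /dif.
have -> : pull p (push q y 0) = eps * pull p (y 0).
  apply: cochainsP => -[|a l]; first by rewrite mulc_nil mul0r.
  by rewrite eps_mul /pull /= qp addr0.
by char2 (@addcc A).
Qed.

Lemma difXE y x l :
  difX q y x l = merge (y x) l + (y x * eps) l + push q y x l.
Proof. by []. Qed.

Lemma difX_of0 (c : X -> F2) x :
  difX q (fun x => of0 (c x)) x = of1 (fun a => c x + c (x + q a)).
Proof.
apply: cochainsP => -[|a [|b l]]; rewrite difXE of0M.
- by rewrite merge_nil mulr0 !addr0.
- by rewrite merge1 mulr1 add0r.
rewrite merge_cons2 mulr0 /= !addr0 add0r.
have -> : of0 (c x) @@ a = 0 by [].
by rewrite merge0.
Qed.

Lemma difX_of1 (c : X -> A -> F2) x : difX q (fun x => of1 (c x)) x =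
  of2 (fun a b => c x (a + b) + c x a + c (x + q a) b).
Proof.
apply: cochainsP => -[|a [|b l]]; rewrite difXE.
- by rewrite mulc_nil merge_nil mulr0 !addr0.
- by rewrite merge1 of1M /= mulr0 !addr0.
have after1 : of1 (c x) @@ a = of0 (c x a) by apply: cochainsP => -[].
rewrite of1M merge_cons2 after1.
have -> : merge (of0 (c x a)) (b :: l) = 0.
  case: l => [|d l]; first exact: merge1.
  have after0 : (of0 (c x a) : cochains A) @@ b = 0 by [].
  by rewrite merge_cons2 after0 merge0 zerocE addr0.
by case: l => [|d l] /=; rewrite ?mulr1 ?mulr0 !addr0.
Qed.

(** Once the constant family [pull p (y 0)] is subtracted, the restriction to the complement
    vanishes and Shapiro's lemma applies. *)
Lemma cocycle_split y : (forall x, difX q y x = 0) ->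
  exists Q, forall x, y x = pull p (y 0) + difX q Q x.
Proof.
move=> dy; pose y' x := y x + pull p (y 0).
have dy' x : difX q y' x = 0.
  by rewrite difXD dy add0r difX_const -pull_difX dy pull0.
have y'0 l : y' 0 (map p l) = 0.
  rewrite /y' addcE -[y 0 _]/(pull p (y 0) l) -[pull p _ (map p l)]/(pull p (pull p (y 0)) l).
  by rewrite pull_pull F2_addxx.
exists (prism q p s (y' 0)) => x.
by rewrite -(shapiro qp qs psq dy' y'0) /y'; char2 (@addcc A).
Qed.

Variables (t : X) (lam : X -> F2).
Hypothesis lamD : forall a b, lam (a + b) = lam a + lam b.
Hypothesis lam_t : lam t = 1.

Definition chi_lam := of1 (fun a => lam (q a)).

Let lam0 : lam 0 = 0.
Proof. by apply: (@addrI _ (lam 0)); rewrite -lamD !addr0. Qed.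

Let difX_lam x : difX q (fun x => of0 (lam x)) x = chi_lam.
Proof.
rewrite difX_of0; congr of1; apply: funext => a.
by rewrite lamD addrA F2_addxx add0r.
Qed.

Let pull_chi_lam : pull p chi_lam = 0.
Proof. by apply: cochainsP => -[|a [|b l]] //; rewrite /pull /= qp lam0. Qed.

(* Over [X] the cocycle [z] is bounded by [y], up to its part on the complement
   and a multiple of [chi_lam]; the change of [y] under translation by [t] is
   then bounded by [w]. *)
Lemma translate_split z : dif z = 0 ->
  exists v y w, [/\ pull p v = v, dif v = 0,
    forall x, difX q y x = z + pull p z + chi_lam * v &
    forall x, y (x + t) + y x = difX q w x].
Proof.
move=> z0; pose z1 := z + pull p z.
have [Q z1Q] : exists Q, forall x, z1 = difX q Q x.
  have [|Q QE] := @cocycle_split (fun=> z1).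
    by move=> x; rewrite difX_const difD -pull_dif z0 pull0 addr0.
  by exists Q => x; have := QE x; rewrite /= pullD pull_pull addcc add0r.
pose y' x := Q (x + t) + Q x; pose v := pull p (y' 0).
have dy' x : difX q y' x = 0.
  by rewrite difXD difX_translate -!z1Q addcc.
have dv : dif v = 0 by rewrite -pull_difX dy' pull0.
have pv : pull p v = v by apply: pull_pull.
have [w y'E] := cocycle_split dy'.
(* Translation by [t] changes [Q] by [v] up to a coboundary. As [lam] grows by 1 under this
   translation, the summand [lam x * v] removes the [v], at the cost of [chi_lam * v] in the
   coboundary. *)
exists v, (fun x => Q x + of0 (lam x) * v), w; split=> // x.
  by rewrite difXD difX_mul dv mulr0 addr0 -z1Q difX_lam.
have -> : difX q w x = y' x + v by rewrite y'E /v; char2 (@addcc A).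
by rewrite lamD lam_t of0D of0_1 mulrDl mul1r /y'; char2 (@addcc A).
Qed.

Section Unique.
Variables (e : cochains A) (y1 w1 : X -> cochains A).
Hypothesis dy1 : forall x, difX q y1 x = e.
Hypothesis dw1 : forall x, difX q w1 x = y1 (x + t) + y1 x.
Hypothesis pe : pull p e = 0.

(** Restriction to the complement kills [chi_lam] and [e], so [u] is exact. Over [X] the rest is
    bounded both by [lam * v + y1 * z] and by a constant, so their sum is a cocycle and comes from
    the complement up to [difX q Q]. Comparing it with its translate gives [v = difX q R]. Hence [v]
    is exact, and splitting [R] corrected by a constant gives the last claim. *)
Lemma cyclic_unique u v z : pull p u = u -> pull p v = v ->
  dif u = 0 -> dif v = 0 -> dif z = 0 ->
  exact_cochain (u + chi_lam * v + e * z) ->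
  [/\ exact_cochain u, exact_cochain v &
    exists Q c P, forall x, w1 x * z = Q (x + t) + Q x + c + difX q P x].
Proof.
move=> pu pv du dv dz [U UE].
have uE : u = dif (pull p U).
  by rewrite -pull_dif -UE !pullD !pullM pull_chi_lam pe !mul0r !addr0.
have [V VE] : exact_cochain (chi_lam * v + e * z).
  by exists (U + pull p U); rewrite difD -UE -uE; char2 (@addcc A).
pose y x := of0 (lam x) * v + y1 x * z + V.
have [|Q yE] := @cocycle_split y.
  move=> x; rewrite 2!difXD 2!difX_mul difX_const dv dz !mulr0 !addr0.
  by rewrite difX_lam dy1 VE addcc.
pose R x := w1 x * z + (Q (x + t) + Q x).
have vE x : v = difX q R x.
  rewrite 2!difXD difX_mul dz mulr0 addr0 dw1 difX_translate.
  have -> : difX q Q (x + t) + difX q Q x = y (x + t) + y x.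
    by rewrite (yE (x + t)) (yE x); char2 (@addcc A).
  rewrite /y lamD lam_t of0D of0_1 !mulrDl mul1r; char2 (@addcc A).
pose S := pull p (R 0).
have vS : v = dif S by rewrite -pv {1}(vE 0) pull_difX.
split; [by exists (pull p U)|by exists S|].
have [|P PE] := @cocycle_split (fun x => R x + S).
  by move=> x; rewrite difXD difX_const -vE -vS addcc.
exists Q, (pull p (R 0 + S) + S), P => x.
have -> : w1 x * z = (R x + S) + S + Q (x + t) + Q x by rewrite /R; char2 (@addcc A).
by rewrite PE; char2 (@addcc A).
Qed.

End Unique.

End CyclicFactor.

(** * Finite cyclic factors *)

Section EvenCyclicFactor.
Variables (A : zmodType) (X : finZmodType) (q : {additive A -> X}).
Variables (p : {additive A -> A}) (s : {additive X -> A}).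
Hypothesis qp : forall a, q (p a) = 0.
Hypothesis qs : forall x, q (s x) = x.
Hypothesis psq : forall a, p a + s (q a) = a.
Implicit Types (z u v : cochains A) (y : X -> cochains A).

(** Translations permute the summands, so summation over [X] is an equivariant map from functions to
    constants and respects coboundaries. *)
Lemma sum_difX y : \sum_x difX q y x = dif (\sum_x y x).
Proof.
have merge_sum : merge (\sum_x y x) = \sum_x (merge (y x) : cochains A).
  apply: (big_ind2 (fun f g : cochains A => (merge f : cochains A) = g)) => //.
    exact: merge0.
  by move=> f1 g1 f2 g2 <- <-; apply: mergeD.
have push_sum : \sum_x push q y x = eps * \sum_x y x.
  apply: cochainsP => l.
  have evalE (F : X -> cochains A) l' : (\sum_x F x) l' = \sum_x F x l'.
    by apply: (big_morph (fun f : cochains A => f l')).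
  rewrite evalE; case: l => [|a l].
    by rewrite mulc_nil mul0r big1.
  rewrite eps_mul evalE /= [RHS](reindex (fun x => x + q a)) //.
  by exists (fun x => x - q a) => x _; rewrite ?addrK ?subrK.
rewrite /difX !big_split /= push_sum -merge_sum -mulr_suml /dif.
by char2 (@addcc A).
Qed.

Lemma sum_translate (y : X -> cochains A) t : \sum_x y (x + t) = \sum_x y x.
Proof.
rewrite [RHS](reindex (fun x => x + t)) //.
by exists (fun x => x - t) => x _; rewrite ?addrK ?subrK.
Qed.

(** A transfer argument: the bounding family is summed over [X], and an odd number of copies of
    [z + pull p z] equals one copy. *)
Lemma odd_split z : odd #|X| -> dif z = 0 -> exact_cochain (z + pull p z).
Proof.
move=> oddX z0; have [|Q QE] := @cocycle_split _ _ q p s qp qs psq (fun=> z + pull p z).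
  by move=> x; rewrite difX_const difD -pull_dif z0 pull0 addr0.
exists (\sum_x Q x); rewrite -sum_difX.
have {}QE x : z + pull p z = difX q Q x.
  by have := QE x; rewrite /= pullD (pull_pull qp psq) addcc add0r.
rewrite -(eq_bigr _ (fun x _ => QE x)) sumr_const -mulr_natr.
rewrite -[#|_|]odd_double_half oddX natrD -muln2 natrM.
have -> : 2%:R = 0 :> cochains A by rewrite mulr2n addcc.
by rewrite mulr0 addr0 mulr1.
Qed.

Variables (t : X) (lam : X -> F2) (kap : X -> X -> F2).
Hypothesis lamD : forall a b, lam (a + b) = lam a + lam b.
Hypothesis lam_t : lam t = 1.
Hypothesis kapC : forall a b, kap a b = kap b a.
Hypothesis kap0 : kap 0 0 = 0.
Hypothesis kap_cocycle : forall a b c,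
  kap b c + kap (a + b) c + kap a (b + c) + kap a b = 0.
Hypothesis sum_kap : \sum_x kap x t = 1.
Hypothesis evenX : ~~ odd #|X|.
Hypothesis solve_translate : forall W : X -> cochains A, \sum_x W x = 0 ->
  exists w, forall x, W x = w (x + t) + w x.
Hypothesis translate_const : forall y, (forall x, y (x + t) + y x = 0) ->
  forall x, y x = y 0.

Definition cocycle_kap : cochains A := of2 (fun a b => kap (q a) (q b)).

(** Over [X] the cocycle [cocycle_kap] is bounded by [y1]; the change of [y1] under translation by
    [t] is bounded by [w1]; and [w1] sums to 1 over [X]. So [cocycle_kap] is the class of the
    four-term exact sequence. *)
Let y1 x : cochains A := of1 (fun a => kap x (q a)).
Let w1 x : cochains A := of0 (kap x t).

Let dy1 x : difX q y1 x = cocycle_kap.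
Proof.
rewrite /y1 difX_of1; congr of2; apply: funext => a; apply: funext => b.
apply: (addVV_eq F2_addxx); rewrite -(kap_cocycle x (q a) (q b)) raddfD.
by char2 F2_addxx.
Qed.

Let dw1 x : difX q w1 x = y1 (x + t) + y1 x.
Proof.
rewrite /w1 difX_of0; apply: cochainsP => -[|a [|b l]]; rewrite addcE /=.
- by rewrite addr0.
- have := kap_cocycle x t (q a); have := kap_cocycle x (q a) t.
  rewrite (kapC t (q a)) (addrC t (q a)) => h1 h2.
  apply: (addVV_eq F2_addxx); rewrite -[RHS]addr0 -{1}h1 -h2; char2 F2_addxx.
- by rewrite addr0.
Qed.

Let pe : pull p cocycle_kap = 0.
Proof. by apply: cochainsP => -[|a [|b [|]]] //; rewrite /pull /= !qp kap0. Qed.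

Let sum_of0 (c : X -> F2) : \sum_x of0 (c x) = of0 (\sum_x c x) :> cochains A.
Proof.
by rewrite (big_morph (@of0 A) (id1 := 0) (op1 := +%R)) //; [exact: of0D|exact: of0_0].
Qed.

Let sum_const z : \sum_(x : X) z = 0.
Proof.
rewrite sumr_const -mulr_natr -[#|_|]odd_double_half (negPf evenX) add0n -muln2 natrM.
have -> : 2%:R = 0 :> cochains A by rewrite mulr2n addcc.
by rewrite !mulr0.
Qed.

(** The sum [z'] of [w] over [X] is the obstruction to writing [w] as a difference under
    translation. Adding [w1 * z'] cancels it, since [w1] sums to 1. Corrected by the resulting [w'],
    the family bounding [z] over [X] is invariant under [t], hence constant, and so is an ordinary
    cochain. *)
Lemma even_split z : dif z = 0 -> exists v z',
  [/\ pull p v = v, dif v = 0, dif z' = 0 &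
      cohomologous z (pull p z + chi_lam q lam * v + cocycle_kap * z')].
Proof.
move=> z0; have [v [y [w [pv dv dy yE]]]] := translate_split qp qs psq lamD lam_t z0.
pose z' := \sum_x w x.
have dz' : dif z' = 0.
  rewrite -sum_difX -(eq_bigr _ (fun x _ => yE x)) big_split /= sum_translate.
  by rewrite addcc.
have [|w' wE] := @solve_translate (fun x => w x + w1 x * z').
  by rewrite big_split /= -mulr_suml sum_of0 sum_kap of0_1 mul1r addcc.
pose Y x := y x + y1 x * z' + difX q w' x.
have dY x : difX q Y x = z + pull p z + chi_lam q lam * v + cocycle_kap * z'.
  by rewrite 2!difXD difX_difX difX_mul dz' mulr0 !addr0 dy dy1.
have YE : forall x, Y x = Y 0.
  apply: translate_const => x; rewrite /Y.
  have -> : y (x + t) + y1 (x + t) * z' + difX q w' (x + t) + (y x + y1 x * z' + difX q w' x)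
    = (y (x + t) + y x) + (y1 (x + t) + y1 x) * z' + (difX q w' (x + t) + difX q w' x).
    by rewrite mulrDl; char2 (@addcc A).
  rewrite yE -dw1 -difX_translate -difXD.
  have <- : (fun x => w x + w1 x * z') = (fun x => w' (x + t) + w' x).
    by apply: funext => x'; apply: wE.
  by rewrite difXD difX_mul dz' mulr0 addr0; char2 (@addcc A).
exists v, z'; split=> //; exists (Y 0).
rewrite -(difX_const q _ 0); have <- : Y = (fun=> Y 0) by apply: funext => x; apply: YE.
by rewrite dY; char2 (@addcc A).
Qed.

(** The last claim of [cyclic_unique] is summed over [X]: the two translates cancel, the constant
    occurs an even number of times, and [w1 * z] sums to [z]. *)
Lemma even_unique u v z : pull p u = u -> pull p v = v ->
  dif u = 0 -> dif v = 0 -> dif z = 0 ->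
  exact_cochain (u + chi_lam q lam * v + cocycle_kap * z) ->
  [/\ exact_cochain u, exact_cochain v & exact_cochain z].
Proof.
move=> pu pv du dv dz uvz.
have [eu ev [Q [c [P PE]]]] :=
  cyclic_unique qp qs psq lamD lam_t dy1 dw1 pe pu pv du dv dz uvz.
split=> //; exists (\sum_x P x).
rewrite -[z]mul1r -of0_1 -sum_kap -sum_of0 mulr_suml (eq_bigr _ (fun x _ => PE x)).
by rewrite 3!big_split /= sum_translate sum_const addcc addr0 add0r sum_difX.
Qed.

End EvenCyclicFactor.

(** * The infinite cyclic factor *)

Section InfiniteCyclicFactor.
Variables (A : zmodType) (q : {additive A -> int}).
Variables (p : {additive A -> A}) (s : {additive int -> A}).
Hypothesis qp : forall a, q (p a) = 0.
Hypothesis qs : forall x, q (s x) = x.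
Hypothesis psq : forall a, p a + s (q a) = a.
Variable lam : int -> F2.
Hypothesis lamD : forall a b, lam (a + b) = lam a + lam b.
Hypothesis lam1 : lam 1 = 1.

Lemma infinite_split z : dif z = 0 -> exists v,
  [/\ pull p v = v, dif v = 0 & cohomologous z (pull p z + chi_lam q lam * v)].
Proof.
move=> z0; have [v [y [w [pv dv dy yE]]]] := translate_split qp qs psq lamD lam1 z0.
(* An antiderivative of [w] for the translation by 1, equal to 0 at 0. It exists for every [w], so
   no even class arises. *)
pose w' (x : int) : cochains A := match x with
  | Posz n => \sum_(i < n) w i%:Z
  | Negz n => \sum_(i < n.+1) w (Negz i) end.
have w'E x : w x = w' (x + 1) + w' x.
  case: x => n.
    by rewrite -PoszD addn1 /w' big_ord_recr /=; char2 (@addcc A).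
  case: n => [|n].
    by rewrite (_ : Negz 0 + 1 = 0%:Z) // /w' big_ord0 add0r big_ord1.
  have -> : Negz n.+1 + 1 = Negz n.
    by rewrite !NegzE [n.+2%:Z]intS opprD addrAC addNr add0r.
  by rewrite /w' [X in _ = _ + X]big_ord_recr /=; char2 (@addcc A).
pose Y x := y x + difX q w' x.
have dY x : difX q Y x = z + pull p z + chi_lam q lam * v.
  by rewrite difXD difX_difX addr0 dy.
have Y1 x : Y (x + 1) = Y x.
  apply: (addVV_eq (@addcc A)); rewrite /Y.
  have -> : y (x + 1) + difX q w' (x + 1) + (y x + difX q w' x) =
    (y (x + 1) + y x) + (difX q w' (x + 1) + difX q w' x) by char2 (@addcc A).
  rewrite yE -difX_translate -difXD.
  have <- : w = (fun x => w' (x + 1) + w' x) by apply: funext.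
  by rewrite addcc.
have YE x : Y x = Y 0.
  elim/int_rec: x => // n IHn; first by rewrite -IHn -addn1 PoszD Y1.
  by rewrite -IHn -[LHS]Y1; congr Y; rewrite -addn1 PoszD opprD addrNK.
exists v; split=> //; exists (Y 0).
rewrite -(difX_const q _ 0); have <- : Y = (fun=> Y 0) by apply: funext.
by rewrite dY; char2 (@addcc A).
Qed.

(** The case of [cyclic_unique] with [e], [y1], [w1] and [z] all zero. *)
Lemma infinite_unique u v : pull p u = u -> pull p v = v ->
  dif u = 0 -> dif v = 0 -> exact_cochain (u + chi_lam q lam * v) ->
  exact_cochain u /\ exact_cochain v.
Proof.
move=> pu pv du dv uv.
have d0 x : difX q (fun=> 0 : cochains A) x = 0 by rewrite difX_const dif0.
have d0' (x : int) : difX q (fun=> 0 : cochains A) x = 0 + 0 by rewrite d0 addr0.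
have [||eu ev _] := cyclic_unique qp qs psq lamD lam1 d0 d0' _ pu pv du dv (dif0 A) => //.
by rewrite mul0r addr0.
Qed.

End InfiniteCyclicFactor.

(** * Monomial bases of the cohomology *)

Definition monomial : Type := (seq nat * seq nat)%type.

(* Index lists of the monomials e^alpha l_S of degree n: weakly decreasing
   for the even classes, strictly decreasing for the characters. *)
Definition standard (r s n : nat) (m : monomial) : bool :=
  [&& sorted geq m.1, all (fun i => i < s)%N m.1,
      sorted gtn m.2, all (fun j => j < r)%N m.2 & ((size m.1).*2 + size m.2 == n)%N].

Lemma standard_consl r s n k alpha S : standard r s n (k :: alpha, S) =
  [&& all (fun i => i <= k)%N alpha, (k < s)%N, (1 < n)%N & standard r s n.-2 (alpha, S)].
Proof.
have tr : transitive geq by move=> a b c ab ca; apply: leq_trans ca ab.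
rewrite /standard /= path_sortedE //= doubleS !addSn.
case: n => [|[|n]]; rewrite ?andbF //= !eqSS.
by rewrite -!andbA; do !bool_congr.
Qed.

Lemma standard_consr r s n k alpha S : standard r s n (alpha, k :: S) =
  [&& all (fun j => j < k)%N S, (k < r)%N, (0 < n)%N & standard r s n.-1 (alpha, S)].
Proof.
have tr : transitive gtn by move=> a b c ab ca; apply: ltn_trans ca ab.
rewrite /standard /= path_sortedE //= addnS.
case: n => [|n]; rewrite ?andbF //= !eqSS.
by rewrite -!andbA; do !bool_congr.
Qed.

Lemma standard_widen r r' s s' n m : (r <= r')%N -> (s <= s')%N ->
  standard r s n m -> standard r' s' n m.
Proof.
move=> rr' ss' /and5P[h1 h2 h3 h4 h5]; apply/and5P; split=> //.
  by apply: sub_all h2 => i /leq_trans; apply.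
by apply: sub_all h4 => i /leq_trans; apply.
Qed.

Section Monomials.
Variables (A : zmodType) (e : nat -> cochains A) (l : nat -> A -> F2).

Definition mono (m : monomial) : cochains A :=
  (\prod_(i <- m.1) e i) * \prod_(j <- m.2) of1 (l j).

Lemma mono_consl k alpha S : mono (k :: alpha, S) = e k * mono (alpha, S).
Proof. by rewrite /mono big_cons mulrA. Qed.

Variables (r s : nat).
Hypothesis lD : forall j, (j < r)%N -> additive_form (l j).
Hypothesis esym : forall i, (i < s)%N -> symmetric_cocycle (e i).

Lemma dif_prod_e alpha : all (fun i => i < s)%N alpha -> dif (\prod_(i <- alpha) e i) = 0.
Proof. by move=> /allP h; apply: dif_prod => i /h /esym[]. Qed.

Lemma dif_prod_l S : all (fun j => j < r)%N S -> dif (\prod_(j <- S) of1 (l j)) = 0.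
Proof. by move=> /allP h; apply: dif_prod => i /h /lD/dif_additive. Qed.

Lemma dif_mono n m : standard r s n m -> dif (mono m) = 0.
Proof.
by move=> /and5P[_ h2 _ h4 _]; apply: cocycleM; [apply: dif_prod_e|apply: dif_prod_l].
Qed.

Lemma dif_sum_mono n (ms : seq monomial) : all (standard r s n) ms ->
  dif (\sum_(m <- ms) mono m) = 0.
Proof. by move=> /allP h; apply: dif_sum0 => m /h; apply: dif_mono. Qed.

Lemma homogeneous_mono n m : standard r s n m -> homogeneous n (mono m).
Proof.
move=> /and5P[_ h2 _ _ /eqP <-]; apply: homogeneousM.
  elim: (m.1) h2 => [|i alpha IH] /=; first by rewrite big_nil => _; apply: homogeneous1.
  move=> /andP[/esym[he _ _] /IH h]; rewrite big_cons doubleS -[X in homogeneous X]add2n.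
  exact: homogeneousM.
elim: (m.2) => [|j S IH]; first by rewrite big_nil; apply: homogeneous1.
by rewrite big_cons; apply: (@homogeneousM _ 1) => //; apply: homogeneous_of1.
Qed.

(** The even classes stand first in a monomial, so a new character has to be moved past them; in
    contrast to [mono_consl], this costs a coboundary. *)
Lemma mono_consr n k alpha S : (k < r)%N -> standard r s n (alpha, S) ->
  cohomologous (of1 (l k) * mono (alpha, S)) (mono (alpha, k :: S)).
Proof.
move=> kr /and5P[/= _ ha _ hS _]; rewrite /mono big_cons /= !mulrA.
apply: cohomologousM; [|exact: dif_prod_l| |exact: cohomologous_refl].
  by apply: cocycleM; [apply: dif_additive; apply: lD|apply: dif_prod_e].
by apply: of1_commute; [apply: lD|apply: dif_prod_e].
Qed.

End Monomials.

(* On 2-torsion elements this is the linear form a |-> 2 a', where a' lifts a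
   to the extension of [A] by F2 defined by [e]. *)
Definition diagonal A (e : cochains A) (a : A) (z : A) : F2 := e [:: a; a] + e [:: z; z].

Definition torsion_form (A : zmodType) (psi : A -> F2) :=
  forall a b : A, a *+ 2 = 0 -> b *+ 2 = 0 -> psi (a + b) = psi a + psi b.

(** Over F2 a linear combination is a list of monomials, and a nontrivial relation is a nonempty
    list without repetitions. The points [t] and [b], dual to the characters and to the diagonals of
    the even classes, allow 2-cocycles to be tested later without going back to the cyclic
    factors. *)
Record cohomology_basis (A : zmodType) (r s : nat) (l : nat -> A -> F2)
    (e : nat -> cochains A) (t b : nat -> A) : Prop := CohomologyBasis {
  cb_additive : forall j, (j < r)%N -> additive_form (l j);
  cb_symmetric : forall i, (i < s)%N -> symmetric_cocycle (e i);
  cb_dual : forall i j, (i < r)%N -> (j < r)%N -> l i (t j) = (i == j)%:R;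
  cb_torsion : forall j, (j < s)%N -> b j *+ 2 = 0;
  cb_diagonal : forall i j, (i < s)%N -> (j < s)%N -> diagonal (e i) (b j) 0 = (i == j)%:R;
  cb_torsion_form : forall psi, torsion_form psi -> forall a : A, a *+ 2 = 0 ->
    psi a = \sum_(i < s) psi (b i) * diagonal (e i) a 0;
  cb_span : forall n z, homogeneous n z -> dif z = 0 ->
    exists2 ms, all (standard r s n) ms & cohomologous z (\sum_(m <- ms) mono e l m);
  cb_indep : forall n ms, uniq ms -> all (standard r s n) ms ->
    exact_cochain (\sum_(m <- ms) mono e l m) -> ms = [::]
}.

Lemma pull_symmetric (A B : zmodType) (h : {additive A -> B}) f :
  symmetric_cocycle f -> symmetric_cocycle (pull h f).
Proof.
move=> [hf df fC]; split; last by move=> a c; apply: fC.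
  by move=> a an; apply: hf; rewrite size_map.
by rewrite -pull_dif df.
Qed.

Lemma cohomologous_pull (A B : zmodType) (h : {additive A -> B}) f g :
  cohomologous f g -> cohomologous (pull h f) (pull h g).
Proof. by move=> [u uE]; exists (pull h u); rewrite -pull_dif -uE. Qed.

Lemma cohomologous_part (A : zmodType) n (f g : cochains A) :
  cohomologous f g -> cohomologous (part n f) (part n g).
Proof.
move=> [u uE]; rewrite /cohomologous -partD uE.
case: n => [|n]; first by rewrite part_dif0; apply: exact_cochain0.
by rewrite part_dif; exists (part n u).
Qed.

Lemma dif_part (A : zmodType) n (f : cochains A) : dif f = 0 -> dif (part n f) = 0.
Proof. by rewrite -part_dif => ->; apply: cochainsP => x; rewrite /part; case: ifP. Qed.

Lemma homogeneous_pull (A B : zmodType) (h : {additive A -> B}) n f :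
  homogeneous n f -> homogeneous n (pull h f).
Proof. by move=> hf a an; apply: hf; rewrite size_map. Qed.

(** * Extending a basis by one cyclic factor *)

Section Step.
Variables (B X : zmodType).
Let A : zmodType := (B * X)%type.

Definition incl (b : B) : A := (b, 0).
Fact incl_additive : zmod_morphism incl.
Proof. by move=> a b; rewrite /incl; congr pair; rewrite /= subr0. Qed.
HB.instance Definition _ := GRing.isZmodMorphism.Build B A incl incl_additive.

Definition inclr (x : X) : A := (0, x).
Fact inclr_additive : zmod_morphism inclr.
Proof. by move=> a b; rewrite /inclr; congr pair; rewrite /= subr0. Qed.
HB.instance Definition _ := GRing.isZmodMorphism.Build X A inclr inclr_additive.

Definition projl (a : A) : A := incl a.1.
Fact projl_additive : zmod_morphism projl.
Proof. by move=> a b; rewrite /projl !raddfB. Qed.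
HB.instance Definition _ := GRing.isZmodMorphism.Build A A projl projl_additive.

Let p : {additive A -> A} := projl.
Let f1 : {additive A -> B} := fst.
Let i1 : {additive B -> A} := incl.

Lemma pull_projl f : pull p f = pull f1 (pull i1 f).
Proof. by symmetry; apply: pull_comp. Qed.

Lemma pull_incl_fst f : pull i1 (pull f1 f) = f.
Proof. by rewrite (@pull_comp _ _ _ i1 f1 f idfun) //; apply: pull_id. Qed.

Lemma pull_projl_fst f : pull p (pull f1 f) = pull f1 f.
Proof. by rewrite pull_projl pull_incl_fst. Qed.

(** [bL] and [bE] say whether [X] brings a character and an even class: only a character for the
    integers, neither in odd order, both in even order. [t0] and [b0] are the corresponding dual
    points. *)
Variables (bL bE : bool) (lam : X -> F2) (kap : X -> X -> F2) (t0 b0 : X).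
Hypothesis lamD : forall a b, lam (a + b) = lam a + lam b.
Hypothesis lam_t : bL -> lam t0 = 1.
Hypothesis kapC : forall a b, kap a b = kap b a.
Hypothesis kap0 : kap 0 0 = 0.
Hypothesis kap_cocycle : forall a b c,
  kap b c + kap (a + b) c + kap a (b + c) + kap a b = 0.
Hypothesis b0_torsion : b0 *+ 2 = 0.
Hypothesis kap_b0 : bE -> kap b0 b0 = 1.
Hypothesis torsionX : forall x : X, x *+ 2 = 0 -> x = 0 \/ bE /\ x = b0.

Let lnew := of1 (fun a : A => lam a.2).
Let enew := of2 (fun a b : A => kap a.2 b.2).

Hypothesis split : forall z : cochains A, dif z = 0 -> exists v z',
  [/\ pull p v = v /\ dif v = 0, dif z' = 0, ~~ bL -> v = 0, ~~ bE -> z' = 0 &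
      cohomologous z (pull p z + lnew * v + enew * z')].
Hypothesis unique : forall u v z : cochains A, pull p u = u -> pull p v = v ->
  dif u = 0 -> dif v = 0 -> dif z = 0 -> (~~ bL -> v = 0) -> (~~ bE -> z = 0) ->
  exact_cochain (u + lnew * v + enew * z) ->
  [/\ exact_cochain u, exact_cochain v & exact_cochain z].

Variables (r s : nat) (l : nat -> B -> F2) (e : nat -> cochains B) (t b : nat -> B).
Hypothesis basis : cohomology_basis r s l e t b.

(** The new character and the new even class get the largest indices [r] and [s]. As index lists
    decrease, a standard monomial contains one of them exactly when the corresponding list begins
    with it. *)
Definition step_l (j : nat) (a : A) : F2 := if j == r then lam a.2 else l j a.1.
Definition step_e (i : nat) : cochains A := if i == s then enew else pull f1 (e i).
Definition step_t (j : nat) : A := if j == r then (0, t0) else (t j, 0).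
Definition step_b (i : nat) : A := if i == s then (0, b0) else (b i, 0).

Let r' := (r + bL)%N.
Let s' := (s + bE)%N.

Let lt_r' j : (j < r')%N -> (j == r /\ bL) \/ ((j == r) = false /\ (j < r)%N).
Proof.
rewrite /r'; case: bL; rewrite ?addn1 ?addn0 ?ltnS => jr; last first.
  by right; rewrite jr ltn_eqF.
by move: jr; rewrite leq_eqVlt; case: eqP => [->|_] /= jr; [left|right].
Qed.

Let lt_s' j : (j < s')%N -> (j == s /\ bE) \/ ((j == s) = false /\ (j < s)%N).
Proof.
rewrite /s'; case: bE; rewrite ?addn1 ?addn0 ?ltnS => jr; last first.
  by right; rewrite jr ltn_eqF.
by move: jr; rewrite leq_eqVlt; case: eqP => [->|_] /= jr; [left|right].
Qed.

Let enew_symmetric : symmetric_cocycle enew.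
Proof.
split; [exact: homogeneous_of2| |by move=> a c; rewrite /= kapC].
rewrite dif_of2; apply: cochainsP => -[|a1 [|a2 [|a3 [|]]]] //= .
Qed.

Let step_additive j : (j < r')%N -> additive_form (step_l j).
Proof.
move=> /lt_r'[[/eqP -> _]|[jr jr']] a c; rewrite /step_l ?eqxx ?jr //.
  exact: lamD.
exact: (cb_additive basis jr' a.1 c.1).
Qed.

Let step_symmetric i : (i < s')%N -> symmetric_cocycle (step_e i).
Proof.
move=> /lt_s'[[/eqP -> _]|[is_ is']]; rewrite /step_e ?eqxx ?is_ //.
exact/pull_symmetric/(cb_symmetric basis).
Qed.

Let pull_of1 chi : pull f1 (of1 chi) = of1 (chi \o f1).
Proof. by apply: cochainsP => -[|a []]. Qed.

Let pull_mono n m : standard r s n m -> pull f1 (mono e l m) = mono step_e step_l m.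
Proof.
move=> /and5P[_ /allP h2 _ /allP h4 _]; rewrite /mono pullM !pull_prod.
congr (_ * _); apply: eq_big_seq => i.
  by move=> /h2 /ltn_eqF si; rewrite /step_e si.
by move=> /h4 /ltn_eqF si; rewrite pull_of1 /step_l si.
Qed.

Let pull_sum_mono n ms : all (standard r s n) ms ->
  pull f1 (\sum_(m <- ms) mono e l m) = \sum_(m <- ms) mono step_e step_l m.
Proof. by move=> /allP h; rewrite pull_sum; apply: eq_big_seq => m /h/pull_mono. Qed.

Let std_up n m : standard r s n m -> standard r' s' n m.
Proof. by apply: standard_widen; rewrite leq_addr. Qed.

Let part_lnew n v : part n (lnew * v) = if n is n'.+1 then lnew * part n' v else 0.
Proof.
case: n => [|n]; last by rewrite -add1n (partM _ _ (@homogeneous_of1 _ _)).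
by apply: cochainsP => -[|a l0] //; rewrite /part /= mulc_nil mul0r.
Qed.

Let part_enew n v : part n (enew * v) = if n is n'.+2 then enew * part n' v else 0.
Proof.
case: n => [|[|n]]; last by rewrite -add2n (partM _ _ (@homogeneous_of2 _ _)).
  by apply: cochainsP => -[|a l0] //; rewrite /part /= mulc_nil mul0r.
apply: cochainsP => -[|a [|c l0]] //; rewrite /part /= mulc_cons mulc_nil mul0r.
by rewrite [(_ @@ _) _]/(0 : F2) mul0r addr0.
Qed.

(** Of the three terms given by [split], two are expressed through cocycles from [B]; the third is
    [enew] times a cocycle on [A] of degree lower by 2, to which induction applies. *)
Let step_span n z : homogeneous n z -> dif z = 0 ->
  exists2 ms, all (standard r' s' n) ms & cohomologous z (\sum_(m <- ms) mono step_e step_l m).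
Proof.
elim/ltn_ind: n z => n IHn z hz dz.
have spanB k u : homogeneous k u -> pull p u = u -> dif u = 0 ->
    exists2 ms, all (standard r s k) ms & cohomologous u (\sum_(m <- ms) mono step_e step_l m).
  move=> hu pu du.
  have [||ms std_ms msE] := @cb_span _ _ _ _ _ _ _ basis k (pull i1 u).
  - exact: homogeneous_pull.
  - by rewrite -pull_dif du.
  exists ms => //; rewrite -pu pull_projl -(pull_sum_mono std_ms).
  exact: cohomologous_pull.
have [v [z' [[pv dv] dz' v0 z'0 zE]]] := split dz.
(* The cochains [v] and [z'] need not be homogeneous; only their components of degrees [n - 1] and
   [n - 2] matter. *)
have {}zE := cohomologous_part n zE.
rewrite !partD part_lnew part_enew (part_homogeneous hz) (part_homogeneous (homogeneous_pull p hz)) in zE.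
have [ms1 std1 ms1E] : exists2 ms, all (standard r' s' n) ms &
    cohomologous (pull p z) (\sum_(m <- ms) mono step_e step_l m).
  have [|||ms std_ms msE] := spanB n (pull p z).
  - exact: homogeneous_pull.
  - by rewrite (pull_projl z) pull_projl_fst.
  - by rewrite -pull_dif dz.
  by exists ms => //; apply: sub_all std_ms => m; apply: std_up.
have [ms2 std2 ms2E] : exists2 ms, all (standard r' s' n) ms &
    cohomologous (if n is n'.+1 then lnew * part n' v else 0) (\sum_(m <- ms) mono step_e step_l m).
  case: (n) => [|k]; first by exists [::] => //; rewrite big_nil; apply: cohomologous_refl.
  case hL: bL; last first.
    exists [::] => //; rewrite big_nil v0 ?hL //.
    have -> : part k 0 = 0 :> cochains A by apply: cochainsP => x; rewrite /part; case: ifP.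
    by rewrite mulr0; apply: cohomologous_refl.
  have [|||ms std_ms msE] := spanB k (part k v).
  - exact: homogeneous_part.
  - by rewrite -{2}pv; apply: cochainsP => x; rewrite /pull /part size_map.
  - exact: dif_part.
  exists [seq (m.1, r :: m.2) | m <- ms].
    rewrite all_map; apply: sub_all std_ms => -[alpha S] std_m /=.
    rewrite standard_consr (std_up std_m) /r' hL addn1 leqnn /=.
    by case/and5P: std_m => _ _ _ -> _.
  have dl : dif lnew = 0 by apply: dif_additive => a c; apply: lamD.
  apply: (@cohomologous_trans _ (lnew * \sum_(m <- ms) mono step_e step_l m)).
    apply: cohomologousM msE => //; last exact: cohomologous_refl.
    apply: (dif_sum_mono step_additive step_symmetric (n := k)).
    by apply: sub_all std_ms => m; apply: std_up.
  rewrite mulr_sumr big_map big_seq [X in cohomologous _ X]big_seq.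
  apply: (big_ind2 (@cohomologous A)); [exact: cohomologous_refl|by move=> *; apply: cohomologousD|].
  move=> [alpha S] /(allP std_ms) /std_up std_m.
  have lr : (r < r')%N by rewrite /r' hL addn1.
  have := mono_consr step_additive step_symmetric lr std_m.
  by have -> : step_l r = fun a => lam a.2 by apply: funext => a; rewrite /step_l eqxx.
have [ms3 std3 ms3E] : exists2 ms, all (standard r' s' n) ms &
    cohomologous (if n is n'.+2 then enew * part n' z' else 0) (\sum_(m <- ms) mono step_e step_l m).
  case: (n) IHn => [|[|k]] IHn; try by exists [::] => //; rewrite big_nil; apply: cohomologous_refl.
  case hE: bE; last first.
    exists [::] => //; rewrite big_nil z'0 ?hE //.
    have -> : part k 0 = 0 :> cochains A by apply: cochainsP => x; rewrite /part; case: ifP.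
    by rewrite mulr0; apply: cohomologous_refl.
  have [|||ms std_ms msE] := IHn k _ (part k z').
  - by [].
  - exact: homogeneous_part.
  - exact: dif_part.
  exists [seq (s :: m.1, m.2) | m <- ms].
    rewrite all_map; apply: sub_all std_ms => -[alpha S] std_m /=.
    rewrite standard_consl std_m andbT /s' hE addn1 leqnn /= andbT.
    by case/and5P: std_m => _; rewrite /s' hE addn1.
  rewrite big_map; have <- : enew * (\sum_(m <- ms) mono step_e step_l m) =
      \sum_(m <- ms) mono step_e step_l (s :: m.1, m.2).
    rewrite mulr_sumr; apply: eq_bigr => -[alpha S] _.
    by rewrite mono_consl /step_e eqxx.
  have [_ de _] := enew_symmetric.
  apply: cohomologousM msE => //; last exact: cohomologous_refl.
  exact: (dif_sum_mono step_additive step_symmetric std_ms).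
exists (ms1 ++ ms2 ++ ms3); first by rewrite !all_cat std1 std2.
apply: cohomologous_trans zE _; rewrite !big_cat /= addrA.
by apply: cohomologousD => //; apply: cohomologousD.
Qed.

Let isE (m : monomial) := ohead m.1 == Some s.
Let isL (m : monomial) := ohead m.2 == Some r.

Let std_isE n m : standard r' s' n m -> isE m ->
  [/\ m = (s :: behead m.1, m.2), bE, (1 < n)%N & standard r' s' n.-2 (behead m.1, m.2)].
Proof.
case: m => -[|k alpha] S //; rewrite standard_consl => /and4P[_ ks n1 std_m] /eqP[kE].
subst k; split=> //; case: (lt_s' ks) => [[]//|[_]].
by rewrite ltnn.
Qed.

Let std_notE n m : standard r' s' n m -> ~~ isE m -> standard r' s n m.
Proof.
case: m => -[|k alpha] S /and5P[/= h1 h2 h3 h4 h5]; first by move=> _; apply/and5P.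
rewrite /isE /= => ks; apply/and5P; split=> //=.
have tr : transitive geq by move=> a b' c ab ca; apply: leq_trans ca ab.
move/andP: h2 => [/lt_s'[[/eqP kE _]|[_ ks'] _]].
  by rewrite kE eqxx in ks.
rewrite ks' /=; apply: sub_all (order_path_min tr h1) => i /= ik.
exact: leq_ltn_trans ik ks'.
Qed.

Let std_isL n m : standard r' s n m -> isL m ->
  [/\ m = (m.1, r :: behead m.2), bL, (0 < n)%N & standard r s n.-1 (m.1, behead m.2)].
Proof.
case: m => alpha [|k S] //; rewrite standard_consr => /and4P[allr kr n1 std_m] /eqP[kE].
subst k; split=> //; first by case: (lt_r' kr) => [[]//|[_]]; rewrite ltnn.
by case/and5P: std_m => h1 h2 h3 h4 h5; apply/and5P.
Qed.

Let std_notL n m : standard r' s n m -> ~~ isL m -> standard r s n m.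
Proof.
case: m => alpha [|k S] /and5P[/= h1 h2 h3 h4 h5]; first by move=> _; apply/and5P.
rewrite /isL /= => kr; apply/and5P; split=> //=.
have tr : transitive gtn by move=> a b' c ab ca; apply: ltn_trans ca ab.
move/andP: h4 => [/lt_r'[[/eqP kE _]|[_ kr'] _]].
  by rewrite kE eqxx in kr.
rewrite kr' /=; apply: sub_all (order_path_min tr h3) => i /= ik.
exact: ltn_trans ik kr'.
Qed.

Let exact_old n ms : uniq ms -> all (standard r s n) ms ->
  exact_cochain (\sum_(m <- ms) mono step_e step_l m) -> ms = [::].
Proof.
move=> uniq_ms std_ms [g gE]; apply: (cb_indep basis uniq_ms std_ms).
exists (pull i1 g); rewrite -pull_dif -gE -(pull_sum_mono std_ms).
by rewrite pull_incl_fst.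
Qed.

(** The monomials fall into those with [enew], those with [lnew] but not [enew], and the old ones.
    By [unique] each class, with its new factor removed, is itself a relation: the last two over
    [B], the first over [A] in degree [n - 2], where induction applies. *)
Let step_indep n ms : uniq ms -> all (standard r' s' n) ms ->
  exact_cochain (\sum_(m <- ms) mono step_e step_l m) -> ms = [::].
Proof.
elim/ltn_ind: n ms => n IHn ms uniq_ms std_ms ex.
pose E := [seq (behead m.1, m.2) | m <- ms & isE m].
pose L := [seq (m.1, behead m.2) | m <- ms & ~~ isE m && isL m].
pose O := [seq m <- ms | ~~ isE m && ~~ isL m].
have stdE : all (standard r' s' n.-2) E.
  rewrite all_map; apply/allP => m; rewrite mem_filter => /andP[mE mms] /=.
  by have [] := std_isE (allP std_ms m mms) mE.
have stdL : all (standard r s n.-1) L.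
  rewrite all_map; apply/allP => m; rewrite mem_filter => /andP[/andP[mE mL] mms] /=.
  by have [] := std_isL (std_notE (allP std_ms m mms) mE) mL.
have stdO : all (standard r s n) O.
  apply/allP => m; rewrite mem_filter => /andP[/andP[mE mL] mms] /=.
  exact: std_notL (std_notE (allP std_ms m mms) mE) mL.
have uniqE : uniq E.
  rewrite map_inj_in_uniq ?filter_uniq // => m1 m2; rewrite !mem_filter.
  move=> /andP[mE1 /(allP std_ms) h1] /andP[mE2 /(allP std_ms) h2].
  have [-> _ _ _] := std_isE h1 mE1; have [-> _ _ _] := std_isE h2 mE2.
  by move=> /= [-> ->].
have uniqL : uniq L.
  rewrite map_inj_in_uniq ?filter_uniq // => m1 m2; rewrite !mem_filter.
  move=> /andP[/andP[mE1 mL1] /(allP std_ms) h1] /andP[/andP[mE2 mL2] /(allP std_ms) h2].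
  have [-> _ _ _] := std_isL (std_notE h1 mE1) mL1.
  have [-> _ _ _] := std_isL (std_notE h2 mE2) mL2.
  by move=> /= [-> ->].
have uniqO : uniq O by rewrite filter_uniq.
pose S := fun ms : seq monomial => \sum_(m <- ms) mono step_e step_l m.
have sumE : \sum_(m <- ms | isE m) mono step_e step_l m = enew * S E.
  rewrite /S big_map big_filter mulr_sumr big_seq_cond [RHS]big_seq_cond.
  apply: eq_bigr => m /andP[mms mE]; have [mEq _ _ _] := std_isE (allP std_ms m mms) mE; rewrite [in LHS]mEq.
  by rewrite mono_consl /step_e eqxx.
have sumL : cohomologous (lnew * S L) (\sum_(m <- ms | ~~ isE m && isL m) mono step_e step_l m).
  rewrite /S big_map big_filter mulr_sumr big_seq_cond [X in cohomologous _ X]big_seq_cond.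
  apply: (big_ind2 (@cohomologous A)); [exact: cohomologous_refl|by move=> *; apply: cohomologousD|].
  move=> m /andP[mms /andP[mE mL]].
  have [mEq hL _ std_m] := std_isL (std_notE (allP std_ms m mms) mE) mL.
  rewrite [X in cohomologous _ (mono _ _ X)]mEq.
  have lr : (r < r')%N by rewrite /r' hL addn1.
  have := mono_consr step_additive step_symmetric lr (std_up std_m).
  by have -> : step_l r = fun a => lam a.2 by apply: funext => a; rewrite /step_l eqxx.
have dS k (ms' : seq monomial) : all (standard r' s' k) ms' -> dif (S ms') = 0.
  exact: (dif_sum_mono step_additive step_symmetric).
have pS k (ms' : seq monomial) : all (standard r s k) ms' -> pull p (S ms') = S ms'.
  by move=> std'; rewrite /S -(pull_sum_mono std') pull_projl_fst.
have up k (ms' : seq monomial) : all (standard r s k) ms' -> all (standard r' s' k) ms'.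
  by apply: sub_all => m; apply: std_up.
have S_nil : S [::] = 0 by rewrite /S big_nil.
have [eO eL eE] : [/\ exact_cochain (S O), exact_cochain (S L) & exact_cochain (S E)].
  apply: unique; try exact: (pS _ _ stdO); try exact: (pS _ _ stdL).
  - exact: dS (up _ _ stdO).
  - exact: dS (up _ _ stdL).
  - exact: dS stdE.
  - move=> nL; rewrite (_ : L = [::]) //; apply/nilP; rewrite /nilp size_map size_filter.
    rewrite -leqn0 leqNgt -has_count; apply/hasPn => m mms; apply/negP => /andP[mE mL].
    by have [_ hL] := std_isL (std_notE (allP std_ms m mms) mE) mL; rewrite hL in nL.
  - move=> nE; rewrite (_ : E = [::]) //; apply/nilP; rewrite /nilp size_map size_filter.
    rewrite -leqn0 leqNgt -has_count; apply/hasPn => m mms; apply/negP => mE.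
    by have [_ hE] := std_isE (allP std_ms m mms) mE; rewrite hE in nE.
  apply: exact_cohomologous ex; rewrite [X in cohomologous _ X](bigID isE) /= sumE.
  rewrite [X in cohomologous _ (_ + X)](bigID isL) /=.
  have -> : \sum_(m <- ms | ~~ isE m && ~~ isL m) mono step_e step_l m = S O.
    by rewrite /S big_filter.
  have -> : S O + lnew * S L + enew * S E = enew * S E + (lnew * S L + S O).
    by char2 (@addcc A).
  apply: cohomologousD; first exact: cohomologous_refl.
  by apply: cohomologousD; last exact: cohomologous_refl.
have O0 := exact_old uniqO stdO eO.
have L0 := exact_old uniqL stdL eL.
case: ms => [//|m ms'] in uniq_ms std_ms ex E L O stdE stdL stdO uniqE uniqL uniqO sumE sumL eO eL eE O0 L0 *.
exfalso; have mms : m \in m :: ms' by rewrite mem_head.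
case mE : (isE m).
  have [_ _ n1 _] := std_isE (allP std_ms m mms) mE.
  have : E = [::] by apply: (IHn n.-2) eE => //; case: (n) n1 => [|[|k]] // _; apply: ltnW.
  by rewrite /E /= mE.
case mL : (isL m).
  by move: L0; rewrite /L /= mE mL.
by move: O0; rewrite /O /= mE mL.
Qed.

Lemma step_basis : cohomology_basis r' s' step_l step_e step_t step_b.
Proof.
have pair2 c x : ((c, x) : A) *+ 2 = (c *+ 2, x *+ 2) by rewrite !mulr2n.
split=> //.
- move=> i j /lt_r'[[/eqP -> hL]|[ir ir']] /lt_r'[[/eqP -> hL']|[jr jr']].
  + by rewrite /step_l /step_t !eqxx lam_t.
  + rewrite /step_l /step_t eqxx jr eq_sym jr.
    by apply: (@addrI _ (lam 0)); rewrite -lamD !addr0.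
  + rewrite /step_l /step_t eqxx ir /=.
    by apply: (@addrI _ (l i 0)); rewrite -(cb_additive basis ir') !addr0.
  + by rewrite /step_l /step_t ir jr (cb_dual basis).
- move=> j /lt_s'[[/eqP -> _]|[js js']]; rewrite /step_b ?eqxx ?js.
    by rewrite pair2 b0_torsion mul0rn.
  by rewrite pair2 (cb_torsion basis js') mul0rn.
- move=> i j /lt_s'[[/eqP -> hE]|[is_ is']] /lt_s'[[/eqP -> hE']|[js js']].
  + by rewrite /diagonal /step_e /step_b !eqxx /= kap_b0 // kap0 addr0.
  + by rewrite /diagonal /step_e /step_b eqxx js eq_sym js /= kap0 addr0.
  + rewrite /diagonal /step_e /step_b eqxx is_ /=; exact: F2_addxx.
  + by rewrite /diagonal /step_e /step_b is_ js -(cb_diagonal basis).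
move=> psi psiT [a x] ax2.
have a2 : a *+ 2 = 0 by have := congr1 fst ax2.
have x2 : x *+ 2 = 0 by have := congr1 snd ax2.
have incl2 c : c *+ 2 = 0 -> incl c *+ 2 = 0 by move=> c2; rewrite -raddfMn c2 raddf0.
have -> : psi (a, x) = psi (incl a) + psi (inclr x).
  rewrite -psiT; first by congr psi; congr pair; rewrite /= ?addr0 ?add0r.
    exact: incl2.
  by rewrite -raddfMn x2 raddf0.
have psiB : torsion_form (psi \o incl).
  by move=> c d c2 d2; rewrite /= raddfD psiT ?incl2.
have -> : psi (incl a) = _ := cb_torsion_form basis psiB a2.
have psi0 : psi 0 = 0 by apply: (@addrI _ (psi 0)); rewrite -psiT ?mul0rn ?addr0.
rewrite /s'; have -> : \sum_(i < s) (psi \o incl) (b i) * diagonal (e i) a 0 =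
  \sum_(i < s) psi (step_b i) * diagonal (step_e i) (a, x) 0.
  by apply: eq_bigr => i _; rewrite /step_b /step_e (ltn_eqF (ltn_ord i)).
have psi_x : psi (inclr x) = (bE%:R) * (psi (0, b0) * diagonal enew (a, x) 0).
  case: (torsionX x2) => [->|[hE ->]].
    by rewrite raddf0 psi0 /diagonal /= F2_addxx !mulr0.
  by rewrite hE mul1r /diagonal /= kap_b0 // kap0 addr0 mulr1.
rewrite psi_x; case: (bE); last by rewrite mul0r addr0 addn0.
by rewrite mul1r addn1 big_ord_recr /= {3}/step_b {3}/step_e eqxx.
Qed.

End Step.

Definition has_basis (A : zmodType) : Prop := exists r s l e t b,
  @cohomology_basis A r s l e t b.

Lemma trivial_basis (A : zmodType) : (forall x : A, x = 0) -> has_basis A.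
Proof.
move=> A0.
have std00 n m : standard 0 0 n m -> m = ([::], [::]) /\ n = 0%N.
  by case: m => -[|i alpha] [|j S] //=; rewrite /standard /= ?andbF // => /eqP <-.
have zE (z : cochains A) : dif z = 0 -> cohomologous z (of0 (z [::])).
  move=> dz; have dz_at l : dif z l = 0 by rewrite dz.
  (* For the trivial group, inserting 0 as first argument is a contracting homotopy in positive
     degrees. *)
  exists (z @@ 0); apply: cochainsP => -[|a [|b l]]; rewrite addcE.
  - by rewrite dif_nil F2_addxx.
  - have := dz_at [:: 0; a]; rewrite dif_cons2 !dif1 (A0 (0 + a)) (A0 a) => h.
    by rewrite [of0 _ _](_ : _ = 0) // -[RHS]h; char2 F2_addxx.
  have := dz_at [:: 0, a, b & l].
  rewrite (dif_cons2 z 0 a) (A0 (0 + a)) (A0 a) (A0 b) => h.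
  rewrite [of0 _ _](_ : _ = 0) //; apply: (addVV_eq F2_addxx); rewrite -[RHS]h; char2 F2_addxx.
exists 0%N, 0%N, (fun=> fun=> 0), (fun=> 0), (fun=> 0), (fun=> 0); split=> //.
- move=> psi psiT a _; rewrite big_ord0 (A0 a).
  by apply: (@addrI _ (psi 0)); rewrite -psiT ?mul0rn ?addr0.
- move=> n z hz dz; have := zE z dz; case: n hz => [|n] hz; last first.
    rewrite [z [::]]hz // of0_0 => ez; exists [::] => //.
    by rewrite big_nil.
  have [->|->] := F2_cases (z [::]) => ez.
    by exists [::] => //; rewrite big_nil -of0_0.
  by exists [:: ([::], [::])] => //; rewrite big_seq1 /mono /= !big_nil mulr1 -of0_1.
- move=> n [|m ms] // /andP[mms _] /andP[std_m /allP std_ms] [g].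
  have [mE _] := std00 _ _ std_m.
  case: ms mms std_ms => [_ _|m' ms mms std_ms]; last first.
    have [m'E _] := std00 _ _ (std_ms m' (mem_head _ _)).
    by rewrite mE m'E mem_head in mms.
  rewrite big_seq1 mE /mono /= !big_nil mulr1 => /(congr1 (fun f : cochains A => f [::])).
  by rewrite dif_nil.
Qed.

Lemma iso_basis (A B : zmodType) (h : {additive A -> B}) (k : {additive B -> A}) :
  cancel h k -> cancel k h -> has_basis B -> has_basis A.
Proof.
move=> hK kH [r [s [l [e [t [b basis]]]]]].
exists r, s, (fun j => l j \o h), (fun i => pull h (e i)), (k \o t), (k \o b).
have pull_kh f : pull h (pull k f) = f.
  by rewrite (@pull_comp _ _ _ h k f idfun) //; [apply: pull_id|move=> a; rewrite /= hK].
have pull_hk f : pull k (pull h f) = f.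
  by rewrite (@pull_comp _ _ _ k h f idfun) //; [apply: pull_id|move=> a; rewrite /= kH].
have pull_mono m : pull h (mono e l m) = mono (fun i => pull h (e i)) (fun j => l j \o h) m.
  rewrite /mono pullM !pull_prod; congr (_ * _); apply: eq_bigr => j _.
  by apply: cochainsP => -[|a []].
have diagE i a : diagonal (pull h (e i)) a 0 = diagonal (e i) (h a) 0.
  by rewrite /diagonal /pull /= raddf0.
split.
- by move=> j jr a c /=; rewrite raddfD (cb_additive basis).
- by move=> i is_; apply/pull_symmetric/(cb_symmetric basis).
- by move=> i j ir jr; rewrite /= kH (cb_dual basis).
- by move=> j js; rewrite /= -raddfMn (cb_torsion basis) ?raddf0.
- by move=> i j is_ js; rewrite diagE /= kH (cb_diagonal basis).
- move=> psi psiT a a2; have kT : torsion_form (psi \o k).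
    by move=> c d c2 d2; rewrite /= raddfD psiT -?raddfMn ?c2 ?d2 ?raddf0.
  have ha2 : h a *+ 2 = 0 by rewrite -raddfMn a2 raddf0.
  have := cb_torsion_form basis kT ha2; rewrite /= hK => ->.
  by apply: eq_bigr => i _; rewrite diagE.
- move=> n z hz dz.
  have [||ms std_ms msE] := @cb_span _ _ _ _ _ _ _ basis n (pull k z).
  + exact: homogeneous_pull.
  + by rewrite -pull_dif dz.
  exists ms => //; have := cohomologous_pull h msE; rewrite pull_kh pull_sum.
  by rewrite (eq_bigr _ (fun m _ => pull_mono m)).
- move=> n ms uniq_ms std_ms [g gE]; apply: (cb_indep basis uniq_ms std_ms).
  exists (pull k g); rewrite -pull_dif -gE pull_sum; apply: eq_bigr => m _.
  by rewrite -pull_mono pull_hk.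
Qed.

(** * The integers and the cyclic groups of odd and of even order *)

Section CyclicSteps.
Variables (B : zmodType) (basisB : has_basis B).

Let projE (X : zmodType) (a : (B * X)%type) : projl a + inclr B (snd a) = a.
Proof. by case: a => b x; rewrite /projl /inclr /incl; congr pair; rewrite /= ?addr0 ?add0r. Qed.

Lemma int_step : has_basis (B * int)%type.
Proof.
have [r [s [l [e [t [b basis]]]]]] := basisB.
pose lam (x : int) : F2 := x%:~R.
have lamD x y : lam (x + y) = lam x + lam y by rewrite /lam intrD.
exists (r + true)%N, (s + false)%N, (step_l lam r l), (step_e (fun _ _ => 0) s e),
  (step_t (1 : int) r t), (step_b (0 : int) s b).
pose A : zmodType := (B * int)%type.
have enew0 : of2 (fun _ _ : A => 0) = 0 by apply: cochainsP => -[|? [|? []]].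
have qp (a : A) : snd (projl a) = 0 by [].
have qs (x : int) : snd (inclr B x) = x by [].
apply: step_basis => //=.
- by move=> *; rewrite !addr0.
- by move=> x /eqP; rewrite Num.Theory.mulrn_eq0 /= => /eqP ->; left.
- move=> z dz; have [v [pv dv zE]] := infinite_split qp qs (@projE _) lamD (erefl : lam 1 = 1) dz.
  exists v, 0; split=> //; first exact: dif0.
  by rewrite enew0 mul0r addr0.
move=> u v z pu pv du dv dz _ z0 uvz.
have [|eu ev] := infinite_unique qp qs (@projE _) lamD (erefl : lam 1 = 1) pu pv du dv.
  by rewrite enew0 mul0r addr0 in uvz.
by split=> //; rewrite z0 //; apply: exact_cochain0.
Qed.

Lemma odd_step m : odd m.+1 -> has_basis (B * 'I_m.+1)%type.
Proof.
move=> m_odd; have [r [s [l [e [t [b basis]]]]]] := basisB.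
exists (r + false)%N, (s + false)%N, (step_l (fun=> 0) r l), (step_e (fun _ _ => 0) s e),
  (step_t (0 : 'I_m.+1) r t), (step_b (0 : 'I_m.+1) s b).
pose A : zmodType := (B * 'I_m.+1)%type.
have enew0 : of2 (fun _ _ : A => 0) = 0 by apply: cochainsP => -[|? [|? []]].
have qp (a : A) : snd (projl a) = 0 by [].
have qs (x : 'I_m.+1) : snd (inclr B x) = x by [].
apply: step_basis => //=.
- by move=> *; rewrite addr0.
- by move=> *; rewrite !addr0.
- by rewrite mul0rn.
- move=> x /(congr1 val) /= /eqP; rewrite -/(dvdn _ _) addnn -mul2n => x2.
  left; apply: val_inj => /=; move: x2; rewrite Gauss_dvdr; last by rewrite coprime_sym coprime2n.
  by rewrite /dvdn modn_small // => /eqP.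
- move=> z dz; exists 0, 0; split=> //; first by split=> //; apply: dif0.
    exact: dif0.
  rewrite !mulr0 !addr0; apply: (odd_split (X := 'I_m.+1) qp qs (@projE _)) => //.
  by rewrite card_ord.
move=> u v z pu pv du dv dz v0 z0; rewrite v0 // z0 // !mulr0 !addr0 => eu.
by split=> //; apply: exact_cochain0.
Qed.

(** For even order N the character is reduction modulo 2, and [kap] is the carry of addition modulo
    N, the cocycle of the extension of Z/N by Z/2 with total group Z/2N. The point [b0] is N/2,
    whose lift doubles to N, the nonzero element of the kernel. *)
Lemma even_step m : ~~ odd m.+1 -> has_basis (B * 'I_m.+1)%type.
Proof.
case: m => // m m_even; have [r [s [l [e [t [b basis]]]]]] := basisB.
pose X := 'I_m.+2.
pose lam (x : X) : F2 := (x : nat)%:R.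
pose kap (x y : X) : F2 := ((x + y) %/ m.+2)%N%:R.
have F2_odd (n : nat) : n%:R = (odd n)%:R :> F2.
  by rewrite -{1}[n]odd_double_half natrD -addnn natrD F2_addxx addr0.
have lamD x y : lam (x + y) = lam x + lam y.
  by rewrite /lam -natrD F2_odd [RHS]F2_odd; congr (nat_of_bool _)%:R; apply/odd_mod/negbTE.
have lam1 : lam 1 = 1 by [].
have half_lt : (m.+2./2 < m.+2)%N by rewrite ltn_half_double -addnn -[X in (X < _)%N]addn0 ltn_add2l.
have halfE : (m.+2./2 + m.+2./2)%N = m.+2.
  by rewrite addnn -[RHS]odd_double_half (negPf m_even).
pose b0 : X := Ordinal half_lt.
have kapC x y : kap x y = kap y x by rewrite /kap addnC.
have kap0 : kap 0 0 = 0 by [].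
have kap_cocycle x y z : kap y z + kap (x + y) z + kap x (y + z) + kap x y = 0.
  (* However three residues are bracketed, the total number of carries is the quotient of their
     integer sum; this is the cocycle identity. *)
  have h (a b' c : X) : (((a + b') %/ m.+2 + (val (a + b')%R + c) %/ m.+2) = (a + b' + c) %/ m.+2)%N.
    by rewrite /= {3}(divn_eq (a + b') m.+2) -addnA divnMDl.
  have -> : kap y z + kap (x + y) z + kap x (y + z) + kap x y =
    (kap y z + kap x (y + z)) + (kap x y + kap (x + y) z) by char2 F2_addxx.
  rewrite {1 2}/kap -natrD [(x + val _)%N]addnC (h y z x) {1 2}/kap -natrD (h x y z).
  by rewrite [(y + z + x)%N]addnC addnA F2_addxx.
exists (r + true)%N, (s + true)%N, (step_l lam r l), (step_e kap s e),
  (step_t (1 : X) r t), (step_b b0 s b).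
pose A : zmodType := (B * X)%type.
have qp (a : A) : snd (projl a) = 0 by [].
have qs (x : X) : snd (inclr B x) = x by [].
have valS (x : X) : val (x + 1)%R = (x.+1 %% m.+2)%N.
  by rewrite /= [(1 %% _)%N]modn_small // addn1.
have sum_kap : \sum_x kap x 1 = 1.
  rewrite big_ord_recr /= big1 ?add0r => [|i _].
    by rewrite /kap /= modn_small // addn1 divnn.
  by rewrite /kap /= modn_small // divn_small // addn1 ltnS.
have X_even : ~~ odd #|X| by rewrite card_ord.
have solve (W : X -> cochains A) : \sum_x W x = 0 -> exists w, forall x, W x = w (x + 1) + w x.
  (* Partial sums of [W] starting at 0; going round from the last residue back to 0 is consistent
     because the total sum vanishes. *)
  move=> W0; exists (fun x : X => \sum_(i < m.+2 | (i < x)%N) W i) => x.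
  apply: (addVV_eq (@addcc A)).
  have -> : W x + (\sum_(i < m.+2 | (i < val (x + 1)%R)%N) W i + \sum_(i < m.+2 | (i < x)%N) W i)
     = \sum_(i < m.+2 | (i < val (x + 1)%R)%N) W i + \sum_(i < m.+2 | (i <= x)%N) W i.
    rewrite [X in _ = _ + X](bigD1 x) //=.
    rewrite (eq_bigl (fun i : 'I_m.+2 => (i < x)%N) W (P1 := fun i => _ && _)).
      by char2 (@addcc A).
    by move=> i; rewrite ltn_neqAle andbC.
  have [xm|xm] := ltnP x.+1 m.+2.
    have -> : val (x + 1) = x.+1 by rewrite valS modn_small.
    exact: addcc.
  have xE : x.+1 = m.+2 by apply/eqP; rewrite eqn_leq ltn_ord.
  have -> : val (x + 1) = 0%N by rewrite valS xE modnn.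
  rewrite big_pred0 ?add0r => [|i]; last by rewrite ltn0.
  by rewrite -[RHS]W0; apply: eq_bigl => i; rewrite -ltnS xE ltn_ord.
have const (y : X -> cochains A) : (forall x, y (x + 1) + y x = 0) -> forall x, y x = y 0.
  move=> y1 x; rewrite -[x]natr_Zp; elim: (x : nat) => // k <-.
  by rewrite -natr1; apply: (addVV_eq (@addcc A)).
apply: step_basis => //=.
- by rewrite mulr2n; apply: val_inj; rewrite /= halfE modnn.
- by move=> _; rewrite /kap /= halfE divnn.
- move=> x /(congr1 val) /=; rewrite -/(dvdn _ _).
  have [x2|x2] := ltnP (x + x) m.+2.
    rewrite modn_small // => /eqP; rewrite addn_eq0 andbb => /eqP x0.
    by left; apply: val_inj.
  rewrite -[(x + x)%N](subnK x2) modnDr modn_small => [x20|]; last first.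
    by rewrite ltn_subLR //; apply: (@leq_trans (m.+2 + x));
      rewrite ?ltn_add2r ?ltn_add2l ?ltn_ord // leq_add2l ltnW.
  right; split=> //; apply: val_inj; change (nat_of_ord x = m.+2./2).
  by rewrite -[LHS]doubleK -addnn -(subnK x2) x20 add0n.
- move=> z dz; have [v [z' [pv dv dz' zE]]] := even_split qp qs (@projE _) lamD lam1
    kapC kap_cocycle sum_kap solve const dz.
  by exists v, z'; split.
move=> u v z pu pv du dv dz _ _.
exact: (even_unique qp qs (@projE _) lamD lam1 kapC kap0 kap_cocycle sum_kap X_even pu pv du dv dz).
Qed.

End CyclicSteps.

(** * Finitely generated groups *)

Section CyclicDecomposition.
Variable A : zmodType.

Lemma mulrz_mod (x : A) (m : nat) (c : int) :
  x *+ m = 0 -> x *~ (c %% m%:Z)%Z = x *~ c.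
Proof.
move=> xm; rewrite [in RHS](divz_eq c m%:Z); move: (c %% m%:Z)%Z => r.
by rewrite mulrzDr mulrC mulrzA -pmulrn xm mul0rz add0r.
Qed.

Definition lincomb k (x : 'I_k -> A) (c : 'I_k -> int) : A := \sum_i x i *~ c i.

Definition generates k (x : 'I_k -> A) (a : A) := exists c, a = lincomb x c.

Lemma generates_lincomb k (x : 'I_k -> A) j (y : 'I_j -> A) (c : 'I_j -> int) :
  (forall i, generates x (y i)) -> generates x (lincomb y c).
Proof.
move=> /fin_all_exists[d dE]; exists (fun i => \sum_h d h i * c h).
rewrite /lincomb; under [RHS]eq_bigr => i _ do rewrite mulrz_sumr.
rewrite exchange_big; apply: eq_bigr => h _ /=; rewrite dE /lincomb.
rewrite mulrz_suml; apply: eq_bigr => i _; by rewrite mulrzA.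
Qed.

Lemma lincomb_recl k (x : 'I_k.+1 -> A) c :
  lincomb x c = x ord0 *~ c ord0 + lincomb (fun i => x (lift ord0 i)) (fun i => c (lift ord0 i)).
Proof. by rewrite /lincomb big_ord_recl. Qed.

Lemma generates_mem k (x : 'I_k -> A) i : generates x (x i).
Proof.
exists (fun j => (j == i)%:R); rewrite /lincomb (bigD1 i) //= eqxx mulr1z.
by rewrite big1 ?addr0 // => j /negPf ->; rewrite mulr0z.
Qed.

Definition same_span k (x y : 'I_k -> A) :=
  (forall i, generates y (x i)) /\ (forall i, generates x (y i)).

Lemma generates_trans k (x y : 'I_k -> A) a :
  (forall i, generates y (x i)) -> generates x a -> generates y a.
Proof. by move=> xy [c ->]; apply: generates_lincomb. Qed.

Lemma same_span_trans k (x y z : 'I_k -> A) :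
  same_span x y -> same_span y z -> same_span x z.
Proof.
move=> [xy yx] [yz zy]; split=> i; first exact: generates_trans yz (xy i).
exact: generates_trans yx (zy i).
Qed.

Lemma same_span_refl k (x : 'I_k -> A) : same_span x x.
Proof. by split=> i; apply: generates_mem. Qed.

Lemma lincombN k (x : 'I_k -> A) c : lincomb x (fun i => - c i) = - lincomb x c.
Proof. by rewrite /lincomb -sumrN; apply: eq_bigr => i _; rewrite mulrNz. Qed.

(* The multiplier m is the least positive leading coefficient of a relation
   between generators spanning the same subgroup; minimality makes it divide
   every other coefficient. *)
Lemma split_cyclic k (x : 'I_k.+1 -> A) : exists y (m : nat),
  [/\ same_span x y, y ord0 *+ m = 0 &
      forall c, lincomb y c = 0 -> (m %| `|c ord0|)%N].
Proof.
pose lead (m : nat) := `[< (0 < m)%N /\ exists y c,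
  [/\ same_span x y, lincomb y c = 0 & c ord0 = m%:Z] >].
have lead_abs y c : same_span x y -> lincomb y c = 0 -> c ord0 != 0 -> lead `|c ord0|%N.
  move=> xy yc c0; apply/asboolP; split; first by rewrite absz_gt0.
  have [cp|cn] := lerP 0 (c ord0).
    by exists y, c; split; rewrite ?gez0_abs.
  exists y, (fun i => - c i); split; rewrite ?lincombN ?yc ?oppr0 //.
  by rewrite ltz0_abs.
have [ex_lead|no_lead] := pselect (exists m, lead m); last first.
  (* Without a nonzero leading coefficient the first generator has infinite order; this is encoded
     by [m = 0]. *)
  exists x, 0%N; split; [exact: same_span_refl|exact: mulr0n|].
  move=> c xc; rewrite dvd0n absz_eq0; apply/negPn/negP => c0.
  by apply: no_lead; exists `|c ord0|%N; apply: lead_abs xc c0; apply: same_span_refl.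
case: (ex_minnP ex_lead) => m /asboolP[m_gt0 [y [c [xy yc c0]]]] m_min.
have small z d : same_span x z -> lincomb z d = 0 -> 0 <= d ord0 -> (d ord0 < m%:Z)%R -> d ord0 = 0.
  move=> xz zd d_ge0 d_lt; apply/eqP/negPn/negP => d0.
  by have := m_min _ (lead_abs z d xz zd d0); rewrite -lez_nat gez0_abs // leNgt d_lt.
pose quo (j : 'I_k) := (c (lift ord0 j) %/ m%:Z)%Z.
pose rem (j : 'I_k) := (c (lift ord0 j) %% m%:Z)%Z.
pose tail i := y (lift ord0 i).
(* With the quotients absorbed into the leading generator, the relation [c] becomes one with leading
   coefficient [m] and remainders elsewhere. *)
pose y' (i : 'I_k.+1) := if unlift ord0 i is Some j then tail j else y ord0 + lincomb tail quo.
have y'0 : y' ord0 = y ord0 + lincomb tail quo by rewrite /y' unlift_none.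
have y'S j : y' (lift ord0 j) = tail j by rewrite /y' liftK.
have y'tail d : lincomb (fun i => y' (lift ord0 i)) d = lincomb tail d.
  by apply: eq_bigr => j _; rewrite y'S.
have yy' : same_span y y'.
  split=> i; case: (unliftP ord0 i) => [j ->|->].
  - by rewrite -/(tail j) -y'S; apply: generates_mem.
  - exists (fun i => if unlift ord0 i is Some j then - quo j else 1).
    rewrite lincomb_recl unlift_none mulr1z y'0 y'tail.
    have -> : lincomb tail (fun i => if unlift ord0 (lift ord0 i) is Some j then - quo j else 1) =
        - lincomb tail quo.
      by rewrite -lincombN; apply: eq_bigr => j _; rewrite liftK.
    by rewrite addrK.
  - by rewrite y'S; apply: generates_mem.
  exists (fun i => if unlift ord0 i is Some j then quo j else 1).
  rewrite lincomb_recl unlift_none mulr1z y'0; congr (_ + _).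
  by apply: eq_bigr => j _; rewrite liftK.
have xy' := same_span_trans xy yy'.
pose c' (i : 'I_k.+1) := if unlift ord0 i is Some j then rem j else m%:Z.
have y'c' : lincomb y' c' = 0.
  rewrite -yc !lincomb_recl y'tail y'0 {1}/c' unlift_none c0 mulrzDl -addrA; congr (_ + _).
  rewrite /lincomb mulrz_suml -big_split; apply: eq_bigr => j _ /=.
  by rewrite /c' liftK -mulrzA -mulrzDr -divz_eq.
have m_neq0 : m%:Z != 0 by move: m_gt0; rewrite lt0n.
have rem0 j : rem j = 0.
  (* Swapping generator [j] to the front makes its remainder a leading coefficient smaller than [m],
     so minimality forces it to be 0. *)
  pose s := tperm ord0 (lift ord0 j).
  have := small (y' \o s) (c' \o s); rewrite /= tpermL /c' liftK; apply.
  - have [xg gx] := xy'; split=> i; last exact: gx.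
    apply: generates_trans (xg i) => h.
    by rewrite -[h](tpermK ord0 (lift ord0 j)); apply: (generates_mem (y' \o s)).
  - rewrite -[RHS]y'c' /lincomb [RHS](reindex_inj (@perm_inj _ s)) /=.
    by apply: eq_bigr.
  - exact: modz_ge0.
  - by apply: ltz_pmod; rewrite ltz_nat.
exists y', m; split=> //.
  rewrite pmulrn; have := y'c'; rewrite lincomb_recl {1}/c' unlift_none y'tail.
  have -> : lincomb tail (fun i => c' (lift ord0 i)) = 0; last by rewrite addr0.
  by rewrite /lincomb big1 // => j _; rewrite /c' liftK rem0 mulr0z.
move=> d y'd; have y'm : y' ord0 *~ m%:Z = 0.
  have := y'c'; rewrite lincomb_recl {1}/c' unlift_none y'tail.
  have -> : lincomb tail (fun i => c' (lift ord0 i)) = 0; last by rewrite addr0.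
  by rewrite /lincomb big1 // => j _; rewrite /c' liftK rem0 mulr0z.
have := small y' (fun i => if unlift ord0 i is Some j then d i else (d ord0 %% m%:Z)%Z) xy'.
rewrite unlift_none => h; have {}h : (d ord0 %% m%:Z)%Z = 0.
  apply: h; [|exact: modz_ge0|by apply: ltz_pmod; rewrite ltz_nat].
  rewrite -y'd !lincomb_recl unlift_none; congr (_ + _); last first.
    by apply: eq_bigr => j _; rewrite liftK.
  by apply: mulrz_mod; rewrite pmulrn.
by have : (m%:Z %| d ord0)%Z by apply/dvdz_mod0P.
Qed.

(** The last two clauses say that the subgroup is the direct sum of the cyclic groups of the [y i],
    of orders [m i], with 0 standing for infinite order. *)
Lemma cyclic_decomposition k (x : 'I_k -> A) : exists y (m : 'I_k -> nat),
  [/\ same_span x y, forall i, y i *+ m i = 0 &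
      forall c, lincomb y c = 0 -> forall i, (m i %| `|c i|)%N].
Proof.
elim: k x => [|k IHk] x.
  by exists x, (fun=> 0%N); split; [exact: same_span_refl|case|move=> c _ []].
have [y [m [xy y0 ydvd]]] := split_cyclic x.
have [z [n [[yz zy] z0 zdvd]]] := IHk (fun i => y (lift ord0 i)).
pose w i := if unlift ord0 i is Some j then z j else y ord0.
have w0 : w ord0 = y ord0 by rewrite /w unlift_none.
have wS j : w (lift ord0 j) = z j by rewrite /w liftK.
have up j (u v : 'I_k.+1 -> A) : (forall i, u (lift ord0 i) = v (lift ord0 i)) ->
    generates (fun i => u (lift ord0 i)) j -> generates v j.
  move=> uv [c ->]; exists (fun i => if unlift ord0 i is Some h then c h else 0).
  rewrite lincomb_recl unlift_none mulr0z add0r.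
  by apply: eq_bigr => h _; rewrite liftK uv.
have yw : same_span y w.
  split=> i; case: (unliftP ord0 i) => [j ->|->].
  - by apply: (up _ w) => //; have [c cE] := yz j; exists c; rewrite cE; apply: eq_bigr => h _; rewrite wS.
  - by rewrite -w0; apply: generates_mem.
  - by rewrite wS; apply: (up _ y) => //; apply: zy.
  - by rewrite w0; apply: generates_mem.
exists w, (fun i => if unlift ord0 i is Some j then n j else m); split.
- exact: same_span_trans xy yw.
- by move=> i; case: (unliftP ord0 i) => [j ->|->]; rewrite ?liftK ?unlift_none ?wS ?w0.
move=> c; rewrite lincomb_recl w0 => cE.
have zE : lincomb (fun i => w (lift ord0 i)) (fun i => c (lift ord0 i)) =
    lincomb z (fun i => c (lift ord0 i)) by apply: eq_bigr => j _; rewrite wS.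
rewrite zE in cE.
have m_dvd : (m %| `|c ord0|)%N.
  have [d dE] := generates_lincomb (fun i => c (lift ord0 i)) zy.
  have := ydvd (fun i => if unlift ord0 i is Some j then d j else c ord0).
  rewrite unlift_none; apply; rewrite lincomb_recl unlift_none -[RHS]cE dE.
  by congr (_ + _); apply: eq_bigr => j _; rewrite liftK.
have yc0 : y ord0 *~ c ord0 = 0.
  rewrite -(mulrz_mod (c ord0) y0).
  have /dvdz_mod0P -> : (m%:Z %| c ord0)%Z by [].
  exact: mulr0z.
move: cE; rewrite yc0 add0r => /zdvd zd i.
by case: (unliftP ord0 i) => [j ->|->]; rewrite ?liftK ?unlift_none.
Qed.

(** The internal direct sum is replaced by an external product [G] of cyclic groups, the form in
    which a basis can be extended factor by factor. *)
Lemma decomposition_basis k (y : 'I_k -> A) (m : 'I_k -> nat) :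
  (forall i, y i *+ m i = 0) ->
  (forall c, lincomb y c = 0 -> forall i, (m i %| `|c i|)%N) ->
  exists (G : zmodType) (f : {additive G -> A}),
    [/\ has_basis G, injective f & forall a, generates y a <-> exists g, f g = a].
Proof.
elim: k y m => [|k IHk] y m y0 ydvd.
  exists 'I_1, \0; split.
  - by apply: trivial_basis => x; rewrite [x]ord1.
  - by move=> a b _; rewrite [a]ord1 [b]ord1.
  move=> a; split=> [[c ->]|[g <-]]; last by exists (fun=> 0); rewrite /lincomb big_ord0.
  by exists 0; rewrite /lincomb big_ord0.
have [||G [f [basisG f_inj f_gen]]] := IHk (fun i => y (lift ord0 i)) (fun i => m (lift ord0 i)).
- by move=> i; apply: y0.
- move=> c yc i; have := ydvd (fun i => if unlift ord0 i is Some j then c j else 0).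
  move=> /(_ _ (lift ord0 i)); rewrite liftK; apply.
  rewrite lincomb_recl unlift_none mulr0z add0r -[RHS]yc.
  by apply: eq_bigr => j _; rewrite liftK.
have rel g (c : int) : f g + y ord0 *~ c = 0 -> (m ord0 %| `|c|)%N /\ (y ord0 *~ c = 0 -> g = 0).
  move=> gc; split=> [|c0]; last by rewrite c0 addr0 in gc; apply: f_inj; rewrite raddf0.
  have [d dE] : generates (fun i => y (lift ord0 i)) (f g) by apply/f_gen; exists g.
  have := ydvd (fun i => if unlift ord0 i is Some j then d j else c).
  move=> /(_ _ ord0); rewrite unlift_none; apply.
  rewrite lincomb_recl unlift_none -[RHS]gc addrC dE; congr (_ + _).
  by apply: eq_bigr => j _; rewrite liftK.
have inj0 (H : zmodType) (h : {additive H -> A}) : (forall x, h x = 0 -> x = 0) -> injective h.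
  by move=> h0 a b ab; apply/eqP; rewrite -subr_eq0; apply/eqP/h0; rewrite raddfB ab subrr.
have gen a : generates y a <-> exists g c, f g + y ord0 *~ c = a.
  split=> [[c ->]|[g [c <-]]].
    have [g gE] : exists g, f g = lincomb (fun i => y (lift ord0 i)) (fun i => c (lift ord0 i)).
      by apply/f_gen; exists (fun i => c (lift ord0 i)).
    by exists g, (c ord0); rewrite gE lincomb_recl addrC.
  have [d dE] : generates (fun i => y (lift ord0 i)) (f g) by apply/f_gen; exists g.
  exists (fun i => if unlift ord0 i is Some j then d j else c).
  rewrite lincomb_recl unlift_none addrC dE; congr (_ + _).
  by apply: eq_bigr => j _; rewrite liftK.
case m0E: (m ord0) => [|n].
  pose h (u : (G * int)%type) := f u.1 + y ord0 *~ u.2.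
  have hB : zmod_morphism h.
    move=> u v; rewrite /h raddfB mulrzBr opprD addrACA -!addrA; congr (_ + _).
  pose ha : {additive (G * int)%type -> A} := HB.pack h (GRing.isZmodMorphism.Build _ _ h hB).
  exists (G * int)%type, ha; split; first exact: int_step.
    apply: inj0 => -[g c]; rewrite /= /h /= => /rel[]; rewrite m0E dvd0n absz_eq0 => /eqP -> g0.
    by rewrite g0 ?mulr0z.
  move=> a; rewrite gen; split=> [[g [c <-]]|[[g c] <-]]; first by exists (g, c).
  by exists g, c.
have yn : y ord0 *+ n.+1 = 0 by rewrite -m0E y0.
have y_mod c : y ord0 *+ (c %% n.+1) = y ord0 *+ c.
  by rewrite [in RHS](divn_eq c n.+1) mulrnDr mulnC mulrnA yn mul0rn add0r.
pose h (u : (G * 'I_n.+1)%type) := f u.1 + y ord0 *+ u.2.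
have hB : zmod_morphism h.
  move=> u v; rewrite /h raddfB opprD addrACA; congr (_ + _) => /=.
  rewrite y_mod mulrnDr y_mod mulrnBr ?(ltnW (ltn_ord _)) // yn sub0r //.
pose ha : {additive (G * 'I_n.+1)%type -> A} := HB.pack h (GRing.isZmodMorphism.Build _ _ h hB).
exists (G * 'I_n.+1)%type, ha; split.
- by case: (boolP (odd n.+1)) => n_odd; [apply: odd_step|apply: even_step].
- apply: inj0 => -[g c]; rewrite /= /h /= pmulrn => /rel[]; rewrite m0E /dvdn modn_small ?ltn_ord //.
  move=> /eqP c0 g0; have cE : c = 0 by apply: val_inj.
  by rewrite g0 cE // mulr0z.
move=> a; rewrite gen; split=> [[g [c <-]]|[[g c] <-]]; last by exists g, c%:Z; rewrite -pmulrn.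
exists (g, inord `|(c %% n.+1%:Z)%Z|%N); rewrite /= /h /=; congr (_ + _).
have c_ge0 : 0 <= (c %% n.+1%:Z)%Z by apply: modz_ge0.
rewrite inordK; last by rewrite -ltz_nat gez0_abs // ltz_pmod.
by rewrite pmulrn gez0_abs // mulrz_mod.
Qed.

Lemma fg_basis : finitely_generated A -> has_basis A.
Proof.
move=> [gens gensP].
have [y [m [[xy yx] y0 ydvd]]] := cyclic_decomposition (fun i : 'I_(size gens) => gens`_i).
have [G [f [basisG f_inj f_gen]]] := decomposition_basis y0 ydvd.
have f_surj a : exists g, f g = a.
  by apply/f_gen; apply: generates_trans xy _; have [c cE] := gensP a; exists c.
pose k a := projT1 (cid (f_surj a)).
have kK : cancel k f by move=> a; rewrite /k; case: cid.
have fK : cancel f k by move=> g; apply: f_inj; rewrite kK.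
have kB : zmod_morphism k by move=> a b; apply: f_inj; rewrite raddfB !kK.
pose ka : {additive A -> G} := HB.pack k (GRing.isZmodMorphism.Build _ _ k kB).
exact: (@iso_basis A G ka f).
Qed.

End CyclicDecomposition.

(** * Cohomology classes *)

Section Bridge.
Variable A : zmodType.
Implicit Types (f g : cochains A) (l : seq A).

(** The faces of [bar_face] on lists. The value [[::]] for index 1 on a singleton is what makes the
    largest index drop the last entry. *)
Fixpoint face (i : nat) l : seq A :=
  if l is x :: l' then
    match i with
    | 0 => l'
    | 1 => if l' is y :: l'' then (x + y : A) :: l'' else [::]
    | i'.+1 => x :: face i' l'
    end
  else [::].

Lemma size_face i l : (i <= size l)%N -> size (face i l) = (size l).-1.
Proof.
elim: l i => [|x l IHl] [|[|i]] //; first by case: l {IHl}.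
rewrite ltnS => il; rewrite (_ : size _ = (size (face i.+1 l)).+1) // IHl //=.
by case: l il {IHl}.
Qed.

Lemma nth_face i l j : (i <= size l)%N -> (j < (size l).-1)%N ->
  (face i l)`_j = if (j.+1 < i)%N then l`_j
    else if j.+1 == i then l`_j + l`_j.+1 else l`_j.+1.
Proof.
elim: l i j => [|x l IHl] [|[|i]] j //.
  by case: l {IHl} => // y l _; case: j.
rewrite ltnS => il jl; case: j jl => [|j] jl //.
rewrite (_ : _`_j.+1 = (face i.+1 l)`_j) // IHl //.
by move: jl => /=; case: (size l).
Qed.

Lemma dif_face f x l : dif f (x :: l) = \sum_(i < (size l).+2) f (face i (x :: l)).
Proof.
elim: l f x => [|y l IHl] f x.
  by rewrite dif1 big_ord_recl big_ord1 /= F2_addxx.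
rewrite dif_cons2 (IHl (f @@ x)) [RHS]big_ord_recl [X in _ = _ + X]big_ord_recl.
rewrite [X in _ + X = _]big_ord_recl.
have -> : \sum_(i < (size l).+1) f (face (lift ord0 (lift ord0 i)) [:: x, y & l]) =
  \sum_(i < (size l).+1) (f @@ x) (face (lift ord0 i) (y :: l)) by apply: eq_bigr.
have -> : f (face ord0 [:: x, y & l]) = f (y :: l) by [].
have -> : f (face (lift ord0 ord0) [:: x, y & l]) = f ((x + y : A) :: l) by [].
have -> : (f @@ x) (face ord0 (y :: l)) = f (x :: l) by [].
by char2 F2_addxx.
Qed.

Definition entries n (a : {ffun 'I_n -> A}) : seq A := [seq a i | i <- enum 'I_n].

Lemma size_entries n (a : {ffun 'I_n -> A}) : size (entries a) = n.
Proof. by rewrite size_map size_enum_ord. Qed.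

Lemma nth_entries n (a : {ffun 'I_n -> A}) (i : 'I_n) : (entries a)`_i = a i.
Proof. by rewrite (nth_map i) ?size_enum_ord // nth_ord_enum. Qed.

Lemma entries_face n (a : {ffun 'I_n.+1 -> A}) (i : 'I_n.+2) :
  entries (bar_face i a) = face i (entries a).
Proof.
have il : (i <= size (entries a))%N by rewrite size_entries -ltnS.
apply: (@eq_from_nth _ 0); first by rewrite size_face // !size_entries.
rewrite size_entries => j jn; rewrite (nth_face il) ?size_entries //.
rewrite -[j]/(nat_of_ord (Ordinal jn)) nth_entries ffunE /=.
have -> : (entries a)`_j = a (widen_ord (leqnSn n) (Ordinal jn)) by rewrite -nth_entries.
have -> : (entries a)`_j.+1 = a (lift ord0 (Ordinal jn)) by rewrite -nth_entries.
by [].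
Qed.

Definition to_cochain n f : cochain F2 A n := fun a => f (entries a).
Arguments to_cochain n f _ : clear implicits.

Definition of_cochain n (c : cochain F2 A n) : cochains A :=
  fun l => if size l == n then c [ffun i : 'I_n => l`_i] else 0.

Lemma of_cochainK n (c : cochain F2 A n) : to_cochain n (of_cochain c) = c.
Proof.
apply: funext => a; rewrite /to_cochain /of_cochain size_entries eqxx; congr c.
by apply/ffunP => i; rewrite ffunE nth_entries.
Qed.

Lemma homogeneous_of_cochain n (c : cochain F2 A n) : homogeneous n (of_cochain c).
Proof. by move=> l /negPf ln; rewrite /of_cochain ln. Qed.

Lemma to_cochain_inj n f g : to_cochain n f = to_cochain n g -> part n f = part n g.
Proof.
move=> fg; apply: (@homogeneous_eq _ n); try exact: homogeneous_part.
move=> l ln; rewrite /part ln eqxx.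
have lE : l = entries [ffun i : 'I_n => l`_i].
  apply: (@eq_from_nth _ 0); rewrite ?size_entries // ln => j jn.
  by rewrite -[j in RHS]/(nat_of_ord (Ordinal jn)) nth_entries ffunE.
by rewrite lE; apply: (congr1 (fun c : cochain F2 A n => c _) fg).
Qed.

Lemma to_cochain_part n f : to_cochain n (part n f) = to_cochain n f.
Proof. by apply: funext => a; rewrite /to_cochain /part size_entries eqxx. Qed.

Lemma coboundary_to_cochain n f : coboundary (to_cochain n f) = to_cochain n.+1 (dif f).
Proof.
apply: funext => a; rewrite /to_cochain.
case lE : (entries a) => [|x l]; first by have := size_entries a; rewrite lE.
have sl : size l = n by have := size_entries a; rewrite lE => -[].
rewrite dif_face sl; apply: eq_bigr => i _; rewrite -lE -entries_face.
have -> : (-1) ^+ i = 1 :> F2.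
  have -> : -1 = 1 :> F2 by apply: val_inj.
  by rewrite expr1n.
by rewrite mul1r.
Qed.

Lemma to_cochain_cocycle n f : dif f = 0 -> to_cochain n f \in @cocycles F2 A n.
Proof. by move=> df; rewrite unfold_in /= coboundary_to_cochain df. Qed.

(** A default value 0 makes this total, so that the class of an expression can be written without
    carrying a proof that it is closed. *)
Definition cocycle_of n f : submodule (@cocycles F2 A n) :=
  insubd (0 : submodule (@cocycles F2 A n)) (to_cochain n f).

Lemma val_cocycle_of n f : dif f = 0 -> val (cocycle_of n f) = to_cochain n f.
Proof. by move=> df; rewrite val_insubd to_cochain_cocycle. Qed.

(** [f] may be inhomogeneous; only its component of degree [n] is seen. *)
Definition coho_class n f : cohomology F2 n A :=
  quotient_pi (within (@cocycles F2 A n) (@coboundaries F2 A n)) (cocycle_of n f).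

Lemma coho_classD n f g : dif f = 0 -> dif g = 0 -> coho_class n (f + g) = coho_class n f + coho_class n g.
Proof.
move=> df dg; rewrite /coho_class -raddfD; congr quotient_pi; apply: val_inj.
by rewrite raddfD /= !val_cocycle_of // difD df dg addr0.
Qed.

Lemma coho_class_surj n (x : cohomology F2 n A) :
  exists f, [/\ homogeneous n f, dif f = 0 & x = coho_class n f].
Proof.
rewrite -(quotient_reprK x); set c := repr x.
have df : dif (of_cochain (val c)) = 0.
  apply: (@homogeneous_eq _ n.+1); [exact/homogeneous_dif/homogeneous_of_cochain|by []|].
  move=> l ln; have := valP c; rewrite unfold_in.
  rewrite -[val c]of_cochainK coboundary_to_cochain of_cochainK => /eqP.
  move=> /(@to_cochain_inj n.+1 _ 0) /(congr1 (fun f : cochains A => f l)).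
  by rewrite /part ln eqxx.
exists (of_cochain (val c)); split=> //; first exact: homogeneous_of_cochain.
by congr quotient_pi; apply: val_inj; rewrite val_cocycle_of // of_cochainK.
Qed.

Lemma coboundaries_exact n f :
  (to_cochain n f \in @coboundaries F2 A n) <-> exact_cochain (part n f).
Proof.
case: n => [|n].
  split=> [/eqP h|[g gE]].
    exists 0; rewrite dif0; have := @to_cochain_inj 0 f 0 h => ->.
    by apply: cochainsP => l; rewrite /part; case: ifP.
  by apply/eqP; rewrite -to_cochain_part -(part_homogeneous (@homogeneous_part _ 0 f)) gE part_dif0.
split=> [/asboolP[b bE]|[g gE]].
  exists (part n (of_cochain b)); rewrite -part_dif; apply: to_cochain_inj.
  by rewrite bE -coboundary_to_cochain of_cochainK.
apply/asboolP; exists (to_cochain n g); rewrite coboundary_to_cochain -[LHS]to_cochain_part gE.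
by [].
Qed.

Lemma coho_class_eq0 n f : dif f = 0 -> coho_class n f = 0 <-> exact_cochain (part n f).
Proof.
move=> df; rewrite -coboundaries_exact -(val_cocycle_of n df).
have -> : (val (cocycle_of n f) \in @coboundaries F2 A n) = (coho_class n f == 0).
  by rewrite -(raddf0 (quotient_pi _)) quotient_eq subr0.
by split=> /eqP.
Qed.

Lemma coho_class_exact n f : exact_cochain f -> coho_class n f = 0.
Proof.
move=> ef; apply/coho_class_eq0; first exact: exact_cocycle.
have := cohomologous_part n (g := 0) (f := f); rewrite /cohomologous addr0 => /(_ ef).
have -> : part n 0 = 0 :> cochains A by apply: cochainsP => l; rewrite /part; case: ifP.
by rewrite addr0.
Qed.

Lemma coho_class_cohomologous n f g : dif f = 0 -> cohomologous f g -> coho_class n f = coho_class n g.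
Proof.
move=> df fg; have dg := cohomologous_cocycle fg df.
have -> : g = f + (f + g) by char2 (@addcc A).
by rewrite coho_classD ?(coho_class_exact _ fg) ?addr0 // difD df dg addr0.
Qed.

Lemma coho_class_part n f : dif f = 0 -> coho_class n (part n f) = coho_class n f.
Proof.
move=> df; congr quotient_pi; apply: val_inj.
by rewrite !val_cocycle_of ?to_cochain_part // dif_part.
Qed.

Lemma coho_class_sum n (I : eqType) (r : seq I) (F : I -> cochains A) :
  {in r, forall i, dif (F i) = 0} -> coho_class n (\sum_(i <- r) F i) = \sum_(i <- r) coho_class n (F i).
Proof.
elim: r => [|i r IHr] F0; first by rewrite !big_nil coho_class_exact //; apply: exact_cochain0.
have Fr : {in r, forall i, dif (F i) = 0} by move=> j jr; apply: F0; rewrite in_cons jr orbT.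
rewrite !big_cons coho_classD ?IHr //; first by apply: F0; rewrite mem_head.
exact: dif_sum0.
Qed.

End Bridge.
Arguments to_cochain {A} n f _.

Lemma coho_class_map (A B : zmodType) (h : {additive A -> B}) n (f : cochains B) :
  dif f = 0 -> cohomology_map F2 h n (coho_class n f) = coho_class n (pull h f).
Proof.
move=> df; have dhf : dif (pull h f) = 0 by rewrite -pull_dif df.
rewrite /coho_class /cohomology_map /subquotient_map /= quotient_mapE.
congr quotient_pi; apply: val_inj; rewrite /= !val_cocycle_of //.
apply: funext => a; rewrite /cochain_map /to_cochain /pull; congr f.
rewrite [in RHS]/entries -map_comp /entries.
by under eq_map => i do rewrite ffunE.
Qed.

(** * Symmetric cocycles *)

Section SymmetricCocycles.
Variable A : zmodType.
Implicit Types e : cochains A.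

Lemma symmetric_cocycleD e e' :
  symmetric_cocycle e -> symmetric_cocycle e' -> symmetric_cocycle (e + e').
Proof.
move=> [he de eC] [he' de' eC']; split; first exact: homogeneousD.
  by rewrite difD de de' addr0.
by move=> a b; rewrite !addcE eC eC'.
Qed.

Lemma symmetric_cocycle0 : symmetric_cocycle (0 : cochains A).
Proof. by split=> //; apply: dif0. Qed.

Lemma symmetric_cocycle_sum (I : eqType) (r : seq I) (F : I -> cochains A) :
  {in r, forall i, symmetric_cocycle (F i)} -> symmetric_cocycle (\sum_(i <- r) F i).
Proof.
move=> hF; rewrite big_seq; apply: big_ind => //; first exact: symmetric_cocycle0.
exact: symmetric_cocycleD.
Qed.

Lemma diagonalD e e' a z : diagonal (e + e') a z = diagonal e a z + diagonal e' a z.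
Proof. by rewrite /diagonal !addcE; char2 F2_addxx. Qed.

Lemma diagonal_sum I (r : seq I) (F : I -> cochains A) a z :
  diagonal (\sum_(i <- r) F i) a z = \sum_(i <- r) diagonal (F i) a z.
Proof.
apply: (big_morph (fun e => diagonal e a z)) => [e e'|]; first exact: diagonalD.
by rewrite /diagonal; apply: F2_addxx.
Qed.

Lemma symmetric_cocycleE e a b c : symmetric_cocycle e ->
  e [:: b; c] + e [:: a + b; c] + e [:: a; b + c] + e [:: a; b] = 0.
Proof.
move=> [_ de _]; have : dif e [:: a; b; c] = 0 by rewrite de.
by rewrite !dif_cons2 dif1 /after => <-; char2 F2_addxx.
Qed.

Lemma symmetric_cocycle_0l e a : symmetric_cocycle e -> e [:: 0; a] = e [:: 0; 0].
Proof.
move=> se; apply: (addVV_eq F2_addxx); rewrite -(symmetric_cocycleE 0 0 a se).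
by rewrite !add0r; char2 F2_addxx.
Qed.

(** The extension defined by [e] is commutative, so doubling of lifts is additive. In terms of
    cochains, the cocycle identities at [(a, b, a + b)] and [(b, b, a)] are added. *)
Lemma diagonal_torsion_form e : symmetric_cocycle e -> torsion_form (fun a => diagonal e a 0).
Proof.
move=> se a b a2 b2; have [_ _ eC] := se.
have baE : b + (a + b) = a by rewrite addrCA -mulr2n b2 addr0.
have h1 := symmetric_cocycleE a b (a + b) se; rewrite baE in h1.
have h2 := symmetric_cocycleE b b a se.
rewrite -mulr2n b2 (symmetric_cocycle_0l a se) (eC b a) in h2.
rewrite /diagonal; apply: (addVV_eq F2_addxx).
rewrite [b + a]addrC in h2.
apply: etrans (etrans (congr2 +%R h1 h2) (addr0 0)); char2 F2_addxx.
Qed.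

Lemma diagonal_exact e a : exact_cochain e -> a *+ 2 = 0 -> diagonal e a 0 = 0.
Proof.
move=> [g ->] a2; rewrite /diagonal !dif_cons2 !dif1.
have -> : a + a = 0 by rewrite -mulr2n.
rewrite (addr0 (0 : A)); by char2 F2_addxx.
Qed.

(** For a 2-cocycle this is the commutator in the central extension. It vanishes on coboundaries and
    on symmetric cocycles, so it isolates products of two distinct characters. *)
Definition antisym e (a b : A) : F2 := e [:: a; b] + e [:: b; a].

Lemma antisymD e e' a b : antisym (e + e') a b = antisym e a b + antisym e' a b.
Proof. by rewrite /antisym !addcE; char2 F2_addxx. Qed.

Lemma antisym_sum I (r : seq I) (F : I -> cochains A) a b :
  antisym (\sum_(i <- r) F i) a b = \sum_(i <- r) antisym (F i) a b.
Proof.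
apply: (big_morph (fun e => antisym e a b)) => [e e'|]; first exact: antisymD.
by rewrite /antisym; apply: F2_addxx.
Qed.

Lemma antisym_exact e a b : exact_cochain e -> antisym e a b = 0.
Proof.
by move=> [g ->]; rewrite /antisym !dif_cons2 !dif1 (addrC b a); char2 F2_addxx.
Qed.

(** Cochains commute only up to coboundary, so factors are reordered one at a time: the head of [u]
    is moved past the factors preceding it in [v]. *)
Lemma cohomologous_perm (I : eqType) (u v : seq I) (F : I -> cochains A) :
  perm_eq u v -> {in u, forall i, dif (F i) = 0} ->
  {in u &, forall i j, cohomologous (F i * F j) (F j * F i)} ->
  cohomologous (\prod_(i <- u) F i) (\prod_(i <- v) F i).
Proof.
elim: u v => [|x u IHu] v uv dF FC.
  by move: uv; rewrite perm_sym => /perm_nilP ->; apply: cohomologous_refl.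
have xv : x \in v by rewrite -(perm_mem uv) mem_head.
case/splitPr: xv uv => v1 v2 uv.
have uv' : perm_eq u (v1 ++ v2) by rewrite -(perm_cons x) (permPl uv) -(cat1s x v2) perm_catCA.
have du : {in u, forall i, dif (F i) = 0} by move=> i iu; apply: dF; rewrite in_cons iu orbT.
have dx : dif (F x) = 0 by apply: dF; rewrite mem_head.
have uC : {in u &, forall i j, cohomologous (F i * F j) (F j * F i)}.
  by move=> i j iu ju; apply: FC; rewrite in_cons ?iu ?ju orbT.
rewrite big_cons; apply: (@cohomologous_trans _ (F x * \prod_(i <- v1 ++ v2) F i)).
  apply: cohomologousM => //; [|exact: cohomologous_refl|exact: IHu].
  by apply: dif_prod => i; rewrite -(perm_mem uv'); apply: du.
rewrite !big_cat big_cons /= !mulrA.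
have v1u i : i \in v1 -> i \in u by move=> iv; rewrite (perm_mem uv') mem_cat iv.
have v2u i : i \in v2 -> i \in u by move=> iv; rewrite (perm_mem uv') mem_cat iv orbT.
have xC i : i \in u -> cohomologous (F x * F i) (F i * F x).
  by move=> iu; apply: FC; rewrite ?mem_head // in_cons iu orbT.
apply: cohomologousM; last exact: cohomologous_refl.
- by apply: cocycleM => //; apply: dif_prod => i /v1u/du.
- by apply: dif_prod => i /v2u/du.
elim: v1 v1u {uv uv'} => [|i v1 IHv] v1u.
  by rewrite !big_nil mulr1 mul1r; apply: cohomologous_refl.
have iu : i \in u by apply: v1u; rewrite mem_head.
have v1u' j : j \in v1 -> j \in u by move=> jv; apply: v1u; rewrite in_cons jv orbT.
have dv1 : dif (\prod_(j <- v1) F j) = 0 by apply: dif_prod => j /v1u'/du.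
rewrite big_cons mulrA; apply: (@cohomologous_trans _ (F i * F x * \prod_(j <- v1) F j)).
  apply: cohomologousM => //; [|exact: xC|exact: cohomologous_refl].
  by apply: cocycleM => //; apply: du.
rewrite -!mulrA; apply: cohomologousM; [exact: du| |exact: cohomologous_refl|exact: IHv].
exact: cocycleM.
Qed.

End SymmetricCocycles.

(** * Symmetric cocycles and their products in terms of a basis *)

Section BasisConsequences.
Variables (A : zmodType) (r s : nat) (l : nat -> A -> F2) (e : nat -> cochains A).
Variables (t b : nat -> A).
Hypothesis basis : cohomology_basis r s l e t b.
Implicit Types (f g z : cochains A) (chi psi : A -> F2).

Let lD := cb_additive basis.
Let esym := cb_symmetric basis.

Lemma standard2 m : standard r s 2 m ->
  (exists2 k, (k < s)%N & m = ([:: k], [::])) \/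
  (exists i j, [/\ (j < i)%N, (i < r)%N & m = ([::], [:: i; j])]).
Proof.
case: m => -[|k [|k' al]] [|i [|j [|h S]]] /and5P[/= h1 h2 h3 h4 h5] //.
- by right; exists i, j; case/andP: h3 => ij _; case/andP: h4.
by left; exists k => //; case/andP: h2.
Qed.

(** Expand [f] in the basis. Antisymmetrising at [(t i, t j)] reads off the coefficient of the
    product of characters i and j, which is 0 by symmetry. Then the diagonal at [b k] reads off the
    coefficient of [e k]. The order matters, as products of characters may have a nonzero
    diagonal. *)
Lemma symmetric_exact f : symmetric_cocycle f ->
  (forall a, a *+ 2 = 0 -> diagonal f a 0 = 0) -> exact_cochain f.
Proof.
move=> sf f0; have [hf df fC] := sf.
have [ms0 std_ms0 ms0E] := cb_span basis hf df.
set ms := odd_part ms0.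
have std_ms : {in ms, forall m, standard r s 2 m}.
  by move=> m /odd_part_sub; apply: allP.
have {ms0E} fE : cohomologous f (\sum_(m <- ms) mono e l m).
  by rewrite (sum_odd_part (@addcc A)).
have uniq_ms : uniq ms by apply: odd_part_uniq.
have no_l i j : ([::], [:: i; j]) \notin ms.
  apply/negP => ijms; have := std_ms _ ijms; move=> /and5P[_ _ /= /andP[ji _] /andP[ir /andP[jr _]] _].
  have := antisym_exact (t i) (t j) fE; rewrite antisymD antisym_sum.
  rewrite [antisym f _ _](_ : _ = 0) ?add0r; last by rewrite /antisym fC F2_addxx.
  rewrite (bigD1_seq _ ijms) //= big_seq_cond big1 ?addr0 => [|m /andP[/std_ms]].
    rewrite /antisym /mono big_nil mul1r !big_cons big_nil mulr1 !of1M /=.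
    by rewrite !(cb_dual basis) // !eqxx (gtn_eqF ji) mul0r addr0 mulr1.
  move=> /standard2[[k ks ->]|[i' [j' [j'i' i'r ->]]]] neq.
    rewrite /antisym /mono big_nil mulr1 big_seq1.
    by have [_ _ ->] := esym ks; rewrite F2_addxx.
  have j'r := ltn_trans j'i' i'r.
  rewrite /antisym /mono big_nil mul1r !big_cons big_nil mulr1 !of1M /= !(cb_dual basis) //.
  case: (eqVneq i' i) neq => [->|ii'] neq.
    case: (eqVneq j' j) neq => [->|jj'] neq; first by rewrite eqxx in neq.
    by rewrite mulr0 (gtn_eqF ji) mul0r addr0.
  rewrite mul0r add0r; case: (eqVneq i' j) => [i'j|]; last by rewrite mul0r.
  case: (eqVneq j' i) => [j'i|]; last by rewrite mulr0.
  by move: j'i'; rewrite i'j j'i => /ltnW; rewrite leqNgt ji.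
suff ms_nil : ms = [::] by move: fE; rewrite ms_nil big_nil /cohomologous addr0.
have no_e k : ([:: k], [::]) \notin ms.
  apply/negP => kms; have := std_ms _ kms; move=> /and5P[_ /= /andP[ks _] _ _ _].
  have b2 := cb_torsion basis ks.
  have := diagonal_exact fE b2; rewrite diagonalD f0 // add0r diagonal_sum.
  rewrite (bigD1_seq _ kms) //= big_seq_cond big1 ?addr0 => [|m /andP[mms neq]].
    by rewrite /mono big_nil mulr1 big_seq1 (cb_diagonal basis) // eqxx.
  case: (standard2 (std_ms m mms)) => [[k' k's mE]|[i [j [_ _ mE]]]]; last first.
    by have := no_l i j; rewrite -mE mms.
  rewrite mE /mono big_nil mulr1 big_seq1 (cb_diagonal basis) //.
  by case: eqP => // k'k; rewrite mE k'k eqxx in neq.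
case msE: ms => [//|m ms']; have mms : m \in ms by rewrite msE mem_head.
case: (standard2 (std_ms m mms)) => [[k _ mE]|[i [j [_ _ mE]]]].
  by have := no_e k; rewrite -mE mms.
by have := no_l i j; rewrite -mE mms.
Qed.

Lemma symmetric_cohomologous f g : symmetric_cocycle f -> symmetric_cocycle g ->
  (forall a, a *+ 2 = 0 -> diagonal f a 0 = diagonal g a 0) -> cohomologous f g.
Proof.
move=> sf sg fg; apply: symmetric_exact; first exact: symmetric_cocycleD.
by move=> a a2; rewrite diagonalD fg // F2_addxx.
Qed.

Lemma torsion_form_realized psi : torsion_form psi -> exists ks,
  [/\ uniq ks, all (fun k => k < s)%N ks &
      forall a, a *+ 2 = 0 -> psi a = diagonal (\sum_(k <- ks) e k) a 0].
Proof.
move=> psiT; exists [seq k <- iota 0 s | psi (b k) == 1]; split.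
- by rewrite filter_uniq ?iota_uniq.
- by apply/allP => k; rewrite mem_filter mem_iota add0n => /andP[_ /andP[]].
move=> a a2; rewrite (cb_torsion_form basis psiT a2) diagonal_sum big_filter.
rewrite -(big_mkord xpredT (fun k => psi (b k) * diagonal (e k) a 0)) /index_iota subn0.
rewrite [RHS]big_mkcond; apply: eq_bigr => k _.
by case: (F2_cases (psi (b k))) => ->; rewrite ?mul0r ?mul1r // eqxx.
Qed.

Lemma symmetric_sum f : symmetric_cocycle f -> exists2 ks,
  all (fun k => k < s)%N ks & cohomologous f (\sum_(k <- ks) e k).
Proof.
move=> sf; have [ks [_ ks_s ksE]] := torsion_form_realized (diagonal_torsion_form sf).
exists ks => //; apply: symmetric_cohomologous => //.
by apply: symmetric_cocycle_sum => k /(allP ks_s) /esym.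
Qed.

(** Coboundaries vanish in degree 1, so spanning up to coboundary is an equality of cochains. *)
Lemma form_sum chi : additive_form chi -> exists2 js,
  all (fun j => j < r)%N js & of1 chi = \sum_(j <- js) of1 (l j).
Proof.
move=> chiD.
have [ms std_ms [g gE]] := cb_span basis (@homogeneous_of1 _ chi) (dif_additive chiD).
have std1 m : standard r s 1 m -> exists2 j, (j < r)%N & m = ([::], [:: j]).
  case: m => -[|k [|k' al]] [|i [|j S]] /and5P[/= h1 h2 h3 h4 h5] //.
  by exists i => //; case/andP: h4.
exists [seq head 0%N m.2 | m <- ms].
  rewrite all_map; apply/allP => m /(allP std_ms)/std1[j jr ->] //=.
apply: (addVV_eq (@addcc A)); rewrite big_map.
rewrite [X in _ + X = _](_ : _ = \sum_(m <- ms) mono e l m).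
  apply: (@homogeneous_eq _ 1) => //; last by case=> [|a []] // _; rewrite gE dif1.
  apply: homogeneousD; first exact: homogeneous_of1.
  apply: homogeneous_sum => m mms.
  exact: (homogeneous_mono l esym (allP std_ms m mms)).
apply: eq_big_seq => m /(allP std_ms)/std1[j jr ->].
by rewrite /mono big_nil big_seq1 mul1r.
Qed.

Lemma mono_sort alpha S k : (k < s)%N -> all (fun i => i < s)%N alpha ->
  all (fun j => j < r)%N S ->
  cohomologous (e k * mono e l (alpha, S)) (mono e l (sort geq (k :: alpha), S)).
Proof.
move=> ks als Sr; rewrite -mono_consl /mono.
have ka : all (fun i => i < s)%N (k :: alpha) by rewrite /= ks.
apply: cohomologousM; [exact: (dif_prod_e esym)|exact: (dif_prod_l lD)| |exact: cohomologous_refl].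
apply: cohomologous_perm; first by rewrite perm_sym perm_sort.
  by move=> i /(allP ka)/esym[].
by move=> i j /(allP ka)/esym si /(allP ka)/esym sj; apply: symmetric_cocycle_commute.
Qed.

Lemma standard_sort n k alpha S : (k < s)%N -> standard r s n (alpha, S) ->
  standard r s n.+2 (sort geq (k :: alpha), S).
Proof.
move=> ks /and5P[/= h1 h2 h3 h4 h5]; apply/and5P; split=> //=.
- by apply: sort_sorted => x y; apply: leq_total.
- by rewrite all_sort /= ks.
by rewrite size_sort /= doubleS !addSn.
Qed.

Lemma symmetric_mul_mono n k f ms : symmetric_cocycle f ->
  all (fun m => standard r s n m && (k <= size m.1)%N) ms -> exists2 ms',
  all (fun m => standard r s n.+2 m && (k < size m.1)%N) ms' &
  cohomologous (f * \sum_(m <- ms) mono e l m) (\sum_(m <- ms') mono e l m).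
Proof.
move=> sf /allP std_ms; have [ks ks_s fE] := symmetric_sum sf.
exists [seq (sort geq (i :: m.1), m.2) | i <- ks, m <- ms].
  apply/allP => _ /allpairsP[[i m] [/= iks mms ->]] /=.
  have /andP[std_m km] := std_ms m mms.
  rewrite size_sort /= ltnS km andbT; apply: standard_sort; last by case: (m) std_m.
  exact: (allP ks_s).
have dms : dif (\sum_(m <- ms) mono e l m) = 0.
  by apply: dif_sum0 => m /std_ms /andP[+ _]; apply: (dif_mono lD esym).
have [_ df _] := sf.
apply: (@cohomologous_trans _ ((\sum_(k <- ks) e k) * \sum_(m <- ms) mono e l m)).
  by apply: cohomologousM => //; apply: cohomologous_refl.
rewrite big_allpairs_dep mulr_suml big_seq [X in cohomologous _ X]big_seq.
apply: (big_ind2 (@cohomologous A)); [exact: cohomologous_refl|by move=> *; apply: cohomologousD|].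
move=> i iks; rewrite mulr_sumr big_seq [X in cohomologous _ X]big_seq.
apply: (big_ind2 (@cohomologous A)); [exact: cohomologous_refl|by move=> *; apply: cohomologousD|].
move=> [alpha S] /std_ms /andP[/and5P[/= h1 h2 h3 h4 h5] _].
by apply: mono_sort => //; apply: (allP ks_s).
Qed.

(** Each symmetric cocycle is a sum of the [e k] up to coboundary, so each factor inserts one more
    even index. Thus step [i] of the filtration involves only monomials with at least [i] even
    classes. *)
Lemma symmetric_prod_span n (es : seq (cochains A)) z :
  (forall f, f \in es -> symmetric_cocycle f) -> homogeneous n z -> dif z = 0 ->
  exists2 ms, all (fun m => standard r s ((size es).*2 + n) m && (size es <= size m.1)%N) ms &
  cohomologous ((\prod_(f <- es) f) * z) (\sum_(m <- ms) mono e l m).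
Proof.
move=> + hz dz; elim: es => [|f es IHes] ses.
  have [ms std_ms msE] := cb_span basis hz dz.
  by exists ms; [apply: sub_all std_ms => m /= ->|rewrite big_nil mul1r].
have sf : symmetric_cocycle f by apply: ses; rewrite mem_head.
have [|ms std_ms msE] := IHes; first by move=> g ges; apply: ses; rewrite in_cons ges orbT.
have [ms' std_ms' ms'E] := symmetric_mul_mono sf std_ms.
exists ms' => //; rewrite big_cons -mulrA; apply: cohomologous_trans ms'E.
have [_ df _] := sf.
apply: cohomologousM => //; last exact: cohomologous_refl.
by apply: dif_sum0 => m /(allP std_ms) /andP[+ _]; apply: (dif_mono lD esym).
Qed.

End BasisConsequences.

(** * Tensor, exterior and symmetric powers *)

Section Lifting.
Variable R : comNzRingType.

Section Quotient.
Variables (V U : lmodType R) (M : submodClosed V) (f : {linear V -> U}).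
Hypothesis fM : {in M, forall x, f x = 0}.

Definition quotient_lift (x : quotient M) : U := f (repr x).

Lemma quotient_liftE x : quotient_lift (quotient_pi M x) = f x.
Proof.
apply/eqP; rewrite -subr_eq0 -raddfB; apply/eqP/fM.
by rewrite -quotient_eq quotient_reprK.
Qed.

Lemma quotient_lift_is_linear : linear quotient_lift.
Proof.
move=> a x y; rewrite -[x]quotient_reprK -[y]quotient_reprK.
by rewrite -linearP !quotient_liftE linearP.
Qed.

Lemma quotient_lift_exists :
  exists g : {linear quotient M -> U}, forall x, g (quotient_pi M x) = f x.
Proof.
pose g : {linear quotient M -> U} := HB.pack quotient_lift
  (GRing.isLinear.Build R _ _ _ quotient_lift quotient_lift_is_linear).
by exists g => x; apply: quotient_liftE.
Qed.

End Quotient.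

Lemma span_kernel (V U : lmodType R) (S : V -> Prop) (f : {linear V -> U}) :
  (forall x, S x -> f x = 0) -> {in span S, forall x, f x = 0}.
Proof.
move=> fS; pose P : {pred V} := fun x => f x == 0.
have P_closed : submod_closed P.
  split=> [|a x y /eqP fx /eqP fy]; rewrite unfold_in; first by rewrite raddf0.
  by rewrite linearP fx fy scaler0 addr0.
pose Q : submodClosed V := HB.pack P (GRing.isSubmodClosed.Build R V P P_closed).
by move=> x /(@span_min _ _ _ Q) h; apply/eqP/h => y /fS /eqP.
Qed.

Section Free.
Variables (X : choiceType) (U : lmodType R) (F : X -> U).

Definition free_lift (g : {malg R[X]}) : U := \sum_(x <- msupp g) g@_x *: F x.

Lemma free_liftEw (g : {malg R[X]}) (D : {fset X}) : (msupp g `<=` D)%fset ->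
  free_lift g = \sum_(x <- D) g@_x *: F x.
Proof.
by move=> gD; apply: big_fset_incl => // x _ /mcoeff_outdom ->; apply: scale0r.
Qed.

Lemma free_lift_is_linear : linear free_lift.
Proof.
move=> a g1 g2; pose D := (msupp g1 `|` msupp g2)%fset.
have D1 : (msupp g1 `<=` D)%fset by apply: fsubsetUl.
have D2 : (msupp g2 `<=` D)%fset by apply: fsubsetUr.
have D3 : (msupp (a *: g1 + g2) `<=` D)%fset.
  apply: fsubset_trans (msuppD_le _ _) _; rewrite fsubUset D2 andbT.
  exact: fsubset_trans (msuppZ_le _ _) D1.
rewrite (free_liftEw D1) (free_liftEw D2) (free_liftEw D3) scaler_sumr -big_split.
by apply: eq_bigr => x _ /=; rewrite mcoeffD mcoeffZ scalerDl scalerA.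
Qed.

Lemma free_lift_exists : exists f : {linear {malg R[X]} -> U}, forall x, f << x >> = F x.
Proof.
pose f : {linear {malg R[X]} -> U} := HB.pack free_lift
  (GRing.isLinear.Build R _ _ _ free_lift free_lift_is_linear).
exists f => x; rewrite /= (free_liftEw msuppU_le) big_seq_fset1 mcoeffUU.
exact: scale1r.
Qed.

Lemma presented_lift_exists (S : {malg R[X]} -> Prop) :
  (forall f : {linear {malg R[X]} -> U}, (forall x, f << x >> = F x) ->
     forall y, S y -> f y = 0) ->
  exists g : {linear quotient (span S) -> U}, forall x, g (quotient_pi (span S) << x >>) = F x.
Proof.
move=> FS; have [f fE] := free_lift_exists.
have [g gE] := quotient_lift_exists (span_kernel (FS f fE)).
by exists g => x; rewrite gE.
Qed.

End Free.

Lemma presented_ind (X : choiceType) (M : submodClosed {malg R[X]}) (K : quotient M -> Prop) :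
  K 0 -> (forall a x y, K x -> K y -> K (a *: x + y)) ->
  (forall x, K (quotient_pi M << x >>)) -> forall y, K y.
Proof.
move=> K0 KD KX y; rewrite -[y]quotient_reprK; set g := repr y.
rewrite [g]monalgE; elim: (msupp g : seq X) => [|x r IHr].
  by rewrite big_nil raddf0.
rewrite big_cons; have -> : << g@_x *g x >> = g@_x *: << x >> :> {malg R[X]}.
  by apply/malgP => z; rewrite mcoeffZ !mcoeffU mulrnAr mulr1.
by rewrite linearP; apply: KD; [apply: KX|apply: IHr].
Qed.

End Lifting.

Section LiftingF2.
Implicit Types U V W : lmodType F2.

Lemma F2_linear V W (f : V -> W) : (forall x y, f (x + y) = f x + f y) -> linear f.
Proof.
move=> fD a x y; have f0 : f 0 = 0 by apply: (@addrI _ (f 0)); rewrite -fD !addr0.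
by case: (F2_cases a) => ->; rewrite ?scale0r ?scale1r ?add0r.
Qed.

Lemma lmodF2_addxx V (x : V) : x + x = 0.
Proof. by rewrite -[x]scale1r -scalerDl F2_addxx scale0r. Qed.

Lemma F2_presented_ind (X : choiceType) (M : submodClosed {malg F2[X]}) (K : quotient M -> Prop) :
  K 0 -> (forall x y, K x -> K y -> K (x + y)) ->
  (forall x, K (quotient_pi M << x >>)) -> forall y, K y.
Proof.
move=> K0 KD; apply: presented_ind => // a x y Kx Ky.
by case: (F2_cases a) => ->; rewrite ?scale0r ?add0r ?scale1r //; apply: KD.
Qed.

Variant additive_in_entries k V U (G : {ffun 'I_k -> V} -> U) : Prop :=
  AdditiveInEntries of forall v i x y,
    G (with_entry v i (x + y)) = G (with_entry v i x) + G (with_entry v i y).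

Lemma multilinear_rel_kernel k V U (G : {ffun 'I_k -> V} -> U)
    (f : {linear {malg F2[{ffun 'I_k -> V}]} -> U}) :
  additive_in_entries G -> (forall v, f << v >> = G v) ->
  forall i a v x y, f (multilinear_rel i a v x y) = 0.
Proof.
move=> [GD] fE i a v x y; rewrite /multilinear_rel !raddfB /= linearZ /= !fE.
case: (F2_cases a) => ->; first by rewrite !scale0r add0r subr0 subrr.
by rewrite !scale1r GD -addrA -opprD subrr.
Qed.

Definition ext_gen k V (v : {ffun 'I_k -> V}) : exterior k V :=
  quotient_pi (span (@exterior_rel F2 k V)) << v >>.

Definition sym_gen k V (v : {ffun 'I_k -> V}) : symmetric k V :=
  quotient_pi (span (@symmetric_rel F2 k V)) << v >>.

Definition ten_gen V W (x : V) (y : W) : tensor V W :=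
  quotient_pi (span (@bilinear_rel F2 V W)) << (x, y) >>.

Lemma exterior_lift_exists k V U (G : {ffun 'I_k -> V} -> U) :
  additive_in_entries G -> (forall (v : {ffun 'I_k -> V}) (i j : 'I_k), i != j -> v i = v j -> G v = 0) ->
  exists g : {linear exterior k V -> U}, forall v, g (ext_gen v) = G v.
Proof.
move=> GD Galt; apply: presented_lift_exists => f fE _ [i a v x y|v i j ij vij].
  exact: multilinear_rel_kernel GD fE _ _ _ _ _.
by rewrite fE (Galt v i j).
Qed.

Lemma symmetric_lift_exists k V U (G : {ffun 'I_k -> V} -> U) :
  additive_in_entries G -> (forall (v : {ffun 'I_k -> V}) (s : 'S_k), G [ffun j => v (s j)] = G v) ->
  exists g : {linear symmetric k V -> U}, forall v, g (sym_gen v) = G v.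
Proof.
move=> GD Gsym; apply: presented_lift_exists => f fE _ [i a v x y|v s].
  exact: multilinear_rel_kernel GD fE _ _ _ _ _.
by rewrite raddfB /= !fE Gsym subrr.
Qed.

Lemma tensor_lift_exists V W U (F : V -> W -> U) :
  (forall v v' w, F (v + v') w = F v w + F v' w) ->
  (forall v w w', F v (w + w') = F v w + F v w') ->
  exists g : {linear tensor V W -> U}, forall v w, g (ten_gen v w) = F v w.
Proof.
move=> FDl FDr; have [|g gE] := @presented_lift_exists F2 _ U (fun u => F u.1 u.2)
    (@bilinear_rel F2 V W); last by exists g => v w; rewrite gE.
move=> f fE _ [a v v' w|a v w w']; rewrite !raddfB /= linearZ /= !fE /=.
  by rewrite (F2_linear (fun x y => FDl x y w)) -addrA -opprD subrr.
by rewrite (F2_linear (FDr v)) -addrA -opprD subrr.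
Qed.

Lemma quotient_pi_rel (R : comNzRingType) (V : lmodType R) (S : V -> Prop) x :
  S x -> quotient_pi (span S) x = 0.
Proof.
by move=> Sx; apply/eqP; rewrite -(raddf0 (quotient_pi (span S))) quotient_eq subr0 mem_span.
Qed.

Lemma ext_gen_additive k V : additive_in_entries (@ext_gen k V).
Proof.
split=> v i x y; apply/eqP; rewrite -subr_eq0 opprD addrA /ext_gen -!raddfB.
have := quotient_pi_rel (ExteriorMultilinear i 1 v x y).
by rewrite /multilinear_rel !scale1r => h; apply/eqP/h.
Qed.

Lemma ext_gen_alternating k V (v : {ffun 'I_k -> V}) i j :
  i != j -> v i = v j -> ext_gen v = 0.
Proof. by move=> ij vij; apply/quotient_pi_rel/(ExteriorAlternating ij vij). Qed.

Lemma sym_gen_additive k V : additive_in_entries (@sym_gen k V).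
Proof.
split=> v i x y; apply/eqP; rewrite -subr_eq0 opprD addrA /sym_gen -!raddfB.
have := quotient_pi_rel (SymmetricMultilinear i 1 v x y).
by rewrite /multilinear_rel !scale1r => h; apply/eqP/h.
Qed.

Lemma sym_gen_perm k V (v : {ffun 'I_k -> V}) (s : 'S_k) :
  sym_gen [ffun j => v (s j)] = sym_gen v.
Proof.
apply/esym/eqP; rewrite -subr_eq0 /sym_gen -raddfB.
exact/eqP/(quotient_pi_rel (SymmetricPerm v s)).
Qed.

Lemma with_entry_id k (T : Type) (v : {ffun 'I_k -> T}) i : with_entry v i (v i) = v.
Proof. by apply/ffunP => j; rewrite ffunE; case: eqP => [->|]. Qed.

(** Polarisation: expanding the vanishing generator with [v i + v j] at both places gives
    antisymmetry, which over F2 is symmetry. *)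
Lemma ext_gen_tperm k V (v : {ffun 'I_k -> V}) i j :
  ext_gen [ffun h => v (tperm i j h)] = ext_gen v.
Proof.
have [<-|ij] := eqVneq i j.
  by congr ext_gen; apply/ffunP => h; rewrite ffunE tperm1 perm1.
have [GD] := @ext_gen_additive k V.
pose w x y := with_entry (with_entry v i x) j y.
have wC x y : w x y = with_entry (with_entry v j y) i x.
  apply/ffunP => h; rewrite !ffunE; case: eqP => // ->.
  by rewrite eq_sym (negPf ij).
have w0 x : ext_gen (w x x) = 0.
  by apply: (@ext_gen_alternating _ _ _ i j) => //; rewrite !ffunE eqxx (negPf ij) eqxx.
have wE : ext_gen (w (v i + v j) (v i + v j)) =
    ext_gen (w (v i) (v i)) + ext_gen (w (v j) (v i)) + (ext_gen (w (v i) (v j)) + ext_gen (w (v j) (v j))).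
  by rewrite {1}/w GD -!/(w _ _) !wC !GD.
rewrite !w0 addr0 add0r in wE.
have -> : [ffun h => v (tperm i j h)] = w (v j) (v i).
  apply/ffunP => h; rewrite !ffunE; case: tpermP => [->|->|/eqP/negPf hi /eqP/negPf hj].
  - by rewrite (negPf ij) eqxx.
  - by rewrite eqxx.
  by rewrite hi hj.
have vE : w (v i) (v j) = v by rewrite /w with_entry_id with_entry_id.
by rewrite -[X in _ = ext_gen X]vE; apply: (addVV_eq (@lmodF2_addxx _)); rewrite -wE.
Qed.

Lemma ext_gen_perm k V (v : {ffun 'I_k -> V}) (s : 'S_k) :
  ext_gen [ffun j => v (s j)] = ext_gen v.
Proof.
have [ts -> _] := prod_tpermP s; elim/last_ind: ts v => [|ts [i j] IHts] v.
  by congr ext_gen; apply/ffunP => h; rewrite ffunE big_nil perm1.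
rewrite -cats1 big_cat big_seq1 /= -[RHS](ext_gen_tperm v i j) -[RHS]IHts; congr ext_gen.
by apply/ffunP => h; rewrite !ffunE permM.
Qed.

Lemma ten_genDl V W (x x' : V) (y : W) : ten_gen (x + x') y = ten_gen x y + ten_gen x' y.
Proof.
apply/eqP; rewrite -subr_eq0 opprD addrA /ten_gen -!raddfB.
by have := quotient_pi_rel (BilinearL 1 x x' y); rewrite !scale1r => h; apply/eqP/h.
Qed.

Lemma ten_genDr V W (x : V) (y y' : W) : ten_gen x (y + y') = ten_gen x y + ten_gen x y'.
Proof.
apply/eqP; rewrite -subr_eq0 opprD addrA /ten_gen -!raddfB.
by have := quotient_pi_rel (BilinearR 1 x y y'); rewrite !scale1r => h; apply/eqP/h.
Qed.

End LiftingF2.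

Section PowerSpans.
Variables (k r : nat) (V : lmodType F2) (lam : nat -> V).
Hypothesis lam_span : forall x : V, exists2 js, all (fun j => j < r)%N js &
  x = \sum_(j <- js) lam j.

Lemma additive_span (U : lmodType F2) (G : {ffun 'I_k -> V} -> U) (K : U -> Prop) :
  additive_in_entries G -> K 0 -> (forall x y, K x -> K y -> K (x + y)) ->
  (forall J : 'I_k -> nat, (forall b, J b < r)%N -> K (G [ffun b => lam (J b)])) ->
  forall v, K (G v).
Proof.
move=> [GD] K0 KD KJ v.
(* The entries from position [m] on are already spanning vectors, and the earlier ones are expanded
   one by one; the goal is the case [m = k]. *)
have claim m : forall u : {ffun 'I_k -> V},
    (forall b : 'I_k, (m <= b)%N -> exists2 j, (j < r)%N & u b = lam j) -> K (G u).
  elim: m => [|m IHm] u uE.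
    have /fin_all_exists2[J Jr JE] : forall b : 'I_k, exists2 j, (j < r)%N & u b = lam j.
      by move=> b; apply: uE.
    have -> : u = [ffun b => lam (J b)] by apply/ffunP => b; rewrite ffunE JE.
    exact: KJ.
  have [mk|km] := ltnP m k; last first.
    by apply: IHm => b mb; have := leq_ltn_trans mb (ltn_ord b); rewrite ltnNge km.
  pose p := Ordinal mk; rewrite -(with_entry_id u p).
  have [js js_r ->] := lam_span (u p).
  elim: js js_r => [_|j js IHjs /= /andP[jr jsr]].
    rewrite big_nil; have -> : G (with_entry u p 0) = 0; last exact: K0.
    by apply: (@addrI _ (G (with_entry u p 0))); rewrite -GD !addr0.
  rewrite big_cons GD; apply: KD; last exact: IHjs.
  apply: IHm => b mb; rewrite ffunE; case: eqP => [_|bp]; first by exists j.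
  apply: uE; rewrite ltn_neqAle mb andbT; apply/eqP => mbE.
  by apply: bp; apply: val_inj.
by apply: (claim k) => b; rewrite leqNgt ltn_ord.
Qed.

Lemma sort_ffun (J : 'I_k -> nat) : exists2 p : 'S_k,
  forall b : 'I_k, nth 0%N (sort geq [seq J b | b <- enum 'I_k]) b = J (p b) &
  size (sort geq [seq J b | b <- enum 'I_k]) = k.
Proof.
have sz : size [seq J b | b <- enum 'I_k] == k by rewrite size_map size_enum_ord.
have ssz : size (sort geq [seq J b | b <- enum 'I_k]) == k by rewrite size_sort.
have /tuple_permP[p pE] : perm_eq (Tuple ssz) (Tuple sz) by rewrite /= perm_sort.
exists p; last exact/eqP.
move=> b; have := congr1 (fun s => nth 0%N s b) pE => /= ->.
rewrite (nth_map b) ?size_enum_ord // nth_ord_enum (tnth_nth 0%N) /=.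
by rewrite (nth_map b) ?size_enum_ord // nth_ord_enum.
Qed.

Lemma ext_span (y : exterior k V) : exists2 Ss,
  all (fun S => [&& sorted gtn S, all (fun j => j < r)%N S & size S == k]) Ss &
  y = \sum_(S <- Ss) ext_gen [ffun b : 'I_k => lam (nth 0%N S b)].
Proof.
pose K (y : exterior k V) := exists2 Ss,
  all (fun S => [&& sorted gtn S, all (fun j => j < r)%N S & size S == k]) Ss &
  y = \sum_(S <- Ss) ext_gen [ffun b : 'I_k => lam (nth 0%N S b)].
have K0 : K 0 by exists [::]; rewrite ?big_nil.
have KD x y' : K x -> K y' -> K (x + y').
  by move=> [Sx hx ->] [Sy hy ->]; rewrite -big_cat; exists (Sx ++ Sy) => //; rewrite all_cat hx hy.
apply: (@F2_presented_ind _ _ K) => //.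
apply: (additive_span (K := K)) => //; first exact: ext_gen_additive.
move=> J Jr; case J_inj : (injectiveb J); last first.
  have /injectivePn[b [c bc bcE]] : ~~ injectiveb J by rewrite J_inj.
  by rewrite -/(ext_gen _) (ext_gen_alternating bc) // !ffunE bcE.
have [p pE psz] := sort_ffun J; set S := sort _ _ in pE psz.
exists [:: S]; last first.
  rewrite big_seq1 -[LHS](ext_gen_perm _ p); congr ext_gen.
  by apply/ffunP => b; rewrite !ffunE pE.
rewrite /= andbT psz eqxx andbT; apply/andP; split; last first.
  by rewrite all_sort; apply/allP => _ /mapP[b _ ->].
have : sorted geq S by apply: sort_sorted => i j; apply: leq_total.
have : uniq S by rewrite sort_uniq map_inj_uniq ?enum_uniq //; apply/injectiveP.
by rewrite gtn_sorted_uniq_geq => -> ->.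
Qed.

Lemma sym_span (y : symmetric k V) : exists2 Ss,
  all (fun S => [&& sorted geq S, all (fun j => j < r)%N S & size S == k]) Ss &
  y = \sum_(S <- Ss) sym_gen [ffun b : 'I_k => lam (nth 0%N S b)].
Proof.
pose K (y : symmetric k V) := exists2 Ss,
  all (fun S => [&& sorted geq S, all (fun j => j < r)%N S & size S == k]) Ss &
  y = \sum_(S <- Ss) sym_gen [ffun b : 'I_k => lam (nth 0%N S b)].
have K0 : K 0 by exists [::]; rewrite ?big_nil.
have KD x y' : K x -> K y' -> K (x + y').
  by move=> [Sx hx ->] [Sy hy ->]; rewrite -big_cat; exists (Sx ++ Sy) => //; rewrite all_cat hx hy.
apply: (@F2_presented_ind _ _ K) => //.
apply: (additive_span (K := K)) => //; first exact: sym_gen_additive.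
move=> J Jr; have [p pE psz] := sort_ffun J; set S := sort _ _ in pE psz.
exists [:: S]; last first.
  rewrite big_seq1 -[LHS](sym_gen_perm _ p); congr sym_gen.
  by apply/ffunP => b; rewrite !ffunE pE.
rewrite /= andbT psz eqxx andbT; apply/andP; split.
  by apply: sort_sorted => i j; apply: leq_total.
by rewrite all_sort; apply/allP => _ /mapP[b _ ->].
Qed.

End PowerSpans.

(** * Cocycles attached to forms on A/2 and on the 2-torsion *)

Section Duals.
Variable A : zmodType.

Lemma mod2_form_exists (chi : A -> F2) : additive_form chi ->
  exists c : dual (mod2 A), forall a, val c (mod2_pi a) = chi a.
Proof.
move=> chiD; have chi0 : chi 0 = 0 by apply: (@addrI _ (chi 0)); rewrite -chiD !addr0.
pose phi (y : mod2 A) : F2^o := chi (repr y).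
have phiE a : phi (mod2_pi a) = chi a.
  have : repr (mod2_pi a) - a \in @doubles A by rewrite -mod2_eq mod2_reprK.
  move=> /asboolP[y yE]; rewrite /phi -[repr _](subrK a) chiD yE mulr2n chiD.
  by rewrite F2_addxx add0r.
have phi_lin : phi \in @linear_form F2 (mod2 A).
  apply/asboolP; apply: (@F2_linear (mod2 A) F2^o) => x y.
  by rewrite -[x]mod2_reprK -[y]mod2_reprK -raddfD !phiE chiD.
by exists (Sub phi phi_lin) => a; rewrite SubK phiE.
Qed.

Lemma val_torsion2 (x : torsion2 A) : val x *+ 2 = 0.
Proof. exact/eqP/(valP x). Qed.

Lemma torsion_dual_exists (psi : A -> F2) : torsion_form psi ->
  exists c : dual (torsion2 A), forall x, val c x = psi (val x).
Proof.
move=> psiT; pose phi (x : torsion2 A) : F2^o := psi (val x).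
have phi_lin : phi \in @linear_form F2 (torsion2 A).
  apply/asboolP; apply: (@F2_linear (torsion2 A) F2^o) => x y.
  by rewrite /phi raddfD psiT ?val_torsion2.
by exists (Sub phi phi_lin) => x; rewrite SubK.
Qed.

Lemma dualD (V : lmodType F2) (c d : dual V) x : val (c + d) x = val c x + val d x.
Proof. by have -> : val (c + d) = val c + val d by exact: raddfD. Qed.

Lemma dual_additive (V : lmodType F2) (c : dual V) x y : val c (x + y) = val c x + val c y.
Proof.
have /asboolP c_lin := valP c.
by have := c_lin 1 x y; rewrite !scale1r.
Qed.

Lemma dual_sum (V : lmodType F2) (js : seq nat) (F : nat -> dual V) x :
  val (\sum_(j <- js) F j) x = \sum_(j <- js) val (F j) x.
Proof.
apply: (big_morph (fun c : dual V => val c x)); first by move=> c d; apply: dualD.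
by have -> : val (0 : dual V) = 0 by exact: raddf0.
Qed.

Definition mod2_cochain (c : dual (mod2 A)) : cochains A := of1 (fun a => val c (mod2_pi a)).

Lemma mod2_form_additive c : additive_form (fun a : A => val (c : dual (mod2 A)) (mod2_pi a) : F2).
Proof. by move=> a b; rewrite raddfD dual_additive. Qed.

Lemma dif_mod2_cochain c : dif (mod2_cochain c) = 0.
Proof. exact/dif_additive/mod2_form_additive. Qed.

Lemma mod2_cochainD c d : mod2_cochain (c + d) = mod2_cochain c + mod2_cochain d.
Proof.
apply: cochainsP => -[|a [|b u]]; rewrite addcE /= ?addr0 //.
Qed.

Definition realizes (e : cochains A) (psi : dual (torsion2 A)) :=
  symmetric_cocycle e /\ forall x : torsion2 A, diagonal e (val x) 0 = val psi x.

(* A chosen symmetric cocycle realizing [psi]; 0 if there is none. *)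
Definition torsion2_cochain (psi : dual (torsion2 A)) : cochains A :=
  if pselect (exists e, realizes e psi) is left h then projT1 (cid h) else 0.

Hypothesis basisA : has_basis A.

Lemma torsion2_cochain_realizes psi : realizes (torsion2_cochain psi) psi.
Proof.
rewrite /torsion2_cochain; case: pselect => [h|[]]; first by case: cid.
have [r [s [l [e [t [b basis]]]]]] := basisA.
(* A [torsion_form] is a map on all of [A] constrained only on 2-torsion, so [psi] is extended by
   0. *)
pose psi' (a : A) : F2 := if insub a is Some x then val psi x else 0.
have psi'E (x : torsion2 A) : psi' (val x) = val psi x by rewrite /psi' valK.
have psi'T : torsion_form psi'.
  move=> a c /eqP a2 /eqP c2; pose x : torsion2 A := Sub a a2; pose y : torsion2 A := Sub c c2.
  have -> : a = val x by rewrite SubK.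
  have -> : c = val y by rewrite SubK.
  by rewrite -raddfD !psi'E dual_additive.
have [ks [_ ks_s ksE]] := torsion_form_realized basis psi'T.
exists (\sum_(k <- ks) e k); split.
  by apply: symmetric_cocycle_sum => k /(allP ks_s); apply: (cb_symmetric basis).
by move=> x; rewrite -psi'E ksE ?val_torsion2.
Qed.

Lemma dif_torsion2_cochain psi : dif (torsion2_cochain psi) = 0.
Proof. by have [[]] := torsion2_cochain_realizes psi. Qed.

Lemma realizes_cohomologous e e' psi : realizes e psi -> realizes e' psi -> cohomologous e e'.
Proof.
move=> [se eE] [se' eE']; have [r [s [l [d [t [b basis]]]]]] := basisA.
apply: (symmetric_cohomologous basis) => // a /eqP a2.
by have := eE (Sub a a2); have := eE' (Sub a a2); rewrite SubK => -> ->.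
Qed.

Lemma torsion2_cochainD psi psi' :
  cohomologous (torsion2_cochain (psi + psi')) (torsion2_cochain psi + torsion2_cochain psi').
Proof.
apply: (realizes_cohomologous (psi := psi + psi')); first exact: torsion2_cochain_realizes.
have [s1 h1] := torsion2_cochain_realizes psi; have [s2 h2] := torsion2_cochain_realizes psi'.
by split=> [|x]; [apply: symmetric_cocycleD|rewrite diagonalD h1 h2 dualD].
Qed.

End Duals.

(** * The filtration and its graded pieces *)

Section Filtration.
Variable n : nat.

Definition Phi_gen (i : nat) (A : zmodType) (x : cohomology F2 n A) : Prop :=
  exists es z, [/\ size es = i, forall f : cochains A, f \in es -> symmetric_cocycle f,
    dif z = 0 & x = coho_class n ((\prod_(f <- es) f) * z)].

Lemma dif_symmetric_prod (A : zmodType) (es : seq (cochains A)) :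
  (forall f, f \in es -> symmetric_cocycle f) -> dif (\prod_(f <- es) f) = 0.
Proof. by move=> ses; apply: dif_prod => f /ses[]. Qed.

Lemma Phi_gen_map i (A B : zmodType) (h : {additive A -> B}) x :
  Phi_gen i x -> Phi_gen i (cohomology_map F2 h n x).
Proof.
move=> [es [z [szes ses dz ->]]]; exists (map (pull h) es), (pull h z); split.
- by rewrite size_map.
- by move=> _ /mapP[f /ses sf ->]; apply: pull_symmetric.
- by rewrite -pull_dif dz.
rewrite coho_class_map; last exact: cocycleM (dif_symmetric_prod ses) dz.
by rewrite pullM pull_prod big_map.
Qed.

Fact Phi_map i (A B : fgAbelian) (h : {additive A -> B}) :
  {in span (@Phi_gen i B), forall x, cohomology_map F2 h n x \in span (@Phi_gen i A)}.
Proof. by apply: span_map => x /(Phi_gen_map h) /mem_span. Qed.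

Definition Phi (i : nat) : subfunctor n :=
  @Subfunctor n (fun A : fgAbelian => span (@Phi_gen i A) : submodClosed _) (@Phi_map i).

Lemma Phi_coho_class i (A : fgAbelian) (es : seq (cochains A)) z : size es = i ->
  (forall f, f \in es -> symmetric_cocycle f) -> dif z = 0 ->
  coho_class n ((\prod_(f <- es) f) * z) \in Phi i A.
Proof. by move=> h1 h2 h3; apply: mem_span; exists es, z. Qed.

Lemma span_ind (V : lmodType F2) (S : V -> Prop) (K : V -> Prop) :
  K 0 -> (forall x y, K x -> K y -> K (x + y)) -> (forall x, S x -> K x) ->
  forall x, x \in span S -> K x.
Proof.
move=> K0 KD KS; pose P : {pred V} := fun x => `[< K x >].
have P_closed : submod_closed P.
  split=> [|a x y /asboolP Kx /asboolP Ky]; apply/asboolP => //.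
  by case: (F2_cases a) => ->; rewrite ?scale0r ?add0r ?scale1r //; apply: KD.
pose Q : submodClosed V := HB.pack P (GRing.isSubmodClosed.Build F2 V P P_closed).
by move=> x /(@span_min _ _ _ Q) h; apply/asboolP/h => y /KS Ky; apply/asboolP.
Qed.

Lemma Phi0 (A : fgAbelian) x : x \in Phi 0 A.
Proof.
have [f [_ df ->]] := coho_class_surj x.
by have := @Phi_coho_class 0 A [::] f erefl; rewrite big_nil mul1r; apply.
Qed.

(** The last symmetric cocycle of a product is absorbed into the arbitrary cocycle [z]. *)
Lemma Phi_decr i (A : fgAbelian) : {subset Phi i.+1 A <= Phi i A}.
Proof.
move=> x; apply: (span_ind (K := fun x => x \in Phi i A)).
- exact: rpred0.
- by move=> y z hy hz; apply: rpredD.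
move=> _ [es [z [szes ses dz ->]]]; case/lastP: es => [//|es f] in szes ses *.
have [_ df _] : symmetric_cocycle f by apply: ses; rewrite mem_rcons mem_head.
rewrite -cats1 big_cat big_seq1 /= -mulrA; apply: Phi_coho_class.
- by move: szes; rewrite size_rcons => -[].
- by move=> g ges; apply: ses; rewrite mem_rcons in_cons ges orbT.
exact: cocycleM.
Qed.

Lemma homogeneous_symmetric_prod (A : zmodType) (es : seq (cochains A)) :
  (forall f, f \in es -> symmetric_cocycle f) ->
  homogeneous (size es).*2 (\prod_(f <- es) f).
Proof.
elim: es => [|f es IHes] ses; first by rewrite big_nil; apply: homogeneous1.
rewrite big_cons /= doubleS -[X in homogeneous X]add2n; apply: homogeneousM.
  by have [] := ses f (mem_head _ _).
by apply: IHes => g ges; apply: ses; rewrite in_cons ges orbT.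
Qed.

Lemma mulc_shortl (A : zmodType) m (f g : cochains A) l :
  homogeneous m f -> (size l < m)%N -> (f * g) l = 0.
Proof.
elim: l m f => [|a l IHl] [|m] f hf //= lm; first by rewrite mulc_nil hf ?mul0r.
rewrite mulc_cons hf // mul0r add0r; apply: (IHl m) => //.
by move=> l' l'm; apply: hf.
Qed.

Lemma part_mul_high (A : zmodType) m k (f g : cochains A) :
  homogeneous m f -> (k < m)%N -> part k (f * g) = 0.
Proof.
move=> hf km; apply: cochainsP => l; rewrite /part; case: eqP => // lk.
by rewrite (mulc_shortl _ hf) ?lk.
Qed.

Lemma Phi_top (A : fgAbelian) x : x \in Phi (n./2).+1 A -> x = 0.
Proof.
apply: (span_ind (K := fun x => x = 0)) => //; first by move=> y z -> ->; rewrite addr0.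
move=> _ [es [z [szes ses dz ->]]].
apply/coho_class_eq0; first exact: cocycleM (dif_symmetric_prod ses) dz.
rewrite (part_mul_high _ (homogeneous_symmetric_prod ses)); first exact: exact_cochain0.
by rewrite szes -ltn_half_double ltnS.
Qed.

Section Graded.
Variables (i : nat) (A : fgAbelian).
Let M := Phi i A.
Let N := Phi i.+1 A.

(* Only meaningful on [M]; elements outside are sent to 0. *)
Definition graded_class (x : cohomology F2 n A) : graded_piece (Phi i) (Phi i.+1) A :=
  quotient_pi (within M N) (insubd (0 : submodule M) x).

Lemma graded_classD x y : x \in M -> y \in M -> graded_class (x + y) = graded_class x + graded_class y.
Proof.
move=> xM yM; rewrite /graded_class -raddfD; congr quotient_pi; apply: val_inj.
have valE z : z \in M -> val (insubd (0 : submodule M) z) = z.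
  by move=> zM; rewrite val_insubd zM.
rewrite valE; last exact: rpredD.
by apply: esym; apply: etrans (raddfD val _ _) _; congr (_ + _); apply: valE.
Qed.

Lemma graded_class_eq0 x : x \in M -> graded_class x = 0 <-> x \in N.
Proof.
move=> xM; have xE : val (insubd (0 : submodule M) x) = x by rewrite val_insubd xM.
have -> : (x \in N) = (graded_class x == 0).
  by rewrite -(raddf0 (quotient_pi (within M N))) quotient_eq subr0 unfold_in -[in LHS]xE.
by split=> /eqP.
Qed.

Lemma graded_class_surj y : exists2 x, x \in M & y = graded_class x.
Proof.
exists (val (repr y)); first exact: valP.
by rewrite -[LHS]quotient_reprK /graded_class valKd.
Qed.

Lemma graded_class_sum (I : eqType) (r : seq I) (F : I -> cohomology F2 n A) :
  {in r, forall j, F j \in M} -> graded_class (\sum_(j <- r) F j) = \sum_(j <- r) graded_class (F j).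
Proof.
elim: r => [|j r IHr] FM.
  by rewrite !big_nil; apply/graded_class_eq0; apply: rpred0.
have FMr : {in r, forall j, F j \in M} by move=> h hr; apply: FM; rewrite in_cons hr orbT.
rewrite !big_cons graded_classD ?IHr //; first by apply: FM; rewrite mem_head.
by rewrite big_seq; apply: rpred_sum => h hr; apply: FMr.
Qed.

End Graded.

Lemma graded_piece_map_class i (A B : fgAbelian) (h : {additive A -> B}) x : x \in Phi i B ->
  graded_piece_map (Phi i) (Phi i.+1) h (graded_class i x) = graded_class i (cohomology_map F2 h n x).
Proof.
move=> xM; rewrite /graded_piece_map /subquotient_map /= quotient_mapE.
congr quotient_pi; apply: val_inj.
have hxM : cohomology_map F2 h n x \in Phi i A by apply: (@Phi_map i A B h).
apply: etrans (esym (_ : val (insubd _ _) = _)); last by rewrite val_insubd hxM.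
by rewrite /submodule_map SubK val_insubd xM.
Qed.

End Filtration.

(** [torsion2_cochain] depends on choices and is additive only up to coboundary. The other factors
    are cocycles, so the defect remains a coboundary in the product. *)
Lemma prod_with_entry (A : zmodType) (T : Type) k (F : T -> cochains A)
    (v : {ffun 'I_k -> T}) (p : 'I_k) (x y z : T) :
  (forall c, dif (F c) = 0) -> cohomologous (F x) (F y + F z) ->
  cohomologous (\prod_(a < k) F (with_entry v p x a))
    (\prod_(a < k) F (with_entry v p y a) + \prod_(a < k) F (with_entry v p z a)).
Proof.
move=> dF Fxyz.
have at_p c : F (with_entry v p c p) = F c by rewrite ffunE eqxx.
have off_p c (s : seq 'I_k) : p \notin s ->
    \prod_(a <- s) F (with_entry v p c a) = \prod_(a <- s) F (v a).
  move=> ps; apply: eq_big_seq => a sa; rewrite ffunE.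
  by case: eqP => // ap; rewrite -ap sa in ps.
have dP (u : 'I_k -> T) (s : seq 'I_k) : dif (\prod_(a <- s) F (u a)) = 0 by apply: dif_prod.
suff claim (s : seq 'I_k) : uniq s -> p \in s ->
    cohomologous (\prod_(a <- s) F (with_entry v p x a))
      (\prod_(a <- s) F (with_entry v p y a) + \prod_(a <- s) F (with_entry v p z a)).
  by apply: claim; [apply: index_enum_uniq|apply: mem_index_enum].
elim: s => [//|a s IHs] /= /andP[sa us]; rewrite in_cons !big_cons.
have [pa|pa /= ps] := eqVneq p a.
  subst a => _; rewrite (at_p x) (at_p y) (at_p z).
  rewrite (off_p x s sa) (off_p y s sa) (off_p z s sa) -mulrDl.
  by apply: cohomologousM => //; apply: cohomologous_refl.
have aE c : F (with_entry v p c a) = F (v a).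
  by rewrite ffunE eq_sym (negPf pa).
rewrite !aE -mulrDr; apply: cohomologousM => //; [|exact: cohomologous_refl|exact: IHs].
by rewrite difD !dP addr0.
Qed.

Lemma symmetric_cocycle_sqr (A : zmodType) (chi : A -> F2) :
  additive_form chi -> symmetric_cocycle (of1 chi * of1 chi).
Proof.
move=> chiD; split.
- by apply: (@homogeneousM _ 1 1); apply: homogeneous_of1.
- by apply: cocycleM; apply: dif_additive.
by move=> a b; rewrite !of1M /= mulrC.
Qed.

(** * The comparison map onto a graded piece *)

Section Comparison.
Variables (n i : nat) (A : fgAbelian).
Let j := (n - 2 * i)%N.
Let basisA : has_basis A := fg_basis (@fg_finitely_generated A).

Definition even_prod (w : {ffun 'I_i -> dual (torsion2 A)}) : cochains A :=
  \prod_(a < i) torsion2_cochain (w a).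
Definition form_prod (v : {ffun 'I_j -> dual (mod2 A)}) : cochains A := \prod_(c < j) mod2_cochain (v c).

Definition comparison_gen v w : graded_piece (Phi n i) (Phi n i.+1) A :=
  graded_class i (coho_class n (even_prod w * form_prod v)).

Let d_even w : dif (even_prod w) = 0.
Proof. by apply: dif_prod => a _; apply: dif_torsion2_cochain. Qed.

Let d_form v : dif (form_prod v) = 0.
Proof. by apply: dif_prod => a _; apply: dif_mod2_cochain. Qed.

Let size_index_enum k : size (index_enum 'I_k) = k.
Proof. by rewrite /index_enum -enumT size_enum_ord. Qed.

Lemma even_prod_mem w z : dif z = 0 -> coho_class n (even_prod w * z) \in Phi n i A.
Proof.
move=> dz; rewrite /even_prod -(big_map (fun a => torsion2_cochain (w a)) xpredT id).
apply: Phi_coho_class => //; first by rewrite size_map size_index_enum.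
by move=> _ /mapP[a _ ->]; have [] := torsion2_cochain_realizes basisA (w a).
Qed.

Let graded_cohomologous f g : dif f = 0 -> cohomologous f g ->
  graded_class i (coho_class n f) = graded_class i (coho_class n g) :> graded_piece (Phi n i) (Phi n i.+1) A.
Proof. by move=> df fg; rewrite (coho_class_cohomologous n df fg). Qed.

Lemma comparison_additive_w v : additive_in_entries (comparison_gen v).
Proof.
split=> w p x y; rewrite /comparison_gen.
rewrite (@graded_cohomologous _ (even_prod (with_entry w p x) * form_prod v +
    even_prod (with_entry w p y) * form_prod v)).
- by rewrite coho_classD ?graded_classD ?even_prod_mem //; apply: cocycleM.
- exact: cocycleM.
rewrite -mulrDl; apply: cohomologousM => //; last exact: cohomologous_refl.
by apply: prod_with_entry; [apply: dif_torsion2_cochain|apply: torsion2_cochainD].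
Qed.

Lemma comparison_additive_v w : additive_in_entries (comparison_gen^~ w).
Proof.
split=> v p x y; rewrite /comparison_gen.
rewrite (@graded_cohomologous _ (even_prod w * form_prod (with_entry v p x) +
    even_prod w * form_prod (with_entry v p y))).
- by rewrite coho_classD ?graded_classD ?even_prod_mem //; apply: cocycleM.
- exact: cocycleM.
rewrite -mulrDr; apply: cohomologousM => //; [|exact: cohomologous_refl|].
  by rewrite difD !d_form addr0.
apply: prod_with_entry; first exact: dif_mod2_cochain.
by rewrite mod2_cochainD; apply: cohomologous_refl.
Qed.

Lemma comparison_perm v (w : {ffun 'I_i -> dual (torsion2 A)}) (p : 'S_i) :
  comparison_gen v [ffun a => w (p a)] = comparison_gen v w.
Proof.
apply: graded_cohomologous; first exact: cocycleM.
apply: cohomologousM => //; last exact: cohomologous_refl.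
have -> : even_prod [ffun a => w (p a)] = \prod_(a <- map p (index_enum 'I_i)) torsion2_cochain (w a).
  by rewrite /even_prod big_map; apply: eq_bigr => a _; rewrite ffunE.
apply: cohomologous_perm => [|a _|a b _ _].
- apply: uniq_perm; rewrite ?map_inj_uniq ?index_enum_uniq //; try exact: perm_inj.
  move=> a; rewrite mem_index_enum; apply/mapP; exists ((p^-1)%g a); rewrite ?mem_index_enum //.
  by rewrite permKV.
- exact: dif_torsion2_cochain.
have sw c : symmetric_cocycle (torsion2_cochain (w c)).
  by have [] := torsion2_cochain_realizes basisA (w c).
exact: symmetric_cocycle_commute.
Qed.

Lemma comparison_alternating (v : {ffun 'I_j -> dual (mod2 A)}) w b c :
  b != c -> v b = v c -> comparison_gen v w = 0.
Proof.
move=> bc vbc; apply/graded_class_eq0; first exact: even_prod_mem.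
set s := rem c (rem b (index_enum 'I_j)).
have s_perm : perm_eq (index_enum 'I_j) [:: b, c & s].
  apply: (perm_trans (perm_to_rem (mem_index_enum b))); rewrite perm_cons.
  by apply: perm_to_rem; rewrite mem_rem_uniq ?index_enum_uniq // inE /= eq_sym bc mem_index_enum.
pose L : cochains A := mod2_cochain (v b); pose R := \prod_(a <- s) mod2_cochain (v a).
have dR : dif R = 0 by apply: dif_prod => a _; apply: dif_mod2_cochain.
have [sq dsq _] : symmetric_cocycle (L * L) by apply/symmetric_cocycle_sqr/mod2_form_additive.
have vE : cohomologous (form_prod v) (L * L * R).
  have -> : L * L * R = \prod_(a <- [:: b, c & s]) mod2_cochain (v a).
    by rewrite !big_cons -vbc mulrA.
  apply: cohomologous_perm => // [a _|a a' _ _]; first exact: dif_mod2_cochain.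
  by apply: of1_commute; [apply: mod2_form_additive|apply: dif_mod2_cochain].
rewrite (@coho_class_cohomologous _ _ _ (even_prod w * (L * L * R))); first last.
- by apply: cohomologousM => //; [apply: cocycleM|apply: cohomologous_refl].
- exact: cocycleM.
rewrite mulrA /even_prod -(big_map (fun a => torsion2_cochain (w a)) xpredT id).
(* The square of the repeated character is one more symmetric cocycle, which makes [i + 1] of
   them. *)
pose es := rcons (map (fun a => torsion2_cochain (w a)) (index_enum 'I_i)) (L * L).
rewrite -[_ * (L * L)](_ : \prod_(f <- es) f = _); last first.
  by rewrite /es -cats1 big_cat big_seq1.
apply: Phi_coho_class => //; first by rewrite size_rcons size_map size_index_enum.
move=> f; rewrite mem_rcons in_cons => /orP[/eqP ->|/mapP[a _ ->]].
  exact/symmetric_cocycle_sqr/mod2_form_additive.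
by have [] := torsion2_cochain_realizes basisA (w a).
Qed.

(** The universal properties are used one at a time: [g v] on the symmetric power for fixed [v],
    then [h x] on the exterior power for a fixed symmetric tensor [x], then the tensor product. At
    each stage the relations in the remaining variable are checked on generators. *)
Lemma comparison_exists :
  exists T : {linear ext_sym j i A -> graded_piece (Phi n i) (Phi n i.+1) A},
    forall v w, T (ten_gen (ext_gen v) (sym_gen w)) = comparison_gen v w.
Proof.
have /choice[g gE] v := symmetric_lift_exists (comparison_additive_w v) (comparison_perm v).
have gD x : additive_in_entries (fun v => g v x).
  split=> v p y z; move: x; apply: presented_ind.
  - by rewrite !raddf0 addr0.
  - by move=> a x x' hx hx'; rewrite !linearP hx hx' scalerDr addrACA.
  by move=> w; rewrite -/(sym_gen w) !gE; case: (comparison_additive_v w).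
have galt x (v : {ffun 'I_j -> dual (mod2 A)}) b c : b != c -> v b = v c -> g v x = 0.
  move=> bc vbc; move: x; apply: presented_ind.
  - by rewrite raddf0.
  - by move=> a x x' hx hx'; rewrite linearP hx hx' scaler0 addr0.
  by move=> w; rewrite -/(sym_gen w) gE (comparison_alternating w bc).
have /choice[h hE] x := exterior_lift_exists (gD x) (galt x).
have hD y x x' : h (x + x') y = h x y + h x' y.
  move: y; apply: presented_ind.
  - by rewrite !raddf0 addr0.
  - by move=> a y y' hy hy'; rewrite !linearP hy hy' scalerDr addrACA.
  by move=> v; rewrite -/(ext_gen v) !hE raddfD.
have [|T TE] := @tensor_lift_exists _ _ _ (fun y x => h x y) _ hD.
  by move=> y y' x; rewrite raddfD.
by exists T => v w; rewrite TE hE gE.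
Qed.

End Comparison.

Lemma cohomologous_prod (A : zmodType) (I : eqType) (u : seq I) (F G : I -> cochains A) :
  {in u, forall a, dif (F a) = 0} -> {in u, forall a, cohomologous (F a) (G a)} ->
  cohomologous (\prod_(a <- u) F a) (\prod_(a <- u) G a).
Proof.
elim: u => [|a u IHu] dF FG; first by rewrite !big_nil; apply: cohomologous_refl.
have au : {subset u <= a :: u} by move=> c cu; rewrite in_cons cu orbT.
rewrite !big_cons; apply: cohomologousM; last by apply: IHu => c /au; [apply: dF|apply: FG].
- by apply: dF; rewrite mem_head.
- by apply: dif_prod => c cu; apply: cohomologous_cocycle (FG c (au c cu)) (dF c (au c cu)).
by apply: FG; rewrite mem_head.
Qed.

(** * Bijectivity *)

Section Bijectivity.
Variables (n i : nat) (A : fgAbelian).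
Hypothesis i_le : (i <= n./2)%N.
Let j := (n - 2 * i)%N.
Variables (r s : nat) (l : nat -> A -> F2) (e : nat -> cochains A) (t b : nat -> A).
Hypothesis basis : cohomology_basis r s l e t b.

Let lD := cb_additive basis.
Let esym := cb_symmetric basis.

Let n_eq : (i.*2 + j)%N = n.
Proof. by rewrite /j mul2n subnKC // -geq_half_double. Qed.

Let basisA : has_basis A.
Proof. by exists r, s, l, e, t, b. Qed.

Lemma dif_sum_standard k ms : all (fun m => standard r s n m && (k <= size m.1)%N) ms ->
  dif (\sum_(m <- ms) mono e l m) = 0.
Proof.
move=> /allP std; apply: dif_sum0 => m /std /andP[+ _]; exact: (dif_mono lD esym).
Qed.

Lemma Phi_span k x : x \in Phi n k A -> exists2 ms,
  all (fun m => standard r s n m && (k <= size m.1)%N) ms & x = coho_class n (\sum_(m <- ms) mono e l m).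
Proof.
move: x; apply: span_ind.
- by exists [::] => //; rewrite big_nil coho_class_exact //; apply: exact_cochain0.
- move=> x y [ms1 h1 ->] [ms2 h2 ->]; exists (ms1 ++ ms2); first by rewrite all_cat h1 h2.
  by rewrite big_cat coho_classD // (dif_sum_standard h1, dif_sum_standard h2).
move=> _ [es [z [szes ses dz ->]]].
have dez : dif ((\prod_(f <- es) f) * z) = 0 by apply: cocycleM (dif_symmetric_prod ses) dz.
have [kn|nk] := leqP k.*2 n; last first.
  exists [::] => //; rewrite big_nil [RHS]coho_class_exact; last exact: exact_cochain0.
  apply/coho_class_eq0 => //; rewrite (part_mul_high _ (homogeneous_symmetric_prod ses)) ?szes //.
  exact: exact_cochain0.
(* The product of the [k] symmetric cocycles has degree [2 k], so only the component of [z] of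
   degree [n - 2 k] contributes to degree [n]. *)
have [ms std_ms msE] := symmetric_prod_span basis ses (@homogeneous_part _ (n - k.*2)%N z) (dif_part _ dz).
rewrite szes subnKC // in std_ms; exists ms => //.
have := partM (n - k.*2)%N z (homogeneous_symmetric_prod ses); rewrite szes subnKC // => partE.
rewrite -(coho_class_part n dez) partE.
by apply: coho_class_cohomologous msE; apply: cocycleM (dif_symmetric_prod ses) (dif_part _ dz).
Qed.

Lemma mono_Phi k m : standard r s n m -> (k <= size m.1)%N -> coho_class n (mono e l m) \in Phi n k A.
Proof.
move=> /and5P[_ /allP h2 _ h4 _] km; rewrite /mono -(cat_take_drop k m.1) big_cat -mulrA /=.
rewrite -(big_map e xpredT id); apply: Phi_coho_class.
- by rewrite size_map size_take; case: ltngtP km.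
- by move=> _ /mapP[h /mem_take /h2 hs ->]; apply: esym.
apply: cocycleM; last exact: (dif_prod_l lD).
by apply: dif_prod => h /mem_drop /h2 /esym[].
Qed.

Lemma lam_exists : exists lam : nat -> dual (mod2 A),
  forall k, (k < r)%N -> forall a, val (lam k) (mod2_pi a) = l k a.
Proof.
have /choice[lam lamE] : forall k, exists c : dual (mod2 A), (k < r)%N ->
  forall a, val c (mod2_pi a) = l k a; last by exists lam.
move=> k; case: (ltnP k r) => kr; last by exists 0.
by have [c cE] := mod2_form_exists (lD kr); exists c.
Qed.

Lemma eta_exists : exists eta : nat -> dual (torsion2 A),
  forall k, (k < s)%N -> forall x, val (eta k) x = diagonal (e k) (val x) 0.
Proof.
have /choice[eta etaE] : forall k, exists c : dual (torsion2 A), (k < s)%N ->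
  forall x, val c x = diagonal (e k) (val x) 0; last by exists eta.
move=> k; case: (ltnP k s) => ks; last by exists 0.
by have [c cE] := torsion_dual_exists (diagonal_torsion_form (esym ks)); exists c.
Qed.

Variables (lam : nat -> dual (mod2 A)) (eta : nat -> dual (torsion2 A)).
Hypothesis lamE : forall k, (k < r)%N -> forall a, val (lam k) (mod2_pi a) = l k a.
Hypothesis etaE : forall k, (k < s)%N -> forall x, val (eta k) x = diagonal (e k) (val x) 0.

Let lam_span (x : dual (mod2 A)) : exists2 ks, all (fun k => k < r)%N ks & x = \sum_(k <- ks) lam k.
Proof.
have [ks ks_r ksE] := form_sum basis (mod2_form_additive x).
exists ks => //; apply: val_inj; apply: funext => y; rewrite dual_sum -(mod2_reprK y).
have := congr1 (fun f : cochains A => f [:: repr y]) ksE.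
have evalE (F : nat -> cochains A) u : (\sum_(k <- ks) F k) u = \sum_(k <- ks) F k u.
  by apply: (big_morph (fun f : cochains A => f u)).
rewrite evalE => h; apply: etrans h _.
by apply: eq_big_seq => k /(allP ks_r) kr; rewrite lamE.
Qed.

Let eta_span (x : dual (torsion2 A)) : exists2 ks, all (fun k => k < s)%N ks & x = \sum_(k <- ks) eta k.
Proof.
have [sx xE] := torsion2_cochain_realizes basisA x.
have [ks [_ ks_s ksE]] := torsion_form_realized basis (diagonal_torsion_form sx).
exists ks => //; apply: val_inj; apply: funext => y.
rewrite dual_sum -xE ksE ?val_torsion2 // diagonal_sum.
by apply: eq_big_seq => k /(allP ks_s) ks'; rewrite etaE.
Qed.

Definition standard_gen (m : monomial) : ext_sym j i A :=
  ten_gen (ext_gen [ffun c : 'I_j => lam (nth 0%N m.2 c)])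
          (sym_gen [ffun a : 'I_i => eta (nth 0%N m.1 a)]).

Lemma standard_gen_span (x : ext_sym j i A) : exists2 ms,
  all (fun m => standard r s n m && (size m.1 == i)) ms & x = \sum_(m <- ms) standard_gen m.
Proof.
pose K (x : ext_sym j i A) := exists2 ms,
  all (fun m => standard r s n m && (size m.1 == i)) ms & x = \sum_(m <- ms) standard_gen m.
have K0 : K 0 by exists [::]; rewrite ?big_nil.
have KD u v : K u -> K v -> K (u + v).
  by move=> [ms1 h1 ->] [ms2 h2 ->]; rewrite -big_cat; exists (ms1 ++ ms2) => //; rewrite all_cat h1 h2.
move: x; apply: (@F2_presented_ind _ _ K) => //.
move=> [x y]; rewrite -/(ten_gen x y).
have [Ss Ss_std ->] := ext_span lam_span x.
have [als als_std ->] := sym_span eta_span y.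
have sum_l (u : seq (seq nat)) F w : ten_gen (\sum_(S <- u) F S) w = \sum_(S <- u) ten_gen (F S) w.
  apply: (big_morph (fun x => ten_gen x w)); first by move=> c d; apply: ten_genDl.
  by apply: (@addrI _ (ten_gen 0 w)); rewrite -ten_genDl !addr0.
have sum_r (u : seq (seq nat)) F w : ten_gen w (\sum_(S <- u) F S) = \sum_(S <- u) ten_gen w (F S).
  apply: (big_morph (fun x => ten_gen w x)); first by move=> c d; apply: ten_genDr.
  by apply: (@addrI _ (ten_gen w 0)); rewrite -ten_genDr !addr0.
exists [seq (al, be) | be <- Ss, al <- als].
  apply/allP => _ /allpairsP[[S0 al] [/= /(allP Ss_std) hS /(allP als_std) hal ->]] /=.
  move: hS hal => /and3P[h3 h4 /eqP h5] /and3P[h1 h2 /eqP h6].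
  by rewrite h6 eqxx andbT; apply/and5P; split=> //=; rewrite h5 h6 n_eq.
rewrite sum_l big_allpairs_dep; apply: eq_bigr => be _; rewrite sum_r; apply: eq_bigr => al _.
by [].
Qed.

Variable T : {linear ext_sym j i A -> graded_piece (Phi n i) (Phi n i.+1) A}.
Hypothesis TE : forall v w, T (ten_gen (ext_gen v) (sym_gen w)) = comparison_gen v w.

(** The cocycle chosen for [eta k] and the basis cocycle [e k] realise the same form, hence are
    cohomologous. *)
Lemma comparison_standard_gen m : standard r s n m -> size m.1 = i ->
  T (standard_gen m) = graded_class i (coho_class n (mono e l m)).
Proof.
move=> std_m szm; rewrite /standard_gen TE /comparison_gen.
have /and5P[_ /allP h2 _ /allP h4 /eqP h5] := std_m.
have szm2 : size m.2 = j by apply: (@addnI i.*2); rewrite n_eq -h5 szm.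
congr (graded_class i _); apply: coho_class_cohomologous.
  by apply: cocycleM; apply: dif_prod => a _; [apply: dif_torsion2_cochain|apply: dif_mod2_cochain].
have -> : form_prod [ffun c : 'I_j => lam (nth 0%N m.2 c)] = \prod_(k <- m.2) of1 (l k).
  rewrite (big_nth 0%N) szm2 big_mkord; apply: eq_bigr => c _; rewrite ffunE /mod2_cochain; congr of1.
  by apply: funext => a; rewrite lamE // h4 // mem_nth // szm2.
apply: cohomologousM; last exact: cohomologous_refl.
- by apply: dif_prod => a _; apply: dif_torsion2_cochain.
- by apply: dif_prod => k /h4 /lD/dif_additive.
rewrite [X in cohomologous _ X](big_nth 0%N) szm big_mkord.
apply: cohomologous_prod => a _; first exact: dif_torsion2_cochain.
rewrite ffunE; set k := nth _ _ _.
have ks : (k < s)%N by apply: h2; rewrite mem_nth // szm.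
apply: (realizes_cohomologous basisA (torsion2_cochain_realizes basisA _)).
by split=> [|x]; [apply: esym|rewrite etaE].
Qed.

(** The standard generators are known only to span the source. A combination mapped to 0 gives a
    relation between monomials with exactly [i] even classes and monomials with more. The two lists
    are disjoint, so independence in cohomology makes both empty. *)
Lemma comparison_injective : injective T.
Proof.
suff T0 x : T x = 0 -> x = 0.
  by move=> x y Txy; apply/eqP; rewrite -subr_eq0; apply/eqP/T0; rewrite linearB /= Txy subrr.
have [ms0 std_ms0 ->] := standard_gen_span x.
rewrite -(sum_odd_part (@lmodF2_addxx _)); set ms := odd_part ms0 => Tms.
have std_ms m : m \in ms -> standard r s n m /\ size m.1 = i.
  by move=> /odd_part_sub /(allP std_ms0) /andP[? /eqP].
have dm m : standard r s n m -> dif (mono e l m) = 0 by apply: (dif_mono lD esym).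
have msPhi : coho_class n (\sum_(m <- ms) mono e l m) \in Phi n i.+1 A.
  rewrite coho_class_sum; last by move=> m /std_ms[/dm].
  have mPhi m : m \in ms -> coho_class n (mono e l m) \in Phi n i A.
    by move=> /std_ms[std_m szm]; apply: mono_Phi; rewrite ?szm.
  apply/graded_class_eq0; first by rewrite big_seq; apply: rpred_sum.
  rewrite graded_class_sum //; rewrite linear_sum in Tms; rewrite -[RHS]Tms.
  by apply: eq_big_seq => m /std_ms[std_m szm]; rewrite comparison_standard_gen.
have [ms' std_ms' ms'E] := Phi_span msPhi.
rewrite -[X in _ = coho_class n X](sum_odd_part (@addcc A)) in ms'E; set ms1 := odd_part ms' in ms'E.
have std_ms1 m : m \in ms1 -> standard r s n m /\ (i < size m.1)%N.
  by move=> /odd_part_sub /(allP std_ms') /andP[].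
have std_cat : all (standard r s n) (ms ++ ms1).
  by rewrite all_cat; apply/andP; split; apply/allP => m; [move=> /std_ms[]|move=> /std_ms1[]].
have : ms ++ ms1 = [::].
  apply: (cb_indep basis _ std_cat).
    rewrite cat_uniq !odd_part_uniq andbT /=; apply/hasPn => m /std_ms1[_ im].
    by apply/negP => /std_ms[_ szm]; rewrite szm ltnn in im.
  have dms : dif (\sum_(m <- ms ++ ms1) mono e l m) = 0 by apply: (dif_sum_mono lD esym std_cat).
  have /coho_class_eq0 : coho_class n (\sum_(m <- ms ++ ms1) mono e l m) = 0.
    rewrite big_cat coho_classD; first by rewrite ms'E lmodF2_addxx.
      by apply: dif_sum0 => m /std_ms[/dm].
    by apply: dif_sum0 => m /std_ms1[/dm].
  move=> /(_ dms); rewrite part_homogeneous // .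
  by apply: homogeneous_sum => m /(allP std_cat); apply: homogeneous_mono.
by move=> /(congr1 size) /eqP; rewrite size_cat addn_eq0 => /andP[/nilP -> _]; rewrite big_nil.
Qed.

(** Monomials with more than [i] even classes die in the graded piece, and those with exactly [i]
    are images of standard generators. *)
Lemma comparison_surjective y : exists x, T x = y.
Proof.
have [z /Phi_span[ms std_ms ->] ->] := graded_class_surj y.
have dm m : m \in ms -> dif (mono e l m) = 0.
  by move=> /(allP std_ms) /andP[std_m _]; apply: (dif_mono lD esym std_m).
have mPhi m : m \in ms -> coho_class n (mono e l m) \in Phi n i A.
  by move=> /(allP std_ms) /andP[std_m im]; apply: mono_Phi.
exists (\sum_(m <- ms | size m.1 == i) standard_gen m).
rewrite coho_class_sum // graded_class_sum // linear_sum [RHS](bigID (fun m : monomial => size m.1 == i)) /=.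
rewrite [X in _ = _ + X]big1_seq ?addr0 => [|m /andP[mi mms]].
  rewrite big_seq_cond [RHS]big_seq_cond; apply: eq_bigr => m /andP[/(allP std_ms) /andP[std_m _] /eqP szm].
  exact: comparison_standard_gen.
have /andP[std_m im] := allP std_ms m mms.
by apply/graded_class_eq0; [apply: mPhi|apply: mono_Phi => //; rewrite ltn_neqAle eq_sym mi].
Qed.

End Bijectivity.

(** * Naturality of the comparison map and of its inverse *)

Lemma exterior_map_gen k (V W : lmodType F2) (f : {linear V -> W}) (v : {ffun 'I_k -> V}) :
  exterior_map k f (ext_gen v) = ext_gen [ffun c => f (v c)].
Proof. by rewrite [LHS]quotient_mapE /= free_mapU. Qed.

Lemma symmetric_map_gen k (V W : lmodType F2) (f : {linear V -> W}) (v : {ffun 'I_k -> V}) :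
  symmetric_map k f (sym_gen v) = sym_gen [ffun c => f (v c)].
Proof. by rewrite [LHS]quotient_mapE /= free_mapU. Qed.

Lemma tensor_map_gen (V V' W W' : lmodType F2) (f : {linear V -> V'}) (g : {linear W -> W'}) x y :
  tensor_map f g (ten_gen x y) = ten_gen (f x) (g y).
Proof. by rewrite [LHS]quotient_mapE /= free_mapU. Qed.

Lemma ext_sym_ind j i (A : fgAbelian) (K : ext_sym j i A -> Prop) :
  K 0 -> (forall x y, K x -> K y -> K (x + y)) ->
  (forall v w, K (ten_gen (ext_gen v) (sym_gen w))) -> forall x, K x.
Proof.
move=> K0 KD Kgen.
have gen0l y : ten_gen (0 : exterior j (dual (mod2 A))) y = 0 :> tensor _ (symmetric i (dual (torsion2 A))).
  by apply: (@addrI _ (ten_gen 0 y)); rewrite -ten_genDl !addr0.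
have gen0r x : ten_gen x (0 : symmetric i (dual (torsion2 A))) = 0 :> tensor (exterior j (dual (mod2 A))) _.
  by apply: (@addrI _ (ten_gen x 0)); rewrite -ten_genDr !addr0.
apply: F2_presented_ind => // -[x y]; rewrite -/(ten_gen x y).
move: x; apply: F2_presented_ind => [|x x' Kx Kx'|v]; first by rewrite gen0l.
  by rewrite ten_genDl; apply: KD.
rewrite -/(ext_gen v); move: y; apply: F2_presented_ind => [|x x' Kx Kx'|w].
- by rewrite gen0r.
- by rewrite ten_genDr; apply: KD.
exact: Kgen.
Qed.

Lemma ext_sym_eq j i (A : fgAbelian) (U : lmodType F2) (F G : {linear ext_sym j i A -> U}) :
  (forall v w, F (ten_gen (ext_gen v) (sym_gen w)) = G (ten_gen (ext_gen v) (sym_gen w))) ->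
  F =1 G.
Proof.
move=> FG; apply: ext_sym_ind => [|x y hx hy|//]; first by rewrite !linear0.
by rewrite !linearD hx hy.
Qed.

Lemma ext_sym_map_gen j i (A B : fgAbelian) (f : {additive A -> B})
    (v : {ffun 'I_j -> dual (mod2 B)}) (w : {ffun 'I_i -> dual (torsion2 B)}) :
  ext_sym_map j i f (ten_gen (ext_gen v) (sym_gen w)) =
  ten_gen (ext_gen [ffun c => dual_map (mod2_map f) (v c)])
    (sym_gen [ffun a => dual_map (torsion2_map f) (w a)]).
Proof. by rewrite /ext_sym_map tensor_map_gen exterior_map_gen symmetric_map_gen. Qed.

Lemma pull_mod2_cochain (A B : zmodType) (f : {additive A -> B}) (c : dual (mod2 B)) :
  pull f (mod2_cochain c) = mod2_cochain (dual_map (mod2_map f) c).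
Proof.
apply: cochainsP => -[|a [|b u]] //; rewrite /pull /mod2_cochain /=.
by rewrite /precomp /= mod2_mapE.
Qed.

Lemma pull_realizes (A B : zmodType) (f : {additive A -> B}) e (psi : dual (torsion2 B)) :
  realizes e psi -> realizes (pull f e) (dual_map (torsion2_map f) psi).
Proof.
move=> [se eE]; split=> [|x]; first exact: pull_symmetric.
rewrite [RHS](_ : _ = val psi (torsion2_map f x)) // -eE SubK.
by rewrite /diagonal /pull /= raddf0.
Qed.

Section Naturality.
Variables (n i : nat).
Hypothesis i_le : (i <= n./2)%N.
Let j := (n - 2 * i)%N.

(** The pullback of the cocycle chosen for a form and the cocycle chosen for the pulled-back form
    realise the same form, so the choices differ by a coboundary. *)
Lemma comparison_gen_map (A B : fgAbelian) (f : {additive A -> B})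
    (v : {ffun 'I_j -> dual (mod2 B)}) (w : {ffun 'I_i -> dual (torsion2 B)}) :
  graded_piece_map (Phi n i) (Phi n i.+1) f (comparison_gen v w) =
  comparison_gen [ffun c => dual_map (mod2_map f) (v c)]
    [ffun a => dual_map (torsion2_map f) (w a)].
Proof.
have basisA := fg_basis (@fg_finitely_generated A).
have basisB := fg_basis (@fg_finitely_generated B).
have d_form (C : fgAbelian) (u : {ffun 'I_j -> dual (mod2 C)}) : dif (form_prod u) = 0.
  by apply: dif_prod => c _; apply: dif_mod2_cochain.
have d_even (C : fgAbelian) (u : {ffun 'I_i -> dual (torsion2 C)}) : dif (even_prod u) = 0.
  by apply: dif_prod => c _; apply: dif_torsion2_cochain; apply: fg_basis (@fg_finitely_generated C).
rewrite /comparison_gen graded_piece_map_class ?even_prod_mem // coho_class_map; last exact: cocycleM.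
congr (graded_class i _); apply: coho_class_cohomologous; first by rewrite -pull_dif cocycleM.
rewrite pullM; apply: cohomologousM.
- by rewrite -pull_dif d_even.
- exact: d_form.
- rewrite /even_prod pull_prod; apply: cohomologous_prod => a _.
    by rewrite -pull_dif dif_torsion2_cochain.
  rewrite ffunE; apply: realizes_cohomologous (torsion2_cochain_realizes basisA _) => //.
  exact/pull_realizes/torsion2_cochain_realizes.
rewrite /form_prod pull_prod (eq_bigr (fun c => mod2_cochain (dual_map (mod2_map f) (v c)))).
  under [X in cohomologous _ X]eq_bigr => c _ do rewrite ffunE.
  exact: cohomologous_refl.
by move=> c _; apply: pull_mod2_cochain.
Qed.

Lemma comparison_natural (A B : fgAbelian) (f : {additive A -> B})
    (TA : {linear ext_sym j i A -> graded_piece (Phi n i) (Phi n i.+1) A})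
    (TB : {linear ext_sym j i B -> graded_piece (Phi n i) (Phi n i.+1) B}) :
  (forall v w, TA (ten_gen (ext_gen v) (sym_gen w)) = comparison_gen v w) ->
  (forall v w, TB (ten_gen (ext_gen v) (sym_gen w)) = comparison_gen v w) ->
  forall x, graded_piece_map (Phi n i) (Phi n i.+1) f (TB x) = TA (ext_sym_map j i f x).
Proof.
move=> TAE TBE; apply: (ext_sym_eq (F := graded_piece_map (Phi n i) (Phi n i.+1) f \o TB)
  (G := TA \o ext_sym_map j i f)) => v w.
apply: etrans (congr1 (graded_piece_map (Phi n i) (Phi n i.+1) f) (TBE v w)) _.
apply: etrans (esym (congr1 TA (ext_sym_map_gen f v w))).
by rewrite TAE; apply: comparison_gen_map.
Qed.

(** The theorem asks for a map out of the graded piece, while naturality is proved for the map into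
    it; hence both are provided. *)
Lemma comparison_inverse (A : fgAbelian) : exists
  (S : {linear graded_piece (Phi n i) (Phi n i.+1) A -> ext_sym j i A})
  (T : {linear ext_sym j i A -> graded_piece (Phi n i) (Phi n i.+1) A}),
  [/\ forall v w, T (ten_gen (ext_gen v) (sym_gen w)) = comparison_gen v w,
      cancel T S & cancel S T].
Proof.
have [T TE] := comparison_exists n i A.
have [r [s [l [e [t [b basis]]]]]] := fg_basis (@fg_finitely_generated A).
have [lam lamE] := lam_exists basis; have [eta etaE] := eta_exists basis.
have Tinj := comparison_injective i_le basis lamE etaE TE.
have /choice[g gE] := comparison_surjective i_le basis lamE etaE TE.
have g_lin : linear g by move=> a x y; apply: Tinj; rewrite linearP !gE.
pose S : {linear graded_piece (Phi n i) (Phi n i.+1) A -> ext_sym j i A} :=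
  HB.pack g (GRing.isLinear.Build F2 _ _ _ g g_lin).
by exists S, T; split=> // x; apply: Tinj; rewrite gE.
Qed.

End Naturality.

Theorem corollary3p3 (n : nat) :
  exists Phi : nat -> subfunctor n,
    [/\ forall (A : fgAbelian) (x : cohomology 'F_2 n A), x \in Phi 0%N A,
        forall (i : nat) (A : fgAbelian), (i <= n./2)%N ->
          {subset Phi i.+1 A <= Phi i A},
        forall (A : fgAbelian) (x : cohomology 'F_2 n A),
          x \in Phi (n./2).+1 A -> x = 0%R &
        forall i : nat, (i <= n./2)%N ->
          exists iso : forall A : fgAbelian,
              {linear graded_piece (Phi i) (Phi i.+1) A ->
                      ext_sym (n - 2 * i) i A},
            (forall A : fgAbelian, bijective (iso A)) /\
            (forall (A B : fgAbelian) (f : {additive A -> B})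
                    (x : graded_piece (Phi i) (Phi i.+1) B),
               iso A (graded_piece_map (Phi i) (Phi i.+1) f x) =
               ext_sym_map (n - 2 * i) i f (iso B x))].
Proof.
exists (Phi n); split.
- exact: Phi0.
- by move=> i A _; apply: Phi_decr.
- exact: Phi_top.
move=> i i_le; pose inv A := cid (comparison_inverse i_le A).
exists (fun A => projT1 (inv A)); split=> [A|A B f x].
  by have [T [_ TK SK]] := projT2 (inv A); exists T.
have [TA [TAE TAK SAK]] := projT2 (inv A); have [TB [TBE TBK SBK]] := projT2 (inv B).
(* Naturality of the inverse follows by applying the injective [TA] to both sides. *)
apply: (can_inj TAK); rewrite SAK -(comparison_natural f TAE TBE).
exact: (congr1 _ (esym (SBK x))).
Qed.
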